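(* Let $n\ge 1$ be an integer and $x>0$ with $n/x=1/e$ (that is, $x=en$). Then, as $n\to\infty$, the scaled Touchard polynomial $\hat T_{n-1}(-x)$ has the asymptotic expansion $$\hat T_{n-1}(-x)\sim (-1)^{n-1}\,\frac{e^{x-n}}{3\pi}\sum_{m=0}^\infty \frac{(-1)^m B_m\,\Gamma\!\left(\frac{m+1}{3}\right)}{\left(\frac{n}{6}\right)^{(m+1)/3}}\,\sin\!\left(\frac{\pi(m+1)}{3}\right),$$ where $$B_0=1,\quad B_1=\frac{5}{6},\quad B_3=\frac{1463}{6480},\quad B_4=\frac{126827}{1088640},\quad B_6=\frac{4732223}{167961600},\ \ldots$$ are the coefficients $B_m$ defined in the context (the terms with $m=2,5,8,\ldots$ vanish because of the sine factor).
   Context: The Touchard (exponential) polynomials $T_n(z)$ are defined by $T_n(z)=e^{-z}\sum_{k=0}^\infty \frac{k^n z^k}{k!}$, equivalently $\exp[z(e^t-1)]=\sum_{n\ge0}T_n(z)\frac{t^n}{n!}$, equivalently $T_n(z)=\sum_{k=0}^n S(n,k)z^k$ with $S(n,k)$ the Stirling numbers of the second kind. The scaled Touchard polynomial is $\hat T_n(z)=\frac{1}{n!}T_n(z)$, so $\hat T_{n-1}(-x)=T_{n-1}(-x)/(n-1)!$. Coefficients $B_m$: let $\tau=\tau(s)$ be the power series, convergent near $s=0$ with $\tau(s)=s+O(s^2)$, determined by $$\frac{s^3}{6}=1-e^{\tau}-\log(1-\tau)=\frac{\tau^3}{3!}+\frac{5\tau^4}{4!}+\frac{23\tau^5}{5!}+\frac{119\tau^6}{6!}+\cdots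 .$$ Then the $B_m$ are defined by $\frac{d\tau}{ds}=\sum_{m\ge0}(-1)^mB_m s^m$. The symbol $\sim$ denotes an asymptotic expansion in the Poincaré sense: for every $M\ge 0$, after division by $(-1)^{n-1}e^{x-n}/(3\pi)$, the difference between the left-hand side and the partial sum over $0\le m\le M$ is $O(n^{-(M+2)/3})$ as $n\to\infty$. *)

(* Defs.v *)
From Stdlib Require Import Arith Reals.
From Coquelicot Require Import Coquelicot.
Open Scope R_scope.

(* [0 ^ 0 = 1] for [pow], so that [touchard 0 z = 1] as required. *)
Definition touchard (n : nat) (z : R) : R :=
  exp (- z) * Series (fun k => INR k ^ n * z ^ k / INR (fact k)).

Definition scaled_touchard (n : nat) (z : R) : R :=
  / INR (fact n) * touchard n z.

(* Euler's integral, improper at both ends (at 0 when [a < 1]); meaningful for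
   [0 < a] only. *)
Definition Gamma (a : R) : R :=
  RInt_gen (fun t => Rpower t (a - 1) * exp (- t))
           (at_right 0) (Rbar_locally p_infty).

(* [tau] is the sum of a power series near 0, [tau s = s + O(s^2)], and [tau]
   solves the defining equation near 0.  The second condition keeps
   [1 - tau s] positive for small [s], where [ln] is the genuine logarithm. *)
Definition is_tau (tau : R -> R) : Prop :=
  (exists a : nat -> R, locally 0 (fun s : R => is_pseries a s (tau s))) /\
  (exists C : R, locally 0 (fun s : R => Rabs (tau s - s) <= C * s ^ 2)) /\
  locally 0 (fun s : R => s ^ 3 / 6 = 1 - exp (tau s) - ln (1 - tau s)).

Definition is_dtau_coeffs (tau : R -> R) (B : nat -> R) : Prop :=
  locally 0 (fun s : R =>
    is_pseries (fun m => (-1) ^ m * B m) s (Derive tau s)).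

Definition expansion_term (B : nat -> R) (n m : nat) : R :=
  (-1) ^ m * B m * Gamma ((INR m + 1) / 3)
    / Rpower (INR n / 6) ((INR m + 1) / 3)
    * sin (PI * (INR m + 1) / 3).

(* Main.v *)
Require Import Defs.
From Stdlib Require Import Arith Reals Lra Lia.
From Coquelicot Require Import Coquelicot.
Open Scope R_scope.

(** With [x = e n], Cauchy's formula writes [T_{n-1}(-x) / (n-1)!], up to the factor
    [(-1)^n e^{x-n}], as the integral of [phase t ^ n / (2 i pi)] around the origin, where
    [phase (-1 + w) = exp (1 - e^w - log (1 - w))] has a double saddle at [w = 0].  The loop is
    symmetric under conjugation, so only the imaginary part over its upper half matters.  That half
    consists of an arc of a circle of radius at most 1, on which [|phase|] is largest at the end
    nearest the saddle and there less than 1, and of the curve [w = tau (u e^{i pi / 3})].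
    Along this curve [phase t ^ n] is [e^{- n u^3 / 6}] up to a small relative error and [dw] is given
    by [d tau / ds], so each coefficient [B_m] contributes a moment of [e^{- n u^3 / 6}], which is a
    value of Gamma.  Truncating [tau] to a polynomial avoids complex analytic continuation: the real
    equation satisfied by [tau] forces the low-order coefficients of a real polynomial to vanish, and
    this controls it in every complex direction.  The values of the [B_m] come from the polynomial
    differential equation obtained by eliminating [e^tau]. *)

(** * Differentiation of complex-valued functions of a real variable *)

(** The integral formula holds for every half loop, so the loop may depend on the order [M] and no
    contour has to be deformed. Holomorphy is replaced by derivatives along paths: the only residues
    needed, those of [e^{kt} / t^{n+1}], follow from integration by parts and the winding of [1/t].
    No complex logarithm is used. Along the saddle path [phase * e^{u^3/6}] solves a linear equation
    [f' = f k], where [k] is, up to bounded factors, the defect of the truncated series in the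
    differentiated equation for [tau]; a Gronwall estimate then keeps this product close to 1. The
    truncation has degree [M + 2]. Its defect is [O(u^{M+3})], which makes the relative error of the
    [n]-th power about [n u^{M+4}]. With [n = 6 r^3] and [u] of size [1/r], integration turns this
    into [r^{-(M+2)}], and the first omitted coefficient of [d tau / ds] contributes the same order,
    which is exactly the error claimed. The angle [PI / 3] makes the cube of the direction equal to
    -1, so [s^3 / 6] becomes [- u^3 / 6]; the imaginary parts of its powers are the sines of the
    expansion. *)

Lemma is_derive_Rmult (f g : R -> R) (x a b : R) :
  is_derive f x a -> is_derive g x b ->
  is_derive (fun v => f v * g v) x (a * g x + f x * b).
Proof.
  intros Hf Hg. apply (is_derive_mult f g x a b Hf Hg). exact Rmult_comm.
Qed.

Lemma is_derive_eq (f : R -> R) (x a b : R) :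
  is_derive f x a -> a = b -> is_derive f x b.
Proof. intros H <-. exact H. Qed.

Lemma is_derive_Rext (f g : R -> R) (x a : R) :
  (forall t, f t = g t) -> is_derive f x a -> is_derive g x a.
Proof. apply is_derive_ext. Qed.

Lemma is_derive_Rcomp (f g : R -> R) (x a b : R) :
  is_derive f (g x) a -> is_derive g x b -> is_derive (fun v => f (g v)) x (b * a).
Proof. intros Hf Hg. exact (is_derive_comp f g x a b Hf Hg). Qed.

(** The mean value theorem applied to [g - h]. With one of the two functions constant it serves as a
    monotonicity test. *)
Lemma incr_diff_le (h g dh dg : R -> R) (a b : R) :
  a <= b ->
  (forall u, a <= u <= b -> is_derive h u (dh u)) ->
  (forall u, a <= u <= b -> is_derive g u (dg u)) ->
  (forall u, a <= u <= b -> dh u <= dg u) ->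
  h b - h a <= g b - g a.
Proof.
  intros Hab Hh Hg Hle.
  assert (D : forall u, a <= u <= b -> is_derive (fun v => g v - h v) u (dg u - dh u)).
  { intros u Hu. exact (is_derive_minus g h u _ _ (Hg u Hu) (Hh u Hu)). }
  destruct (MVT_gen (fun v => g v - h v) a b (fun u => dg u - dh u)) as [c [Hc E]].
  - intros u Hu. rewrite Rmin_left, Rmax_right in Hu by lra. apply D; lra.
  - intros u Hu. rewrite Rmin_left, Rmax_right in Hu by lra.
    apply continuity_pt_filterlim, (ex_derive_continuous (fun v => g v - h v)).
    eexists. apply D; lra.
  - rewrite Rmin_left, Rmax_right in Hc by lra.
    assert (0 <= (dg c - dh c) * (b - a)).
    { apply Rmult_le_pos; [specialize (Hle c Hc)|]; lra. }
    lra.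
Qed.

Lemma exp_le_compat (x y : R) : x <= y -> exp x <= exp y.
Proof. intros [H|H]; [left; now apply exp_increasing | right; now rewrite H]. Qed.

Definition Cexp (z : C) : C := (exp (fst z) * cos (snd z), exp (fst z) * sin (snd z)).

Definition is_Cderive (f : R -> C) (u : R) (l : C) : Prop :=
  is_derive (fun v => fst (f v)) u (fst l) /\ is_derive (fun v => snd (f v)) u (snd l).

Definition Ccontinuous (f : R -> C) (u : R) : Prop :=
  continuous (fun v => fst (f v)) u /\ continuous (fun v => snd (f v)) u.

Lemma C_eq (z w : C) : fst z = fst w -> snd z = snd w -> z = w.
Proof. destruct z, w; simpl; intros; subst; reflexivity. Qed.

Lemma Im_le_Cmod (z : C) : Rabs (Im z) <= Cmod z.
Proof. eapply Rle_trans; [apply Rmax_r | apply Rmax_Cmod]. Qed.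

Lemma Cmod_sqr (z : C) : Cmod z * Cmod z = fst z * fst z + snd z * snd z.
Proof.
  unfold Cmod. rewrite sqrt_sqrt.
  - ring.
  - apply Rplus_le_le_0_compat; apply pow2_ge_0.
Qed.

Lemma Cexp_plus (z w : C) : Cexp (z + w) = (Cexp z * Cexp w)%C.
Proof.
  apply C_eq; simpl; rewrite exp_plus; [rewrite cos_plus | rewrite sin_plus]; ring.
Qed.

Lemma Cexp_0 : Cexp 0 = 1.
Proof. apply C_eq; simpl; rewrite exp_0, ?cos_0, ?sin_0; ring. Qed.

Lemma Cexp_RtoC (x : R) : Cexp (RtoC x) = RtoC (exp x).
Proof. apply C_eq; simpl; rewrite ?cos_0, ?sin_0; ring. Qed.

Lemma Cexp_pow (z : C) (n : nat) : (Cexp z ^ n)%C = Cexp (INR n * z).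
Proof.
  induction n as [|n IH].
  - simpl Cpow. rewrite Cmult_0_l. symmetry. apply Cexp_0.
  - rewrite Cpow_S, IH, <- Cexp_plus, S_INR, RtoC_plus. f_equal. ring.
Qed.

Lemma Cmod_Cexp (z : C) : Cmod (Cexp z) = exp (fst z).
Proof.
  apply Rsqr_inj; [apply Cmod_ge_0 | left; apply exp_pos |].
  unfold Rsqr. rewrite Cmod_sqr. simpl.
  assert (H := sin2_cos2 (snd z)). unfold Rsqr in H.
  replace (exp (fst z) * cos (snd z) * (exp (fst z) * cos (snd z)) +
    exp (fst z) * sin (snd z) * (exp (fst z) * sin (snd z)))
    with (exp (fst z) * exp (fst z) * (sin (snd z) * sin (snd z) + cos (snd z) * cos (snd z)))
    by ring.
  rewrite H. ring.
Qed.

Lemma Cmod_Cexp_le (z : C) : Cmod (Cexp z) <= exp (Cmod z).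
Proof.
  rewrite Cmod_Cexp. apply exp_le_compat.
  eapply Rle_trans; [apply Rle_abs | apply (re_le_Cmod z)].
Qed.

Lemma is_Cderive_eq (f : R -> C) (u : R) (a b : C) :
  is_Cderive f u a -> a = b -> is_Cderive f u b.
Proof. intros H <-. exact H. Qed.

Lemma is_Cderive_ext (f g : R -> C) (u : R) (a : C) :
  (forall v, f v = g v) -> is_Cderive f u a -> is_Cderive g u a.
Proof.
  intros E [H1 H2]. split.
  - apply (is_derive_ext (fun v => fst (f v))); [intros; now rewrite E | exact H1].
  - apply (is_derive_ext (fun v => snd (f v))); [intros; now rewrite E | exact H2].
Qed.

Lemma is_Cderive_const (c : C) (u : R) : is_Cderive (fun _ => c) u 0.
Proof.
  split; [exact (is_derive_const (V := R_NormedModule) (fst c) u)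
         | exact (is_derive_const (V := R_NormedModule) (snd c) u)].
Qed.

Lemma is_Cderive_RtoC (f : R -> R) (u a : R) :
  is_derive f u a -> is_Cderive (fun v => RtoC (f v)) u (RtoC a).
Proof. intros H. split; simpl; [exact H | exact (is_derive_const (V := R_NormedModule) 0 u)]. Qed.

Lemma is_Cderive_plus (f g : R -> C) (u : R) (a b : C) :
  is_Cderive f u a -> is_Cderive g u b ->
  is_Cderive (fun v => (f v + g v)%C) u (a + b)%C.
Proof.
  intros [F1 F2] [G1 G2]. split; simpl.
  - exact (is_derive_plus _ _ _ _ _ F1 G1).
  - exact (is_derive_plus _ _ _ _ _ F2 G2).
Qed.

Lemma is_Cderive_opp (f : R -> C) (u : R) (a : C) :
  is_Cderive f u a -> is_Cderive (fun v => (- f v)%C) u (- a)%C.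
Proof.
  intros [F1 F2]. split; simpl.
  - exact (is_derive_opp _ _ _ F1).
  - exact (is_derive_opp _ _ _ F2).
Qed.

Lemma is_Cderive_minus (f g : R -> C) (u : R) (a b : C) :
  is_Cderive f u a -> is_Cderive g u b ->
  is_Cderive (fun v => (f v - g v)%C) u (a - b)%C.
Proof. intros F G. apply is_Cderive_plus; [|apply is_Cderive_opp]; assumption. Qed.

Lemma is_Cderive_mult (f g : R -> C) (u : R) (a b : C) :
  is_Cderive f u a -> is_Cderive g u b ->
  is_Cderive (fun v => (f v * g v)%C) u (a * g u + f u * b)%C.
Proof.
  intros [F1 F2] [G1 G2]. split; simpl.
  - eapply is_derive_eq.
    + apply (is_derive_minus (fun v => fst (f v) * fst (g v)) (fun v => snd (f v) * snd (g v)));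
        apply is_derive_Rmult; eassumption.
    + unfold minus, plus, opp; simpl. ring.
  - eapply is_derive_eq.
    + apply (is_derive_plus (fun v => fst (f v) * snd (g v)) (fun v => snd (f v) * fst (g v)));
        apply is_derive_Rmult; eassumption.
    + unfold plus; simpl. ring.
Qed.

Lemma is_Cderive_Cexp (f : R -> C) (u : R) (a : C) :
  is_Cderive f u a -> is_Cderive (fun v => Cexp (f v)) u (a * Cexp (f u))%C.
Proof.
  intros [F1 F2]. split; simpl.
  - eapply is_derive_eq.
    + apply is_derive_Rmult.
      * apply (is_derive_Rcomp exp); [apply is_derive_exp | exact F1].
      * apply (is_derive_Rcomp cos); [apply is_derive_cos | exact F2].
    + simpl; ring.
  - eapply is_derive_eq.
    + apply is_derive_Rmult.
      * apply (is_derive_Rcomp exp); [apply is_derive_exp | exact F1].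
      * apply (is_derive_Rcomp sin); [apply is_derive_sin | exact F2].
    + simpl; ring.
Qed.

Lemma Cnorm2_pos (z : C) : z <> 0 -> 0 < fst z * fst z + snd z * snd z.
Proof.
  intros H. rewrite <- Cmod_sqr.
  assert (0 < Cmod z) by (apply Cmod_gt_0; exact H).
  apply Rmult_lt_0_compat; assumption.
Qed.

Lemma is_Cderive_inv (f : R -> C) (u : R) (a : C) :
  f u <> 0 -> is_Cderive f u a ->
  is_Cderive (fun v => (/ f v)%C) u (- a * (/ f u * / f u))%C.
Proof.
  intros Hf [F1 F2].
  assert (Hd := Cnorm2_pos _ Hf).
  assert (HD : is_derive (fun v => fst (f v) * (fst (f v) * 1) + snd (f v) * (snd (f v) * 1)) u
                 (2 * (fst a * fst (f u) + snd a * snd (f u)))).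
  { apply (is_derive_Rext (fun v => fst (f v) * fst (f v) + snd (f v) * snd (f v))).
    { intros t. ring. }
    eapply is_derive_eq.
    - apply (is_derive_plus (fun v => fst (f v) * fst (f v)) (fun v => snd (f v) * snd (f v)));
        apply is_derive_Rmult; eassumption.
    - unfold plus; simpl. ring. }
  assert (HI := is_derive_inv _ _ _ HD).
  split; simpl.
  - eapply is_derive_eq.
    + apply (is_derive_Rmult _ (fun v => / (fst (f v) * (fst (f v) * 1) + snd (f v) * (snd (f v) * 1)))).
      * exact F1.
      * apply HI. lra.
    + unfold plus, mult, scal; simpl. field. lra.
  - eapply is_derive_eq.
    + apply (is_derive_Rmult (fun v => - snd (f v)) (fun v => / (fst (f v) * (fst (f v) * 1) + snd (f v) * (snd (f v) * 1)))).
      * apply (is_derive_opp _ _ _ F2).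
      * apply HI. lra.
    + unfold opp, plus, mult, scal; simpl. field. lra.
Qed.

Lemma is_Cderive_pow (f : R -> C) (u : R) (a : C) (n : nat) :
  is_Cderive f u a ->
  is_Cderive (fun v => (f v ^ S n)%C) u (INR (S n) * f u ^ n * a)%C.
Proof.
  intros F. induction n as [|n IH].
  - apply (is_Cderive_ext f).
    + intros v. simpl. ring.
    + apply (is_Cderive_eq _ _ a); [exact F | simpl; ring].
  - apply (is_Cderive_ext (fun v => (f v * f v ^ S n)%C)).
    + reflexivity.
    + eapply is_Cderive_eq.
      * apply is_Cderive_mult; [exact F | exact IH].
      * rewrite (S_INR (S n)), RtoC_plus, !Cpow_S. ring.
Qed.

Lemma is_Cderive_continuous (f : R -> C) (u : R) (a : C) :
  is_Cderive f u a -> Ccontinuous f u.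
Proof.
  intros [F1 F2].
  split; apply (ex_derive_continuous (V := R_NormedModule)); eexists; eassumption.
Qed.

Lemma Ccontinuous_mult (f g : R -> C) (u : R) :
  Ccontinuous f u -> Ccontinuous g u -> Ccontinuous (fun v => (f v * g v)%C) u.
Proof.
  intros [F1 F2] [G1 G2]. split; simpl.
  - apply (continuous_minus (fun v => fst (f v) * fst (g v)) (fun v => snd (f v) * snd (g v)));
      apply (continuous_mult (K := R_AbsRing)); assumption.
  - apply (continuous_plus (fun v => fst (f v) * snd (g v)) (fun v => snd (f v) * fst (g v)));
      apply (continuous_mult (K := R_AbsRing)); assumption.
Qed.

(* Projecting on the direction of [f b - f a] avoids losing a constant factor. *)
Lemma Cderive_bound (f df : R -> C) (g dg : R -> R) (a b : R) :
  a <= b ->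
  (forall u, a <= u <= b -> is_Cderive f u (df u)) ->
  (forall u, a <= u <= b -> is_derive g u (dg u)) ->
  (forall u, a <= u <= b -> Cmod (df u) <= dg u) ->
  Cmod (f b - f a) <= g b - g a.
Proof.
  intros Hab Hf Hg Hle.
  set (d := (f b - f a)%C).
  assert (Hg0 : 0 <= g b - g a).
  { replace 0 with (0 - 0) by ring.
    apply (incr_diff_le (fun _ => 0) g (fun _ => 0) dg a b Hab).
    - intros u _. apply (is_derive_const (V := R_NormedModule)).
    - exact Hg.
    - intros u Hu. eapply Rle_trans; [apply Cmod_ge_0 | apply Hle, Hu]. }
  assert (H : fst d * fst (f b) + snd d * snd (f b) - (fst d * fst (f a) + snd d * snd (f a))
              <= Cmod d * g b - Cmod d * g a).
  { apply (incr_diff_le (fun v => fst d * fst (f v) + snd d * snd (f v)) (fun v => Cmod d * g v)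
            (fun v => fst d * fst (df v) + snd d * snd (df v)) (fun v => Cmod d * dg v) a b Hab).
    - intros u Hu. destruct (Hf u Hu) as [F1 F2].
      apply (is_derive_plus (fun v => fst d * fst (f v)) (fun v => snd d * snd (f v)));
        apply is_derive_scal; assumption.
    - intros u Hu. apply is_derive_scal, Hg, Hu.
    - intros u Hu.
      apply Rle_trans with (Cmod d * Cmod (df u)).
      + rewrite <- Cmod_conj, <- Cmod_mult.
        eapply Rle_trans; [|apply re_le_Cmod].
        eapply Rle_trans; [|apply Rle_abs].
        simpl. lra.
      + apply Rmult_le_compat_l; [apply Cmod_ge_0 | apply Hle, Hu]. }
  assert (E : Cmod d * Cmod d <= Cmod d * (g b - g a)).
  { rewrite Cmod_sqr. unfold d at 1 2 3 4. simpl. unfold d in H at 1 2 3 4; simpl in H. lra. }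
  destruct (Rle_lt_or_eq_dec 0 (Cmod d) (Cmod_ge_0 d)) as [Hd|Hd].
  - apply Rmult_le_reg_l with (Cmod d); assumption.
  - fold d. rewrite <- Hd. exact Hg0.
Qed.

(** * Path integrals *)

Fixpoint Csum (f : nat -> C) (n : nat) : C :=
  match n with
  | 0%nat => 0
  | S m => (Csum f m + f m)%C
  end.

Lemma Csum_ext (f g : nat -> C) (n : nat) :
  (forall j, (j < n)%nat -> f j = g j) -> Csum f n = Csum g n.
Proof.
  induction n as [|n IH]; intros H; simpl; [reflexivity|].
  rewrite IH, H; [reflexivity | lia | intros; apply H; lia].
Qed.

Lemma Csum_mult_r (f : nat -> C) (c : C) (n : nat) :
  (Csum f n * c)%C = Csum (fun j => (f j * c)%C) n.
Proof.
  induction n as [|n IH]; simpl; [ring|]. rewrite <- IH. ring.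
Qed.

Definition exp_partial (z : C) (L : nat) : C :=
  Csum (fun j => (z ^ j * / RtoC (INR (fact j)))%C) L.

Lemma INR_fact_C_neq_0 (n : nat) : RtoC (INR (fact n)) <> 0.
Proof. intros H. apply RtoC_inj in H. exact (INR_fact_neq_0 n H). Qed.

Lemma INR_S_neq_0 (n : nat) : INR (S n) <> 0.
Proof. apply not_0_INR. lia. Qed.

Lemma INR_S_C_neq_0 (n : nat) : RtoC (INR (S n)) <> 0.
Proof. intros H. apply RtoC_inj in H. exact (INR_S_neq_0 n H). Qed.

Lemma is_Cderive_exp_partial (f : R -> C) (u : R) (a : C) (L : nat) :
  is_Cderive f u a ->
  is_Cderive (fun v => exp_partial (f v) (S L)) u (a * exp_partial (f u) L)%C.
Proof.
  intros F. unfold exp_partial. induction L as [|L IH].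
  - apply (is_Cderive_ext (fun _ => (0 + 1 * / RtoC (INR (fact 0)))%C)).
    + reflexivity.
    + eapply is_Cderive_eq; [apply is_Cderive_const | simpl; ring].
  - apply (is_Cderive_ext (fun v => (Csum (fun j => (f v ^ j * / RtoC (INR (fact j)))%C) (S L) +
              f v ^ S L * / RtoC (INR (fact (S L))))%C)).
    + reflexivity.
    + eapply is_Cderive_eq.
      * apply is_Cderive_plus; [exact IH|].
        apply is_Cderive_mult; [apply is_Cderive_pow; exact F | apply is_Cderive_const].
      * simpl Csum. rewrite fact_simpl, mult_INR, RtoC_mult.
        field. split; [apply INR_fact_C_neq_0 | apply INR_S_C_neq_0].
Qed.

Lemma exp_partial_0 (L : nat) : exp_partial 0 (S L) = 1.
Proof.
  unfold exp_partial. induction L as [|L IH].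
  - simpl. field.
  - change (Csum (fun j => (0 ^ j * / RtoC (INR (fact j)))%C) (S L) +
              0 ^ S L * / RtoC (INR (fact (S L))) = 1)%C.
    rewrite IH, Cpow_S. ring.
Qed.

(** Along the segment from 0 to [z], the remainder of order [L + 1] has derivative [z] times the
    remainder of order [L], so the bound follows by integrating once per step of the induction. *)
Lemma Cexp_taylor_bound (z : C) (L : nat) :
  Cmod (Cexp z - exp_partial z L) <= Cmod z ^ L / INR (fact L) * exp (Cmod z).
Proof.
  (* The factor [exp (Cmod z)] does not depend on [u], so only the power of [u] is integrated. *)
  assert (H : forall u, 0 <= u <= 1 ->
    Cmod (Cexp (u * z) - exp_partial (u * z) L) <= (u * Cmod z) ^ L / INR (fact L) * exp (Cmod z)).
  { induction L as [|L IH]; intros u Hu.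
    - unfold exp_partial. simpl. replace (Cexp (u * z) - 0)%C with (Cexp (u * z)) by ring.
      replace (1 / 1 * exp (Cmod z)) with (exp (Cmod z)) by field.
      eapply Rle_trans; [apply Cmod_Cexp_le|]. apply exp_le_compat.
      rewrite Cmod_mult, Cmod_R, Rabs_pos_eq by lra.
      assert (0 <= Cmod z) by apply Cmod_ge_0. nra.
    - assert (D : forall v, is_Cderive (fun v => (RtoC v * z)%C) v z).
      { intros v. eapply is_Cderive_eq.
        - apply is_Cderive_mult; [apply is_Cderive_RtoC, is_derive_id | apply is_Cderive_const].
        - unfold one; simpl. ring. }
      assert (B := Cderive_bound (fun v => (Cexp (v * z) - exp_partial (v * z) (S L))%C)
        (fun v => (z * (Cexp (v * z) - exp_partial (v * z) L))%C)
        (fun v => (v * Cmod z) ^ S L / INR (fact (S L)) * exp (Cmod z))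
        (fun v => Cmod z * ((v * Cmod z) ^ L / INR (fact L) * exp (Cmod z))) 0 u).
      cbv beta in B. rewrite Cmult_0_l, Cexp_0, exp_partial_0 in B.
      match type of B with _ -> _ -> _ -> _ -> Cmod ?a <= ?b =>
        replace a with (Cexp (u * z) - exp_partial (u * z) (S L))%C in B by ring;
        replace b with ((u * Cmod z) ^ S L / INR (fact (S L)) * exp (Cmod z)) in B
          by (rewrite Rmult_0_l, pow_ne_zero by discriminate; unfold Rdiv; ring) end.
      apply B; clear B.
      + lra.
      + intros v Hv. eapply is_Cderive_eq.
        * apply is_Cderive_minus; [apply is_Cderive_Cexp, D | apply is_Cderive_exp_partial, D].
        * cbv beta. ring.
      + intros v Hv.
        apply (is_derive_Rext (fun v => / INR (fact (S L)) * exp (Cmod z) * (v * Cmod z) ^ S L)).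
        { intros t. unfold Rdiv. ring. }
        eapply is_derive_eq.
        * apply is_derive_scal, is_derive_pow.
          apply (is_derive_Rmult (fun t => t) (fun _ => Cmod z) v 1 0).
          -- exact (is_derive_id v).
          -- exact (is_derive_const (V := R_NormedModule) (Cmod z) v).
        * rewrite fact_simpl, mult_INR. simpl pred.
          field. split; [apply INR_fact_neq_0 | apply INR_S_neq_0].
      + intros v Hv. rewrite Cmod_mult. apply Rmult_le_compat_l; [apply Cmod_ge_0|].
        apply IH. lra. }
  specialize (H 1 ltac:(lra)). rewrite Cmult_1_l, Rmult_1_l in H. exact H.
Qed.

(* Stands in for complex differentiability of [F] off the origin, with derivative [f]. *)
Definition path_derive (F f : C -> C) : Prop :=
  forall (g : R -> C) (u : R) (a : C), g u <> 0 -> is_Cderive g u a ->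
    is_Cderive (fun v => F (g v)) u (f (g u) * a)%C.

Lemma path_derive_eq (F f g : C -> C) :
  path_derive F f -> (forall z : C, z <> 0 -> f z = g z) -> path_derive F g.
Proof. intros H E h u a Hu D. rewrite <- E by exact Hu. now apply H. Qed.

Lemma path_derive_const (c : C) : path_derive (fun _ => c) (fun _ => 0).
Proof.
  intros g u a _ _. eapply is_Cderive_eq; [apply is_Cderive_const | ring].
Qed.

Lemma path_derive_id : path_derive (fun z => z) (fun _ => 1).
Proof. intros g u a _ D. eapply is_Cderive_eq; [exact D | ring]. Qed.

Lemma path_derive_plus (F f G g : C -> C) :
  path_derive F f -> path_derive G g ->
  path_derive (fun z => (F z + G z)%C) (fun z => (f z + g z)%C).
Proof.
  intros HF HG h u a Hu D. eapply is_Cderive_eq.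
  - apply is_Cderive_plus; [apply HF; eassumption | apply HG; eassumption].
  - ring.
Qed.

Lemma path_derive_mult (F f G g : C -> C) :
  path_derive F f -> path_derive G g ->
  path_derive (fun z => (F z * G z)%C) (fun z => (f z * G z + F z * g z)%C).
Proof.
  intros HF HG h u a Hu D. eapply is_Cderive_eq.
  - apply is_Cderive_mult; [apply HF; eassumption | apply HG; eassumption].
  - simpl. ring.
Qed.

Lemma path_derive_scal (c : C) (F f : C -> C) :
  path_derive F f -> path_derive (fun z => (c * F z)%C) (fun z => (c * f z)%C).
Proof.
  intros HF. eapply path_derive_eq.
  - apply path_derive_mult; [apply (path_derive_const c) | exact HF].
  - intros z _. simpl. ring.
Qed.

Lemma path_derive_Cexp (F f : C -> C) :
  path_derive F f -> path_derive (fun z => Cexp (F z)) (fun z => (f z * Cexp (F z))%C).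
Proof.
  intros HF h u a Hu D. eapply is_Cderive_eq.
  - apply is_Cderive_Cexp. apply HF; eassumption.
  - simpl. ring.
Qed.

Lemma path_derive_pow (F f : C -> C) (n : nat) :
  path_derive F f ->
  path_derive (fun z => (F z ^ S n)%C) (fun z => (INR (S n) * F z ^ n * f z)%C).
Proof.
  intros HF h u a Hu D. eapply is_Cderive_eq.
  - apply is_Cderive_pow. apply HF; eassumption.
  - simpl. ring.
Qed.

Lemma path_derive_inv : path_derive (fun z => (/ z)%C) (fun z => (- (/ z * / z))%C).
Proof.
  intros h u a Hu D. eapply is_Cderive_eq.
  - apply is_Cderive_inv; eassumption.
  - ring.
Qed.

(** Acts as a certificate of continuity along paths, hence of integrability and boundedness, which
    is stable under the operations building the integrands. *)
Definition path_derivable (F : C -> C) : Prop := exists f, path_derive F f.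

Lemma path_derivable_mult (F G : C -> C) :
  path_derivable F -> path_derivable G -> path_derivable (fun z => (F z * G z)%C).
Proof. intros [f HF] [g HG]. eexists. apply path_derive_mult; eassumption. Qed.

Lemma path_derivable_plus (F G : C -> C) :
  path_derivable F -> path_derivable G -> path_derivable (fun z => (F z + G z)%C).
Proof. intros [f HF] [g HG]. eexists. apply path_derive_plus; eassumption. Qed.

Lemma path_derivable_const (c : C) : path_derivable (fun _ => c).
Proof. eexists. apply path_derive_const. Qed.

Lemma path_derivable_Cexp (F : C -> C) :
  path_derivable F -> path_derivable (fun z => Cexp (F z)).
Proof. intros [f HF]. eexists. apply path_derive_Cexp; eassumption. Qed.

Lemma path_derivable_id : path_derivable (fun z => z).
Proof. eexists. apply path_derive_id. Qed.

Lemma path_derivable_inv : path_derivable (fun z => (/ z)%C).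
Proof. eexists. apply path_derive_inv. Qed.

Lemma path_derivable_pow (F : C -> C) (n : nat) :
  path_derivable F -> path_derivable (fun z => (F z ^ n)%C).
Proof.
  intros [f HF]. destruct n as [|n].
  - apply (path_derivable_const 1).
  - eexists. apply path_derive_pow; eassumption.
Qed.

Lemma path_derivable_Csum (F : nat -> C -> C) (n : nat) :
  (forall j, path_derivable (F j)) -> path_derivable (fun z => Csum (fun j => F j z) n).
Proof.
  intros H. induction n as [|n IH]; simpl.
  - apply path_derivable_const.
  - apply path_derivable_plus; [exact IH | apply H].
Qed.

(** The velocity is data, so that integrals can be written without a derivative operator; [path_ok]
    states that it is the derivative of [pt]. *)
Record path : Type := Path { pt : R -> C; vel : R -> C; len : R }.

Definition path_ok (p : path) : Prop :=
  0 <= len p /\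
  forall u, 0 <= u <= len p ->
    pt p u <> 0 /\ is_Cderive (pt p) u (vel p u) /\ Ccontinuous (vel p) u.

Definition Im_int (p : path) (f : C -> C) : R :=
  RInt (fun u => Im (f (pt p u) * vel p u)) 0 (len p).

Lemma path_integrand_continuous (p : path) (f : C -> C) (u : R) :
  path_ok p -> path_derivable f -> 0 <= u <= len p ->
  continuous (fun u => Im (f (pt p u) * vel p u)) u.
Proof.
  intros [_ Hp] [f' Hf] Hu. destruct (Hp u Hu) as [H0 [Hd Hc]].
  apply (Ccontinuous_mult (fun u => f (pt p u)) (vel p) u); [|exact Hc].
  eapply is_Cderive_continuous. apply Hf; eassumption.
Qed.

Lemma path_integrand_ex_RInt (p : path) (f : C -> C) :
  path_ok p -> path_derivable f ->
  ex_RInt (fun u => Im (f (pt p u) * vel p u)) 0 (len p).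
Proof.
  intros Hp Hf. apply (ex_RInt_continuous (V := R_CompleteNormedModule)).
  intros u Hu. rewrite Rmin_left, Rmax_right in Hu by apply Hp.
  now apply path_integrand_continuous.
Qed.

Lemma Im_int_ext (p : path) (f g : C -> C) :
  path_ok p -> (forall z : C, z <> 0 -> f z = g z) -> Im_int p f = Im_int p g.
Proof.
  intros Hp E. apply RInt_ext. intros u Hu.
  rewrite Rmin_left, Rmax_right in Hu by apply Hp.
  rewrite E; [reflexivity|]. apply Hp; lra.
Qed.

Lemma Im_int_plus (p : path) (f g : C -> C) :
  path_ok p -> path_derivable f -> path_derivable g ->
  Im_int p (fun z => (f z + g z)%C) = Im_int p f + Im_int p g.
Proof.
  intros Hp Hf Hg. unfold Im_int.
  rewrite <- (RInt_plus (V := R_CompleteNormedModule)) by now apply path_integrand_ex_RInt.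
  apply RInt_ext. intros u _. unfold plus; simpl. ring.
Qed.

Lemma Im_int_scal (p : path) (c : R) (f : C -> C) :
  path_ok p -> path_derivable f ->
  Im_int p (fun z => (c * f z)%C) = c * Im_int p f.
Proof.
  intros Hp Hf. unfold Im_int.
  rewrite <- (RInt_scal (V := R_CompleteNormedModule)) by now apply path_integrand_ex_RInt.
  apply RInt_ext. intros u _. unfold scal; simpl. unfold mult; simpl. ring.
Qed.

Lemma Im_int_primitive (p : path) (F f : C -> C) :
  path_ok p -> path_derive F f -> path_derivable f ->
  Im_int p f = Im (F (pt p (len p))) - Im (F (pt p 0)).
Proof.
  intros Hp HF Hf. apply is_RInt_unique.
  apply (is_RInt_derive (V := R_CompleteNormedModule) (fun u => Im (F (pt p u)))).
  - intros u Hu. rewrite Rmin_left, Rmax_right in Hu by apply Hp.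
    destruct Hp as [_ Hp]. destruct (Hp u Hu) as [H0 [Hd _]].
    exact (proj2 (HF _ _ _ H0 Hd)).
  - intros u Hu. rewrite Rmin_left, Rmax_right in Hu by apply Hp.
    now apply path_integrand_continuous.
Qed.

Lemma Ccontinuous_bounded (f : R -> C) (b : R) :
  (forall u, 0 <= u <= b -> Ccontinuous f u) ->
  exists M, 0 < M /\ forall u, 0 <= u <= b -> Cmod (f u) <= M.
Proof.
  intros H.
  destruct (bounded_continuity (V := R_NormedModule) (fun u => fst (f u)) 0 b) as [M1 H1].
  { intros u Hu. apply H, Hu. }
  destruct (bounded_continuity (V := R_NormedModule) (fun u => snd (f u)) 0 b) as [M2 H2].
  { intros u Hu. apply H, Hu. }
  exists (Rabs M1 + Rabs M2 + 1). split.
  { assert (0 <= Rabs M1) by apply Rabs_pos. assert (0 <= Rabs M2) by apply Rabs_pos. lra. }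
  intros u Hu. specialize (H1 u Hu). specialize (H2 u Hu).
  change (Rabs (fst (f u)) < M1) in H1. change (Rabs (snd (f u)) < M2) in H2.
  replace (f u) with (RtoC (fst (f u)) + Ci * RtoC (snd (f u)))%C
    by (apply C_eq; simpl; ring).
  eapply Rle_trans; [apply Cmod_triangle|].
  rewrite Cmod_mult, Cmod_Ci, !Cmod_R.
  assert (M1 <= Rabs M1) by apply Rle_abs. assert (M2 <= Rabs M2) by apply Rle_abs. lra.
Qed.

Lemma path_derivable_bounded (p : path) (f : C -> C) :
  path_ok p -> path_derivable f ->
  exists M, 0 < M /\ forall u, 0 <= u <= len p -> Cmod (f (pt p u)) <= M.
Proof.
  intros [_ Hp] [f' Hf]. apply (Ccontinuous_bounded (fun u => f (pt p u))).
  intros u Hu. destruct (Hp u Hu) as [H0 [Hd _]].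
  eapply is_Cderive_continuous. apply Hf; eassumption.
Qed.

(** Length times maximum. The constant is chosen before [f], so it serves all powers [phase ^ n] and
    all Taylor polynomials at once. *)
Lemma Im_int_bound (p : path) :
  path_ok p -> exists K, 0 < K /\ forall (f : C -> C) (e : R), path_derivable f ->
    (forall u, 0 <= u <= len p -> Cmod (f (pt p u)) <= e) -> Rabs (Im_int p f) <= K * e.
Proof.
  intros Hp. destruct (Ccontinuous_bounded (vel p) (len p)) as [V [HV HV']].
  { intros u Hu. now apply Hp. }
  assert (Hl : 0 <= len p) by apply Hp.
  (* Adding 1 keeps the constant positive for a path of length 0. *)
  exists ((len p + 1) * V). split; [nra|].
  intros f e Hf He.
  assert (e0 : 0 <= e) by (eapply Rle_trans; [apply Cmod_ge_0 | apply (He 0); lra]).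
  apply Rle_trans with ((len p - 0) * (e * V)).
  - apply abs_RInt_le_const; [exact Hl | now apply path_integrand_ex_RInt |].
    intros u Hu. eapply Rle_trans; [apply Im_le_Cmod|]. rewrite Cmod_mult.
    apply Rmult_le_compat; try apply Cmod_ge_0; auto.
  - assert (0 <= e * V) by nra. nra.
Qed.

(** * Touchard polynomials as contour integrals *)

Definition contour_int (p q : path) (f : C -> C) : R := Im_int p f - Im_int q f.

(* [p] followed by the reverse of [q] is a path in the punctured plane between two real points
   along which the argument grows by [PI]: the upper half of a loop around the origin. *)
Definition half_loop (p q : path) : Prop :=
  path_ok p /\ path_ok q /\
  Im (pt p 0) = 0 /\ Im (pt q 0) = 0 /\ pt p (len p) = pt q (len q) /\
  contour_int p q Cinv = PI.

Lemma contour_int_ext (p q : path) (f g : C -> C) :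
  half_loop p q -> (forall z : C, z <> 0 -> f z = g z) -> contour_int p q f = contour_int p q g.
Proof.
  intros [Hp [Hq _]] E. unfold contour_int.
  rewrite (Im_int_ext p f g), (Im_int_ext q f g); auto.
Qed.

Lemma contour_int_plus (p q : path) (f g : C -> C) :
  half_loop p q -> path_derivable f -> path_derivable g ->
  contour_int p q (fun z => (f z + g z)%C) = contour_int p q f + contour_int p q g.
Proof.
  intros [Hp [Hq _]] Hf Hg. unfold contour_int. rewrite !Im_int_plus by assumption. ring.
Qed.

Lemma contour_int_scal (p q : path) (c : R) (f : C -> C) :
  half_loop p q -> path_derivable f ->
  contour_int p q (fun z => (c * f z)%C) = c * contour_int p q f.
Proof.
  intros [Hp [Hq _]] Hf. unfold contour_int. rewrite !Im_int_scal by assumption. ring.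
Qed.

(** The values of the primitive at the common endpoint cancel, and at the two real starting points
    they have no imaginary part. *)
Lemma contour_int_primitive (p q : path) (F f : C -> C) :
  half_loop p q -> path_derive F f -> path_derivable f ->
  (forall x : R, Im (F x) = 0) -> contour_int p q f = 0.
Proof.
  intros [Hp [Hq [Hp0 [Hq0 [E _]]]]] HF Hf HR. unfold contour_int.
  rewrite !(Im_int_primitive _ F f) by assumption. rewrite E.
  replace (pt p 0) with (RtoC (fst (pt p 0))) by (apply C_eq; [reflexivity | symmetry; exact Hp0]).
  replace (pt q 0) with (RtoC (fst (pt q 0))) by (apply C_eq; [reflexivity | symmetry; exact Hq0]).
  rewrite !HR. ring.
Qed.

Lemma contour_int_sub_bound (p q : path) :
  half_loop p q -> exists K, 0 < K /\ forall (f g : C -> C) (e : R),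
    path_derivable f -> path_derivable g ->
    (forall u, 0 <= u <= len p -> Cmod (f (pt p u) - g (pt p u)) <= e) ->
    (forall u, 0 <= u <= len q -> Cmod (f (pt q u) - g (pt q u)) <= e) ->
    Rabs (contour_int p q f - contour_int p q g) <= K * e.
Proof.
  intros H. assert (H' := H). destruct H' as [Hp [Hq _]].
  destruct (Im_int_bound p Hp) as [K1 [HK1 B1]].
  destruct (Im_int_bound q Hq) as [K2 [HK2 B2]].
  exists (K1 + K2). split; [lra|]. intros f g e Hf Hg Ep Eq.
  assert (Hd : path_derivable (fun z => (f z + RtoC (-1) * g z)%C)).
  { apply path_derivable_plus; [exact Hf|].
    apply path_derivable_mult; [apply path_derivable_const | exact Hg]. }
  assert (E : contour_int p q f - contour_int p q g =
              contour_int p q (fun z => (f z + RtoC (-1) * g z)%C)).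
  { rewrite contour_int_plus, contour_int_scal; auto.
    - ring.
    - apply path_derivable_mult; [apply path_derivable_const | exact Hg]. }
  rewrite E. unfold contour_int.
  assert (M : forall a b : C, (a + RtoC (-1) * b)%C = (a - b)%C).
  { intros a b. apply C_eq; simpl; ring. }
  assert (C1 := B1 _ e Hd (fun u Hu => eq_ind_r (fun z => Cmod z <= e) (Ep u Hu) (M _ _))).
  assert (C2 := B2 _ e Hd (fun u Hu => eq_ind_r (fun z => Cmod z <= e) (Eq u Hu) (M _ _))).
  eapply Rle_trans; [apply Rabs_triang|]. rewrite Rabs_Ropp. lra.
Qed.

Lemma pow_fact_lim (A K : R) : is_lim_seq (fun J => K * (A ^ J / INR (fact J))) 0.
Proof.
  replace (Finite 0) with (Rbar_mult K 0) by (simpl; f_equal; ring).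
  apply is_lim_seq_scal_l. apply is_lim_seq_Reals.
  intros eps Heps. destruct (cv_speed_pow_fact A eps Heps) as [N HN].
  exists N. exact HN.
Qed.

(** The exchange of limit and integral is only needed for exponential series, hence a hypothesis of
    uniform convergence at factorial speed. *)
Lemma contour_int_lim (p q : path) (f : C -> C) (fs : nat -> C -> C) (A K : R) :
  half_loop p q -> path_derivable f -> (forall J, path_derivable (fs J)) ->
  (forall J u, 0 <= u <= len p -> Cmod (fs J (pt p u) - f (pt p u)) <= K * (A ^ J / INR (fact J))) ->
  (forall J u, 0 <= u <= len q -> Cmod (fs J (pt q u) - f (pt q u)) <= K * (A ^ J / INR (fact J))) ->
  is_lim_seq (fun J => contour_int p q (fs J)) (contour_int p q f).
Proof.
  intros H Hf Hfs Bp Bq.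
  destruct (contour_int_sub_bound p q H) as [M [HM B]].
  assert (L := pow_fact_lim A (M * K)).
  apply is_lim_seq_spec. apply is_lim_seq_spec in L.
  intros eps. destruct (L eps) as [N HN]. exists N. intros n Hn.
  specialize (HN n Hn). specialize (B (fs n) f _ (Hfs n) Hf (Bp n) (Bq n)).
  eapply Rle_lt_trans; [exact B|].
  rewrite Rminus_0_r in HN. eapply Rle_lt_trans; [|exact HN].
  rewrite <- Rmult_assoc. apply Rle_abs.
Qed.

Definition is_real (z : C) : Prop := Im z = 0.

Lemma is_real_RtoC (x : R) : is_real (RtoC x).
Proof. reflexivity. Qed.

Lemma is_real_mult (z w : C) : is_real z -> is_real w -> is_real (z * w).
Proof. unfold is_real, Im; intros Hz Hw; simpl; rewrite Hz, Hw; ring. Qed.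

Lemma is_real_inv (z : C) : is_real z -> is_real (/ z).
Proof. unfold is_real, Im; intros Hz; simpl; rewrite Hz; unfold Rdiv; ring. Qed.

Lemma is_real_pow (z : C) (n : nat) : is_real z -> is_real (z ^ n).
Proof.
  intros H. induction n as [|n IH]; [reflexivity|].
  rewrite Cpow_S. now apply is_real_mult.
Qed.

Lemma is_real_Cexp (z : C) : is_real z -> is_real (Cexp z).
Proof. unfold is_real, Im; intros Hz; simpl; rewrite Hz, sin_0; ring. Qed.

Lemma path_derivable_exp_partial (F : C -> C) (J : nat) :
  path_derivable F -> path_derivable (fun z => exp_partial (F z) J).
Proof.
  intros H. unfold exp_partial. apply path_derivable_Csum. intros j.
  apply path_derivable_mult; [now apply path_derivable_pow | apply path_derivable_const].
Qed.

Lemma path_derivable_linear (k : C) : path_derivable (fun t => (k * t)%C).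
Proof. apply path_derivable_mult; [apply path_derivable_const | apply path_derivable_id]. Qed.

(** Only the term [1/t] contributes: every further term is a real multiple of a power of [t] and has
    a primitive that is real on the real axis. *)
Lemma contour_int_exp_partial_over_id (p q : path) (k : R) (J : nat) :
  half_loop p q -> contour_int p q (fun t => (exp_partial (k * t) (S J) * / t)%C) = PI.
Proof.
  intros H. induction J as [|J IH].
  - rewrite (contour_int_ext p q _ Cinv H); [apply H|].
    intros z Hz. unfold exp_partial. simpl. field. exact Hz.
  - rewrite (contour_int_ext p q _ (fun t => (exp_partial (k * t) (S J) * / t +
      RtoC (k ^ S J / INR (fact (S J))) * t ^ J)%C) H).
    + rewrite contour_int_plus, IH, contour_int_scal; auto.
      * rewrite (contour_int_primitive p q (fun t => (RtoC (/ INR (S J)) * t ^ S J)%C)); auto.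
        -- ring.
        -- eapply path_derive_eq.
           ++ apply path_derive_scal, path_derive_pow, path_derive_id.
           ++ intros z _. rewrite RtoC_inv by apply INR_S_neq_0. field. apply INR_S_C_neq_0.
        -- apply path_derivable_pow, path_derivable_id.
        -- intros x. apply is_real_mult; [apply is_real_RtoC | apply is_real_pow, is_real_RtoC].
      * apply path_derivable_pow, path_derivable_id.
      * apply path_derivable_mult; [|apply path_derivable_inv].
        apply path_derivable_exp_partial, path_derivable_linear.
      * apply path_derivable_mult; [apply path_derivable_const|].
        apply path_derivable_pow, path_derivable_id.
    + intros z Hz. unfold exp_partial at 1.
      change (Csum ?f (S (S J))) with (Csum f (S J) + f (S J))%C. cbv beta.
      fold (exp_partial (k * z) (S J)).
      rewrite RtoC_div, RtoC_pow, Cpow_mult_l, (Cpow_S z) by apply INR_fact_neq_0.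
      field. split; [apply INR_fact_C_neq_0 | exact Hz].
Qed.

Lemma contour_int_exp_over_id (p q : path) (k : R) :
  half_loop p q -> contour_int p q (fun t => (Cexp (k * t) * / t)%C) = PI.
Proof.
  intros H. assert (H' := H). destruct H' as [Hp [Hq _]].
  assert (Hi : path_derivable (fun t => (/ t)%C)) by apply path_derivable_inv.
  destruct (path_derivable_bounded p _ Hp Hi) as [Ip [Ip0 HIp]].
  destruct (path_derivable_bounded q _ Hq Hi) as [Iq [Iq0 HIq]].
  destruct (path_derivable_bounded p _ Hp (path_derivable_linear k)) as [Ap [Ap0 HAp]].
  destruct (path_derivable_bounded q _ Hq (path_derivable_linear k)) as [Aq [Aq0 HAq]].
  set (A := Ap + Aq). set (I := Ip + Iq).
  (* The Taylor polynomial has [S J] terms, so its error carries [A^(J+1) / (J+1)!]; one factor [A]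
     is moved to the constant and [1/(J+1)] is bounded by 1. *)
  assert (B : forall (z : C) J, Cmod (k * z) <= A -> Cmod (/ z) <= I ->
    Cmod (exp_partial (k * z) (S J) * / z - Cexp (k * z) * / z)
      <= I * exp A * A * (A ^ J / INR (fact J))).
  { intros z J HA HI.
    replace (exp_partial (k * z) (S J) * / z - Cexp (k * z) * / z)%C
      with (- ((Cexp (k * z) - exp_partial (k * z) (S J)) * / z))%C by ring.
    rewrite Cmod_opp, Cmod_mult.
    apply Rle_trans with (A ^ S J / INR (fact (S J)) * exp A * I).
    - apply Rmult_le_compat; try apply Cmod_ge_0; [|exact HI].
      eapply Rle_trans; [apply Cexp_taylor_bound|].
      apply Rmult_le_compat.
      + apply Rmult_le_pos; [apply pow_le, Cmod_ge_0|].
        left. apply Rinv_0_lt_compat, INR_fact_lt_0.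
      + left; apply exp_pos.
      + apply Rmult_le_compat_r; [left; apply Rinv_0_lt_compat, INR_fact_lt_0|].
        apply pow_incr. split; [apply Cmod_ge_0 | exact HA].
      + apply exp_le_compat, HA.
    - rewrite fact_simpl, mult_INR.
      replace (A ^ S J / (INR (S J) * INR (fact J)) * exp A * I)
        with (I * exp A * A * (A ^ J / INR (fact J)) * / INR (S J))
        by (simpl pow; field; split; [apply INR_fact_neq_0 | apply INR_S_neq_0]).
      rewrite <- (Rmult_1_r (I * exp A * A * (A ^ J / INR (fact J)))) at 2.
      apply Rmult_le_compat_l.
      + assert (0 < INR (fact J)) by apply INR_fact_lt_0.
        assert (0 <= A ^ J) by (apply pow_le; unfold A; lra).
        assert (0 < exp A) by apply exp_pos.
        repeat apply Rmult_le_pos; try lra; try (unfold I, A; lra).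
        left. now apply Rinv_0_lt_compat.
      + rewrite <- Rinv_1. apply Rinv_le_contravar; [lra|].
        rewrite S_INR. assert (0 <= INR J) by apply pos_INR. lra. }
  assert (L : is_lim_seq (fun J => contour_int p q
                (fun t => (exp_partial (k * t) (S J) * / t)%C))
                (contour_int p q (fun t => (Cexp (k * t) * / t)%C))).
  { apply (contour_int_lim p q _ (fun J t => (exp_partial (k * t) (S J) * / t)%C) A
             (I * exp A * A) H).
    - apply path_derivable_mult; [apply path_derivable_Cexp, path_derivable_linear | exact Hi].
    - intros J. apply path_derivable_mult; [|exact Hi].
      apply path_derivable_exp_partial, path_derivable_linear.
    - intros J u Hu. apply B; unfold A, I.
      + specialize (HAp u Hu). lra.
      + specialize (HIp u Hu). lra.
    - intros J u Hu. apply B; unfold A, I.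
      + specialize (HAq u Hu). lra.
      + specialize (HIq u Hu). lra. }
  assert (L' : is_lim_seq (fun J => contour_int p q
                (fun t => (exp_partial (k * t) (S J) * / t)%C)) PI).
  { apply (is_lim_seq_ext (fun _ => PI)); [|apply is_lim_seq_const].
    intros J. symmetry. now apply contour_int_exp_partial_over_id. }
  apply is_lim_seq_unique in L. apply is_lim_seq_unique in L'.
  rewrite L in L'. now injection L'.
Qed.

(** Integration by parts lowers the order of the pole down to the simple pole; this replaces the
    residue theorem. *)
Lemma contour_int_exp_over_pow (p q : path) (k : R) (n : nat) :
  half_loop p q ->
  contour_int p q (fun t => (Cexp (k * t) * (/ t) ^ S n)%C) = PI * k ^ n / INR (fact n).
Proof.
  intros H. induction n as [|n IH].
  - rewrite (contour_int_ext p q _ (fun t => (Cexp (k * t) * / t)%C) H).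
    + rewrite contour_int_exp_over_id by exact H. simpl. field.
    + intros z _. rewrite Cpow_1_r. reflexivity.
  - set (f := fun m t => (Cexp (k * t) * (/ t) ^ m)%C).
    assert (Df : forall m, path_derivable (f m)).
    { intros m. apply path_derivable_mult.
      - apply path_derivable_Cexp, path_derivable_linear.
      - apply path_derivable_pow, path_derivable_inv. }
    change (contour_int p q (f (S (S n))) = PI * k ^ S n / INR (fact (S n))).
    change (contour_int p q (f (S n)) = PI * k ^ n / INR (fact n)) in IH.
    (* This integrand is the derivative of [f (S n)]. *)
    assert (E : contour_int p q (fun t => (RtoC k * f (S n) t + RtoC (- INR (S n)) * f (S (S n)) t)%C) = 0).
    { apply (contour_int_primitive p q (f (S n))); [exact H | | |].
      - eapply path_derive_eq.
        + apply path_derive_mult.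
          * apply path_derive_Cexp, path_derive_scal, path_derive_id.
          * apply path_derive_pow, path_derive_inv.
        + intros z Hz. unfold f. rewrite !Cpow_S, RtoC_opp. ring.
      - apply path_derivable_plus; apply path_derivable_mult;
          [apply path_derivable_const | apply Df | apply path_derivable_const | apply Df].
      - intros x. apply is_real_mult.
        + apply is_real_Cexp, is_real_mult; apply is_real_RtoC.
        + apply is_real_pow, is_real_inv, is_real_RtoC. }
    rewrite contour_int_plus, !contour_int_scal, IH in E; auto;
      try (apply path_derivable_mult; [apply path_derivable_const | apply Df]).
    rewrite fact_simpl, mult_INR.
    assert (S0 := INR_S_neq_0 n). assert (F0 := INR_fact_neq_0 n).
    apply Rmult_eq_reg_l with (INR (S n)); [|exact S0].
    replace (INR (S n) * (PI * k ^ S n / (INR (S n) * INR (fact n))))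
      with (k * (PI * k ^ n / INR (fact n))) by (simpl pow; field; split; assumption).
    lra.
Qed.

Lemma contour_int_Csum (p q : path) (c : nat -> R) (f : nat -> C -> C) (J : nat) :
  half_loop p q -> (forall j, path_derivable (f j)) ->
  contour_int p q (fun t => Csum (fun j => (c j * f j t)%C) (S J)) =
  sum_n (fun j => c j * contour_int p q (f j)) J.
Proof.
  intros H Hf. induction J as [|J IH].
  - rewrite sum_O, <- contour_int_scal; auto.
    apply contour_int_ext; [exact H|]. intros z _. simpl. ring.
  - rewrite sum_Sn, <- IH, <- contour_int_scal; auto.
    apply (contour_int_plus p q (fun t => Csum (fun j => (c j * f j t)%C) (S J))
             (fun t => (c (S J) * f (S J) t)%C)); [exact H | |].
    + apply path_derivable_Csum. intros j.
      apply path_derivable_mult; [apply path_derivable_const | apply Hf].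
    + apply path_derivable_mult; [apply path_derivable_const | apply Hf].
Qed.

(** Expanding [exp (z e^t)] in powers of [z e^t] and integrating term by term against [t^{-(n+1)}]
    gives [PI j^n / n!] for the term [z^j e^{jt} / j!], which is the series defining [touchard]. *)
Lemma touchard_contour_int (p q : path) (n : nat) (z : R) :
  half_loop p q ->
  PI * scaled_touchard n z =
  exp (- z) * contour_int p q (fun t => (Cexp (z * Cexp t) * (/ t) ^ S n)%C).
Proof.
  intros H. assert (H' := H). destruct H' as [Hp [Hq _]].
  set (g := fun t : C => ((/ t) ^ S n)%C).
  assert (Dg : path_derivable g) by apply path_derivable_pow, path_derivable_inv.
  set (e := fun t : C => (z * Cexp t)%C).
  assert (De : path_derivable e).
  { apply path_derivable_mult; [apply path_derivable_const|].
    apply path_derivable_Cexp, path_derivable_id. }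
  destruct (path_derivable_bounded p _ Hp Dg) as [Ip [Ip0 HIp]].
  destruct (path_derivable_bounded q _ Hq Dg) as [Iq [Iq0 HIq]].
  destruct (path_derivable_bounded p _ Hp De) as [Ap [Ap0 HAp]].
  destruct (path_derivable_bounded q _ Hq De) as [Aq [Aq0 HAq]].
  set (A := Ap + Aq). set (I := Ip + Iq).
  assert (B : forall t J, Cmod (e t) <= A -> Cmod (g t) <= I ->
    Cmod (exp_partial (e t) J * g t - Cexp (e t) * g t) <= I * exp A * (A ^ J / INR (fact J))).
  { intros t J HA HI.
    replace (exp_partial (e t) J * g t - Cexp (e t) * g t)%C
      with (- ((Cexp (e t) - exp_partial (e t) J) * g t))%C by ring.
    rewrite Cmod_opp, Cmod_mult.
    replace (I * exp A * (A ^ J / INR (fact J))) with (A ^ J / INR (fact J) * exp A * I) by ring.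
    apply Rmult_le_compat; try apply Cmod_ge_0; [|exact HI].
    eapply Rle_trans; [apply Cexp_taylor_bound|].
    apply Rmult_le_compat.
    - apply Rmult_le_pos; [apply pow_le, Cmod_ge_0|].
      left. apply Rinv_0_lt_compat, INR_fact_lt_0.
    - left; apply exp_pos.
    - apply Rmult_le_compat_r; [left; apply Rinv_0_lt_compat, INR_fact_lt_0|].
      apply pow_incr. split; [apply Cmod_ge_0 | exact HA].
    - apply exp_le_compat, HA. }
  assert (L : is_lim_seq (fun J => contour_int p q (fun t => (exp_partial (e t) J * g t)%C))
                (contour_int p q (fun t => (Cexp (e t) * g t)%C))).
  { apply (contour_int_lim p q _ (fun J t => (exp_partial (e t) J * g t)%C) A (I * exp A) H).
    - apply path_derivable_mult; [apply path_derivable_Cexp, De | exact Dg].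
    - intros J. apply path_derivable_mult; [now apply path_derivable_exp_partial | exact Dg].
    - intros J u Hu. apply B; unfold A, I.
      + specialize (HAp u Hu). lra.
      + specialize (HIp u Hu). lra.
    - intros J u Hu. apply B; unfold A, I.
      + specialize (HAq u Hu). lra.
      + specialize (HIq u Hu). lra. }
  (* [sum_n] up to [J] has [J + 1] terms, so the limit is taken along [S J]. *)
  apply is_lim_seq_incr_1 in L.
  assert (E : forall J, contour_int p q (fun t => (exp_partial (e t) (S J) * g t)%C) =
    sum_n (fun k => scal (PI / INR (fact n)) (INR k ^ n * z ^ k / INR (fact k))) J).
  { intros J.
    rewrite (contour_int_ext p q _ (fun t => Csum (fun j => (RtoC (z ^ j / INR (fact j)) *
      (Cexp (INR j * t) * (/ t) ^ S n))%C) (S J)) H).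
    - rewrite contour_int_Csum; [|exact H|].
      + apply sum_n_ext. intros k. rewrite contour_int_exp_over_pow by exact H.
        unfold scal; simpl; unfold mult; simpl. field. split; apply INR_fact_neq_0.
      + intros j. apply path_derivable_mult; [|exact Dg].
        apply path_derivable_Cexp, path_derivable_linear.
    - intros t Ht. unfold exp_partial. rewrite Csum_mult_r. apply Csum_ext. intros j _.
      unfold e, g. rewrite Cpow_mult_l, Cexp_pow, RtoC_div, RtoC_pow by apply INR_fact_neq_0.
      unfold Cdiv. ring. }
  assert (Hs : is_series (fun k => scal (PI / INR (fact n)) (INR k ^ n * z ^ k / INR (fact k)))
                 (contour_int p q (fun t => (Cexp (e t) * g t)%C))).
  { apply (is_lim_seq_ext _ _ _ E L). }
  apply is_series_unique in Hs. rewrite Series_scal_l in Hs.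
  unfold scaled_touchard, touchard. change (fun t => (Cexp (z * Cexp t) * (/ t) ^ S n)%C)
    with (fun t => (Cexp (e t) * g t)%C). rewrite <- Hs.
  field. apply INR_fact_neq_0.
Qed.

(** * Truncated power series in the complex plane *)

(** Horner form with the constant coefficient first: a polynomial vanishing at 0 is divided by [z]
    by passing to the tail of the list. *)
Fixpoint peval (l : list R) (z : C) : C :=
  match l with
  | nil => 0
  | cons c l => (c + z * peval l z)%C
  end.

Definition is_rpoly (f : C -> C) : Prop := exists l, forall z, f z = peval l z.

Lemma is_rpoly_ext (f g : C -> C) : (forall z, f z = g z) -> is_rpoly f -> is_rpoly g.
Proof. intros E [l H]. exists l. intros z. now rewrite <- E. Qed.

Lemma is_rpoly_shift (c : R) (f : C -> C) :
  is_rpoly f -> is_rpoly (fun z => (c + z * f z)%C).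
Proof. intros [l H]. exists (cons c l). intros z. simpl. now rewrite H. Qed.

Lemma is_rpoly_const (c : R) : is_rpoly (fun _ => RtoC c).
Proof. exists (cons c nil). intros z. simpl. ring. Qed.

Lemma is_rpoly_id : is_rpoly (fun z => z).
Proof. exists (cons 0 (cons 1 nil)). intros z. simpl. ring. Qed.

Lemma is_rpoly_scal (c : R) (f : C -> C) : is_rpoly f -> is_rpoly (fun z => (c * f z)%C).
Proof.
  intros [l H]. apply (is_rpoly_ext (fun z => (c * peval l z)%C)).
  { intros z. now rewrite H. }
  clear H f. induction l as [|d l IH]; simpl.
  - apply (is_rpoly_ext (fun _ => RtoC 0)); [intros; ring | apply is_rpoly_const].
  - apply (is_rpoly_ext (fun z => (RtoC (c * d) + z * (c * peval l z))%C)).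
    + intros z. rewrite RtoC_mult. ring.
    + now apply is_rpoly_shift.
Qed.

Lemma is_rpoly_plus (f g : C -> C) :
  is_rpoly f -> is_rpoly g -> is_rpoly (fun z => (f z + g z)%C).
Proof.
  intros [l Hf] [l' Hg]. apply (is_rpoly_ext (fun z => (peval l z + peval l' z)%C)).
  { intros z. now rewrite Hf, Hg. }
  clear. revert l'. induction l as [|c l IH]; intros l'.
  - exists l'. intros z. simpl. ring.
  - destruct l' as [|d l']; simpl.
    + exists (cons c l). intros z. simpl. ring.
    + apply (is_rpoly_ext (fun z => (RtoC (c + d) + z * (peval l z + peval l' z))%C)).
      * intros z. rewrite RtoC_plus. ring.
      * apply is_rpoly_shift, IH.
Qed.

Lemma is_rpoly_mult (f g : C -> C) :
  is_rpoly f -> is_rpoly g -> is_rpoly (fun z => (f z * g z)%C).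
Proof.
  intros [l Hf] Hg. apply (is_rpoly_ext (fun z => (peval l z * g z)%C)).
  { intros z. now rewrite Hf. }
  clear Hf f. induction l as [|c l IH]; simpl.
  - apply (is_rpoly_ext (fun _ => RtoC 0)); [intros; ring | apply is_rpoly_const].
  - apply (is_rpoly_ext (fun z => (c * g z + (0 + z * (peval l z * g z)))%C)).
    + intros z. ring.
    + apply is_rpoly_plus; [now apply is_rpoly_scal | now apply is_rpoly_shift].
Qed.

Lemma is_rpoly_minus (f g : C -> C) :
  is_rpoly f -> is_rpoly g -> is_rpoly (fun z => (f z - g z)%C).
Proof.
  intros Hf Hg. apply (is_rpoly_ext (fun z => (f z + RtoC (-1) * g z)%C)).
  - intros z. apply C_eq; simpl; ring.
  - apply is_rpoly_plus; [exact Hf | now apply is_rpoly_scal].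
Qed.

Lemma is_rpoly_pow (f : C -> C) (n : nat) : is_rpoly f -> is_rpoly (fun z => (f z ^ n)%C).
Proof.
  intros H. induction n as [|n IH]; simpl.
  - apply is_rpoly_const.
  - now apply is_rpoly_mult.
Qed.

Lemma is_rpoly_Csum (f : nat -> C -> C) (n : nat) :
  (forall j, is_rpoly (f j)) -> is_rpoly (fun z => Csum (fun j => f j z) n).
Proof.
  intros H. induction n as [|n IH]; simpl.
  - apply is_rpoly_const.
  - now apply is_rpoly_plus.
Qed.

Lemma is_rpoly_exp_partial (f : C -> C) (L : nat) :
  is_rpoly f -> is_rpoly (fun z => exp_partial (f z) L).
Proof.
  intros H. unfold exp_partial. apply is_rpoly_Csum. intros j.
  apply is_rpoly_mult; [now apply is_rpoly_pow|].
  apply (is_rpoly_ext (fun _ => RtoC (/ INR (fact j)))).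
  - intros _. apply RtoC_inv, INR_fact_neq_0.
  - apply is_rpoly_const.
Qed.

Lemma peval_bounded (l : list R) :
  exists M, 0 <= M /\ forall z, Cmod z <= 1 -> Cmod (peval l z) <= M.
Proof.
  induction l as [|c l [M [HM IH]]].
  - exists 0. split; [lra|]. intros z _. simpl. rewrite Cmod_0. lra.
  - exists (Rabs c + M). split; [assert (H := Rabs_pos c); lra|].
    intros z Hz. simpl. eapply Rle_trans; [apply Cmod_triangle|].
    rewrite Cmod_R, Cmod_mult. apply Rplus_le_compat_l.
    rewrite <- (Rmult_1_l M). apply Rmult_le_compat; try apply Cmod_ge_0; auto.
Qed.

(** * Orders of vanishing at 0 along the positive reals *)

Definition bigO (m : nat) (f : R -> C) : Prop :=
  exists K d, 0 <= K /\ 0 < d /\ forall s, 0 < s < d -> Cmod (f s) <= K * s ^ m.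

(* Smallness on the positive reals forces the low-order coefficients to vanish. *)
Lemma rpoly_bigO_complex (f : C -> C) (m : nat) :
  is_rpoly f -> bigO m (fun s => f (RtoC s)) ->
  exists K, 0 <= K /\ forall z, Cmod z <= 1 -> Cmod (f z) <= K * Cmod z ^ m.
Proof.
  intros [l Hl]. revert f l Hl. induction m as [|m IH]; intros f l Hl HO.
  - destruct (peval_bounded l) as [M [HM B]]. exists M. split; [exact HM|].
    intros z Hz. simpl. rewrite Rmult_1_r, Hl. auto.
  - destruct l as [|c l].
    { exists 0. split; [lra|]. intros z _. rewrite Hl. simpl. rewrite Cmod_0. lra. }
    destruct HO as [K [d [HK [Hd HO]]]].
    destruct (peval_bounded l) as [M [HM B]].
    assert (Hc : c = 0).
    { destruct (Req_dec c 0) as [|Hc]; [assumption|exfalso].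
      assert (Hc' : 0 < Rabs c) by now apply Rabs_pos_lt.
      (* For small [s] the hypothesis and the bound on the tail give [|c| <= (K + M) s], which this
         choice of [s] contradicts. *)
      set (s := Rmin (d / 2) (Rmin 1 (Rabs c / (2 * (K + M + 1))))).
      assert (Hq : 0 < Rabs c / (2 * (K + M + 1))) by (apply Rdiv_lt_0_compat; lra).
      assert (Hs : 0 < s) by (unfold s; repeat apply Rmin_glb_lt; lra).
      assert (Hs1 : s <= d / 2) by apply Rmin_l.
      assert (Hs2 : s <= 1) by (eapply Rle_trans; [apply Rmin_r | apply Rmin_l]).
      assert (Hs3 : s <= Rabs c / (2 * (K + M + 1)))
        by (eapply Rle_trans; [apply Rmin_r | apply Rmin_r]).
      specialize (HO s ltac:(lra)). rewrite Hl in HO. simpl peval in HO.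
      assert (Hz : Cmod (RtoC s) = s) by (rewrite Cmod_R, Rabs_pos_eq; lra).
      assert (T := Cmod_triangle (RtoC c + RtoC s * peval l (RtoC s)) (- (RtoC s * peval l (RtoC s)))).
      replace (c + s * peval l s + - (s * peval l s))%C with (RtoC c) in T by ring.
      rewrite Cmod_opp, Cmod_mult, Hz, Cmod_R in T.
      specialize (B (RtoC s) ltac:(lra)).
      assert (P : s ^ m <= 1) by (rewrite <- (pow1 m); apply pow_incr; lra).
      assert (P0 : 0 <= s ^ m) by (apply pow_le; lra).
      assert (Q : K * s ^ S m <= K * s).
      { apply Rmult_le_compat_l; [exact HK|]. simpl. nra. }
      assert (Q2 : s * Cmod (peval l s) <= s * M) by (apply Rmult_le_compat_l; lra).
      assert (Q3 : s * (2 * (K + M + 1)) <= Rabs c).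
      { apply Rmult_le_compat_r with (r := 2 * (K + M + 1)) in Hs3; [|lra].
        unfold Rdiv in Hs3. rewrite Rmult_assoc, Rinv_l, Rmult_1_r in Hs3; lra. }
      nra. }
    subst c.
    assert (E : forall z, f z = (z * peval l z)%C) by (intros z; rewrite Hl; simpl; ring).
    destruct (IH (peval l) l) as [K' [HK' B']].
    + reflexivity.
    + exists K, d. split; [exact HK|]. split; [exact Hd|]. intros s Hs.
      specialize (HO s Hs). rewrite E, Cmod_mult, Cmod_R, Rabs_pos_eq in HO by lra.
      apply Rmult_le_reg_l with s; [lra|]. simpl in HO. lra.
    + exists K'. split; [exact HK'|]. intros z Hz. rewrite E, Cmod_mult. simpl.
      replace (K' * (Cmod z * Cmod z ^ m)) with (Cmod z * (K' * Cmod z ^ m)) by ring.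
      apply Rmult_le_compat_l; [apply Cmod_ge_0 | auto].
Qed.

Lemma bigO_ext (m : nat) (f g : R -> C) :
  (exists d, 0 < d /\ forall s, 0 < s < d -> f s = g s) -> bigO m f -> bigO m g.
Proof.
  intros [d' [Hd' E]] [K [d [HK [Hd H]]]]. exists K, (Rmin d d').
  split; [exact HK|]. split; [now apply Rmin_glb_lt|].
  intros s Hs. assert (A := Rmin_l d d'). assert (A' := Rmin_r d d').
  rewrite <- E by lra. apply H. lra.
Qed.

Lemma bigO_plus (m : nat) (f g : R -> C) :
  bigO m f -> bigO m g -> bigO m (fun s => (f s + g s)%C).
Proof.
  intros [K [d [HK [Hd H]]]] [K' [d' [HK' [Hd' H']]]]. exists (K + K'), (Rmin d d').
  split; [lra|]. split; [now apply Rmin_glb_lt|].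
  intros s Hs. assert (A := Rmin_l d d'). assert (A' := Rmin_r d d').
  eapply Rle_trans; [apply Cmod_triangle|].
  specialize (H s ltac:(lra)). specialize (H' s ltac:(lra)). lra.
Qed.

Lemma bigO_mult (m n : nat) (f g : R -> C) :
  bigO m f -> bigO n g -> bigO (m + n) (fun s => (f s * g s)%C).
Proof.
  intros [K [d [HK [Hd H]]]] [K' [d' [HK' [Hd' H']]]]. exists (K * K'), (Rmin d d').
  split; [nra|]. split; [now apply Rmin_glb_lt|].
  intros s Hs. assert (A := Rmin_l d d'). assert (A' := Rmin_r d d').
  specialize (H s ltac:(lra)). specialize (H' s ltac:(lra)).
  rewrite Cmod_mult, pow_add.
  replace (K * K' * (s ^ m * s ^ n)) with ((K * s ^ m) * (K' * s ^ n)) by ring.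
  apply Rmult_le_compat; auto; apply Cmod_ge_0.
Qed.

Lemma bigO_opp (m : nat) (f : R -> C) : bigO m f -> bigO m (fun s => (- f s)%C).
Proof.
  intros [K [d [HK [Hd H]]]]. exists K, d. split; [exact HK|]. split; [exact Hd|].
  intros s Hs. rewrite Cmod_opp. auto.
Qed.

Lemma bigO_le (m n : nat) (f : R -> C) : (n <= m)%nat -> bigO m f -> bigO n f.
Proof.
  intros Hmn [K [d [HK [Hd H]]]]. exists K, (Rmin d 1). split; [exact HK|].
  split; [apply Rmin_glb_lt; lra|]. intros s Hs.
  assert (A := Rmin_l d 1). assert (A' := Rmin_r d 1).
  eapply Rle_trans; [apply H; lra|]. apply Rmult_le_compat_l; [exact HK|].
  replace m with (n + (m - n))%nat by lia. rewrite pow_add.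
  rewrite <- (Rmult_1_r (s ^ n)) at 2. apply Rmult_le_compat_l; [apply pow_le; lra|].
  rewrite <- (pow1 (m - n)). apply pow_incr. lra.
Qed.

Lemma bigO_bounded (f : R -> C) (M d : R) :
  0 < d -> (forall s, 0 < s < d -> Cmod (f s) <= M) -> bigO 0 f.
Proof.
  intros Hd H. exists (Rabs M), d. split; [apply Rabs_pos|]. split; [exact Hd|].
  intros s Hs. simpl. rewrite Rmult_1_r. eapply Rle_trans; [now apply H | apply Rle_abs].
Qed.

Lemma bigO_const (c : C) : bigO 0 (fun _ => c).
Proof. apply (bigO_bounded _ (Cmod c) 1); [lra | intros; lra]. Qed.

Lemma bigO_pow (m : nat) : bigO m (fun s => (RtoC s ^ m)%C).
Proof.
  exists 1, 1. split; [lra|]. split; [lra|]. intros s Hs.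
  rewrite Cmod_pow, Cmod_R, Rabs_pos_eq by lra. lra.
Qed.

Lemma Rmult_le_1_le (x y : R) : 0 <= x -> y <= 1 -> x * y <= x.
Proof. intros. nra. Qed.

Lemma bigO_exp_remainder (m L : nat) (f : R -> C) :
  bigO m f -> bigO (m * L) (fun s => (Cexp (f s) - exp_partial (f s) L)%C).
Proof.
  intros [K [d [HK [Hd H]]]].
  exists (K ^ L / INR (fact L) * exp K), (Rmin d 1).
  assert (HF := INR_fact_lt_0 L). assert (He := exp_pos K).
  split.
  { apply Rmult_le_pos; [|lra]. apply Rmult_le_pos; [now apply pow_le|].
    left; now apply Rinv_0_lt_compat. }
  split; [apply Rmin_glb_lt; lra|]. intros s Hs.
  assert (A := Rmin_l d 1). assert (A' := Rmin_r d 1). specialize (H s ltac:(lra)).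
  assert (P : s ^ m <= 1) by (rewrite <- (pow1 m); apply pow_incr; lra).
  eapply Rle_trans; [apply Cexp_taylor_bound|].
  rewrite pow_mult.
  replace (K ^ L / INR (fact L) * exp K * (s ^ m) ^ L)
    with ((K * s ^ m) ^ L / INR (fact L) * exp K)
    by (rewrite Rpow_mult_distr; unfold Rdiv; ring).
  apply Rmult_le_compat.
  - apply Rmult_le_pos; [apply pow_le, Cmod_ge_0 | left; now apply Rinv_0_lt_compat].
  - left; apply exp_pos.
  - apply Rmult_le_compat_r; [left; now apply Rinv_0_lt_compat|].
    apply pow_incr. split; [apply Cmod_ge_0 | exact H].
  - apply exp_le_compat. eapply Rle_trans; [exact H|]. now apply Rmult_le_1_le.
Qed.

Lemma bigO_exp_minus_1 (m : nat) (f : R -> C) :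
  bigO m f -> bigO m (fun s => (Cexp (f s) - 1)%C).
Proof.
  intros H. apply (bigO_exp_remainder m 1) in H. rewrite Nat.mul_1_r in H.
  apply (bigO_ext m (fun s => (Cexp (f s) - exp_partial (f s) 1)%C)); [|exact H].
  exists 1. split; [lra|]. intros s _. f_equal. unfold exp_partial. simpl. field.
Qed.

Lemma bigO_exp (m : nat) (f : R -> C) : bigO m f -> bigO 0 (fun s => Cexp (f s)).
Proof.
  intros H. apply (bigO_ext 0 (fun s => ((Cexp (f s) - 1) + 1)%C)).
  - exists 1. split; [lra|]. intros; ring.
  - apply bigO_plus; [|apply bigO_const].
    apply (bigO_le m 0); [lia|]. now apply bigO_exp_minus_1.
Qed.

(** * Truncated series and the differential equation of [tau] *)

Definition partial_pseries (a : nat -> R) (N : nat) (z : C) : C :=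
  Csum (fun k => (a k * z ^ k)%C) N.

Lemma is_rpoly_partial_pseries (a : nat -> R) (N : nat) : is_rpoly (partial_pseries a N).
Proof.
  apply (is_rpoly_Csum (fun k z => (a k * z ^ k)%C)). intros k.
  apply is_rpoly_scal, is_rpoly_pow, is_rpoly_id.
Qed.

Lemma partial_pseries_shift (a : nat -> R) (N : nat) (z : C) :
  partial_pseries a (S N) z = (a 0%nat + z * partial_pseries (PS_decr_1 a) N z)%C.
Proof.
  unfold partial_pseries. induction N as [|N IH].
  - simpl. ring.
  - change (Csum (fun k => (a k * z ^ k)%C) (S (S N)))
      with (Csum (fun k => (a k * z ^ k)%C) (S N) + a (S N) * z ^ S N)%C.
    rewrite IH. simpl. unfold PS_decr_1. ring.
Qed.

Lemma pos_lt_CV_radius (a : nat -> R) :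
  Rbar_lt 0 (CV_radius a) -> exists d, 0 < d /\ forall s, Rabs s < d -> Rbar_lt (Rabs s) (CV_radius a).
Proof.
  intros H. destruct (CV_radius a) as [r| |]; simpl in H.
  - exists r. split; [exact H|]. intros s Hs. exact Hs.
  - exists 1. split; [lra|]. intros; exact I.
  - destruct H.
Qed.

(** Each step removes the constant term and pulls out one factor [s]; what is left at the end is
    bounded because a power series is continuous at 0. *)
Lemma PSeries_partial_bigO (a : nat -> R) (N : nat) :
  Rbar_lt 0 (CV_radius a) ->
  bigO N (fun s => (RtoC (PSeries a s) - partial_pseries a N (RtoC s))%C).
Proof.
  revert a. induction N as [|N IH]; intros a Ha.
  - destruct (pos_lt_CV_radius a Ha) as [d [Hd Hr]].
    assert (Hc : continuity_pt (PSeries a) 0) by (apply PSeries_continuity; rewrite Rabs_R0; exact Ha).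
    destruct (Hc 1 ltac:(lra)) as [e [He Hc']].
    apply (bigO_bounded _ (Rabs (PSeries a 0) + 1) e); [exact He|].
    intros s Hs. unfold partial_pseries. simpl.
    replace (PSeries a s - 0)%C with (RtoC (PSeries a s)) by ring. rewrite Cmod_R.
    assert (D : Rabs (PSeries a s - PSeries a 0) < 1).
    { apply Hc'. split; [split; [exact I | lra]|]. simpl. unfold R_dist.
      rewrite Rminus_0_r, Rabs_pos_eq; lra. }
    assert (T := Rabs_triang (PSeries a s - PSeries a 0) (PSeries a 0)).
    replace (PSeries a s - PSeries a 0 + PSeries a 0) with (PSeries a s) in T by ring. lra.
  - destruct (pos_lt_CV_radius a Ha) as [d [Hd Hr]].
    apply (bigO_ext (S N) (fun s => (RtoC s ^ 1 * (RtoC (PSeries (PS_decr_1 a) s) -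
      partial_pseries (PS_decr_1 a) N (RtoC s)))%C)).
    + exists d. split; [exact Hd|]. intros s Hs.
      rewrite partial_pseries_shift, (PSeries_decr_1 a) by
        (apply CV_radius_inside, Hr; rewrite Rabs_pos_eq; lra).
      rewrite RtoC_plus, RtoC_mult. ring.
    + apply (bigO_mult 1 N); [apply bigO_pow | apply IH].
      rewrite CV_radius_decr_1. exact Ha.
Qed.

(** Defect in the equation obtained by differentiating [s^3/6 = 1 - e^w - log (1 - w)] and
    multiplying by [1 - w], which removes the logarithm. *)
Definition saddle_ode (w dw s : C) : C :=
  ((1 - (1 - w) * Cexp w) * dw - (1 - w) * (s * s / 2))%C.

(** The passage from real to complex arguments. On the positive reals the defect of the truncation
    is small because [tau] itself has defect 0; up to a Taylor remainder of the exponential it is a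
    real polynomial, so [rpoly_bigO_complex] carries the bound to the unit disc. *)
Lemma partial_pseries_ode_bound (a : nat -> R) (K : nat) :
  (1 <= K)%nat -> Rbar_lt 0 (CV_radius a) -> a 0%nat = 0 ->
  (exists d, 0 < d /\ forall s : R, 0 < s < d ->
     saddle_ode (PSeries a s) (PSeries (PS_derive a) s) s = 0) ->
  exists M, 0 <= M /\ forall z, Cmod z <= 1 ->
    Cmod (saddle_ode (partial_pseries a (S K) z) (partial_pseries (PS_derive a) K z) z)
      <= M * Cmod z ^ (S K).
Proof.
  intros HK Ha Ha0 [d [Hd Hode]].
  set (w := partial_pseries a (S K)). set (dw := partial_pseries (PS_derive a) K).
  assert (Ha' : Rbar_lt 0 (CV_radius (PS_derive a))) by (rewrite CV_radius_derive; exact Ha).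
  assert (Rw : is_rpoly w) by apply is_rpoly_partial_pseries.
  assert (Rdw : is_rpoly dw) by apply is_rpoly_partial_pseries.
  (* Truncating the exponential as well makes the defect [P] a polynomial. *)
  set (E := fun z => exp_partial (w z) (S K)).
  set (P := fun z => ((1 - (1 - w z) * E z) * dw z - (1 - w z) * (RtoC (/ 2) * (z * z)))%C).
  assert (RP : is_rpoly P).
  { assert (R1 : is_rpoly (fun _ => RtoC 1)) by apply is_rpoly_const.
    apply is_rpoly_minus; apply is_rpoly_mult; try assumption.
    - apply is_rpoly_minus; [exact R1|]. apply is_rpoly_mult.
      + now apply is_rpoly_minus.
      + now apply is_rpoly_exp_partial.
    - now apply is_rpoly_minus.
    - apply is_rpoly_scal, is_rpoly_mult; apply is_rpoly_id. }
  set (T := fun s : R => RtoC (PSeries a s)). set (dT := fun s : R => RtoC (PSeries (PS_derive a) s)).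
  assert (OTw : bigO (S K) (fun s => (T s - w (RtoC s))%C)) by now apply PSeries_partial_bigO.
  assert (OdT : bigO K (fun s => (dT s - dw (RtoC s))%C)) by now apply PSeries_partial_bigO.
  assert (Ow1 : bigO 1 (fun s => w (RtoC s))).
  { destruct (is_rpoly_partial_pseries (PS_decr_1 a) K) as [l Hl].
    destruct (peval_bounded l) as [M [HM B]].
    exists M, 1. split; [exact HM|]. split; [lra|]. intros s Hs.
    unfold w. rewrite partial_pseries_shift, Ha0, Hl, Cplus_0_l, Cmod_mult.
    assert (Hz : Cmod (RtoC s) = s) by (rewrite Cmod_R, Rabs_pos_eq; lra).
    specialize (B (RtoC s) ltac:(lra)). rewrite Hz. simpl. nra. }
  assert (Odw : bigO 0 (fun s => dw (RtoC s))).
  { destruct Rdw as [l Hl]. destruct (peval_bounded l) as [M [HM B]].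
    apply (bigO_bounded _ M 1); [lra|]. intros s Hs. rewrite Hl. apply B.
    rewrite Cmod_R, Rabs_pos_eq; lra. }
  assert (OT1 : bigO 1 T).
  { apply (bigO_ext 1 (fun s => ((T s - w (RtoC s)) + w (RtoC s))%C)).
    - exists 1. split; [lra|]. intros; ring.
    - apply bigO_plus; [|exact Ow1]. apply (bigO_le (S K)); [lia | exact OTw]. }
  assert (O1w : bigO 0 (fun s => (1 - w (RtoC s))%C)).
  { apply bigO_plus; [apply bigO_const|]. apply bigO_opp, (bigO_le 1); [lia | exact Ow1]. }
  assert (OE : bigO (S K) (fun s => (Cexp (w (RtoC s)) - E (RtoC s))%C)).
  { assert (H := bigO_exp_remainder 1 (S K) _ Ow1). rewrite Nat.mul_1_l in H. exact H. }
  assert (OeT : bigO (S K) (fun s => (Cexp (T s) - Cexp (w (RtoC s)))%C)).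
  { apply (bigO_ext (S K) (fun s => ((Cexp (T s - w (RtoC s)) - 1) * Cexp (w (RtoC s)))%C)).
    - exists 1. split; [lra|]. intros s _.
      replace (Cexp (T s)) with (Cexp (T s - w (RtoC s)) * Cexp (w (RtoC s)))%C.
      + ring.
      + rewrite <- Cexp_plus. f_equal. ring.
    - replace (S K) with (S K + 0)%nat by lia. apply bigO_mult.
      + now apply bigO_exp_minus_1.
      + exact (bigO_exp _ _ Ow1). }
  assert (OP : bigO (S K) (fun s => P (RtoC s))).
  (* [P] minus the vanishing defect of the full series, split into the differences in [T], in the
     exponential and in [dT]. *)
  { apply (bigO_ext (S K) (fun s =>
      (((T s - w (RtoC s)) * (- Cexp (T s)) +
        (1 - w (RtoC s)) * ((Cexp (T s) - Cexp (w (RtoC s))) + (Cexp (w (RtoC s)) - E (RtoC s))))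
         * dw (RtoC s)
       + ((1 - Cexp (T s)) + T s * Cexp (T s)) * (- (dT s - dw (RtoC s)))
       + (- (T s - w (RtoC s))) * (RtoC (/ 2) * (RtoC s * RtoC s)))%C)).
    - exists d. split; [exact Hd|]. intros s Hs.
      specialize (Hode s Hs). unfold saddle_ode in Hode. fold (T s) in Hode. fold (dT s) in Hode.
      unfold P.
      replace ((1 - (1 - w s) * E s) * dw s - (1 - w s) * (RtoC (/ 2) * (s * s)))%C
        with ((1 - (1 - w s) * E s) * dw s - (1 - w s) * (RtoC (/ 2) * (s * s)) - 0)%C by ring.
      rewrite <- Hode. rewrite RtoC_inv by lra. field.
    - apply bigO_plus; [apply bigO_plus|].
      + replace (S K) with (S K + 0)%nat by lia. apply bigO_mult; [|exact Odw].
        apply bigO_plus.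
        * replace (S K) with (S K + 0)%nat by lia. apply bigO_mult; [exact OTw|].
          apply bigO_opp. exact (bigO_exp _ _ OT1).
        * replace (S K) with (0 + S K)%nat by lia. apply bigO_mult; [exact O1w|].
          now apply bigO_plus.
      (* The derivative is approximated only to order [K]; the missing order comes from its factor
         [1 - (1 - T) e^T], which vanishes at 0. *)
      + replace (S K) with (1 + K)%nat by lia. apply bigO_mult.
        * apply bigO_plus.
          -- apply (bigO_ext 1 (fun s => (- (Cexp (T s) - 1))%C)).
             ++ exists 1. split; [lra|]. intros; ring.
             ++ apply bigO_opp. now apply bigO_exp_minus_1.
          -- apply (bigO_mult 1 0); [exact OT1 | exact (bigO_exp _ _ OT1)].
        * now apply bigO_opp.
      + replace (S K) with (S K + 0)%nat by lia. apply bigO_mult; [now apply bigO_opp|].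
        apply (bigO_bounded _ (/ 2) 1); [lra|]. intros s Hs.
        rewrite !Cmod_mult, !Cmod_R, !Rabs_pos_eq by lra. nra. }
  destruct (rpoly_bigO_complex P (S K) RP OP) as [M1 [HM1 B1]].
  destruct (is_rpoly_partial_pseries (PS_decr_1 a) K) as [l Hl].
  destruct (peval_bounded l) as [M2 [HM2 B2]].
  destruct Rdw as [l' Hl']. destruct (peval_bounded l') as [M3 [HM3 B3]].
  assert (Bw : forall z, Cmod z <= 1 -> Cmod (w z) <= M2 * Cmod z).
  { intros z Hz. unfold w. rewrite partial_pseries_shift, Ha0, Hl, Cplus_0_l, Cmod_mult, Rmult_comm.
    apply Rmult_le_compat_r; [apply Cmod_ge_0 | auto]. }
  (* The first term bounds [P]; the second bounds the cost of restoring the true exponential, whose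
     Taylor remainder is of order [S K] because [|w z| <= M2 |z|]. *)
  exists (M1 + (1 + M2) * (M2 ^ S K * exp M2) * M3). split.
  { assert (0 < exp M2) by apply exp_pos. assert (0 <= M2 ^ S K) by now apply pow_le.
    apply Rplus_le_le_0_compat; [exact HM1|].
    apply Rmult_le_pos; [apply Rmult_le_pos; [|apply Rmult_le_pos]|]; lra. }
  intros z Hz.
  replace (saddle_ode (w z) (dw z) z) with
    (P z + - ((1 - w z) * (Cexp (w z) - E z) * dw z))%C
    by (unfold saddle_ode, P; rewrite RtoC_inv by lra; field).
  eapply Rle_trans; [apply Cmod_triangle|]. rewrite Cmod_opp, !Cmod_mult, Rmult_plus_distr_r.
  apply Rplus_le_compat; [now apply B1|].
  specialize (Bw z Hz). assert (Hz0 := Cmod_ge_0 z).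
  assert (Bw' : Cmod (w z) <= M2) by nra.
  replace ((1 + M2) * (M2 ^ S K * exp M2) * M3 * Cmod z ^ S K)
    with ((1 + M2) * ((M2 * Cmod z) ^ S K * exp M2) * M3) by (rewrite Rpow_mult_distr; ring).
  apply Rmult_le_compat.
  - apply Rmult_le_pos; apply Cmod_ge_0.
  - apply Cmod_ge_0.
  - apply Rmult_le_compat; try apply Cmod_ge_0.
    + eapply Rle_trans; [apply (Cmod_triangle 1 (- w z))|].
      rewrite Cmod_opp, Cmod_1. lra.
    + eapply Rle_trans; [apply Cexp_taylor_bound|].
      apply Rmult_le_compat.
      * apply Rmult_le_pos; [apply pow_le, Cmod_ge_0|].
        left. apply Rinv_0_lt_compat, INR_fact_lt_0.
      * left; apply exp_pos.
      * apply Rle_trans with (Cmod (w z) ^ S K).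
        -- apply Rmult_le_1_le; [apply pow_le, Cmod_ge_0|].
           rewrite <- Rinv_1. apply Rinv_le_contravar; [lra|].
           assert (H1 := lt_0_INR _ (lt_O_fact (S K))).
           change 1 with (INR 1). apply le_INR. apply lt_O_fact.
        -- apply pow_incr. split; [apply Cmod_ge_0 | exact Bw].
      * now apply exp_le_compat.
  - rewrite Hl'. auto.
Qed.

(** * Moments of the cubic exponential and the Gamma function *)

Lemma is_RInt_gen_primitive (f F : R -> R) (la lb : R) :
  (forall a b, 0 < a -> 0 < b -> is_RInt f a b (F b - F a)) ->
  filterlim F (at_right 0) (locally la) ->
  filterlim F (Rbar_locally p_infty) (locally lb) ->
  is_RInt_gen f (at_right 0) (Rbar_locally p_infty) (lb - la).
Proof.
  intros HI Ha Hb P [eps HP].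
  assert (He : 0 < eps / 2) by (destruct eps; simpl; lra).
  set (e := mkposreal _ He).
  assert (Ha' := Ha (ball la e) (locally_ball la e)).
  assert (Hb' := Hb (ball lb e) (locally_ball lb e)).
  apply (Filter_prod _ _ _ (fun a => 0 < a /\ ball la e (F a)) (fun b => 0 < b /\ ball lb e (F b))).
  - apply filter_and; [|exact Ha']. exists (mkposreal 1 Rlt_0_1). intros y _ Hy. exact Hy.
  - apply filter_and; [|exact Hb']. exists 0. intros y Hy. exact Hy.
  - intros a b [Hap Ha1] [Hbp Hb1]. exists (F b - F a). split; [now apply HI|].
    apply HP. change (Rabs (F a - la) < eps / 2) in Ha1. change (Rabs (F b - lb) < eps / 2) in Hb1.
    change (Rabs (F b - F a - (lb - la)) < eps).
    replace (F b - F a - (lb - la)) with ((F b - lb) - (F a - la)) by ring.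
    eapply Rle_lt_trans; [apply Rabs_triang|]. rewrite Rabs_Ropp. lra.
Qed.

(** Euler's integrand for [(m + 1) / 3] after the substitution [t = u^3], up to the factor 3 from
    [dt = 3 u^2 du]. This 3 is the one in the prefactor [1 / (3 PI)]. *)
Definition cubic_kernel (m : nat) (u : R) : R := u ^ m * exp (- u ^ 3).

Definition cubic_moment (m : nat) (y : R) : R := RInt (cubic_kernel m) 0 y.

Lemma cubic_kernel_continuous (m : nat) (u : R) : continuous (cubic_kernel m) u.
Proof.
  apply (ex_derive_continuous (V := R_NormedModule)). unfold cubic_kernel. auto_derive. trivial.
Qed.

Lemma cubic_kernel_ex_RInt (m : nat) (a b : R) : ex_RInt (cubic_kernel m) a b.
Proof.
  apply (ex_RInt_continuous (V := R_CompleteNormedModule)). intros; apply cubic_kernel_continuous.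
Qed.

Lemma is_derive_cubic_moment (m : nat) (y : R) :
  is_derive (cubic_moment m) y (cubic_kernel m y).
Proof.
  apply (is_derive_RInt (V := R_NormedModule) _ _ 0).
  - apply filter_forall. intros x. apply (RInt_correct (V := R_CompleteNormedModule)).
    apply cubic_kernel_ex_RInt.
  - apply cubic_kernel_continuous.
Qed.

Lemma cubic_moment_0 (m : nat) : cubic_moment m 0 = 0.
Proof. exact (RInt_point (V := R_CompleteNormedModule) 0 (cubic_kernel m)). Qed.

Lemma pow_le_fact_exp (m : nat) (u : R) : 0 <= u -> u ^ m <= INR (fact m) * exp u.
Proof.
  revert u. induction m as [|m IH]; intros u Hu.
  - simpl. rewrite Rmult_1_l, <- exp_0. now apply exp_le_compat.
  - assert (H : u ^ S m - 0 ^ S m <= INR (fact (S m)) * exp u - INR (fact (S m)) * exp 0).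
    { apply (incr_diff_le (fun v => v ^ S m) (fun v => INR (fact (S m)) * exp v)
               (fun v => INR (S m) * 1 * v ^ m) (fun v => INR (fact (S m)) * exp v) 0 u Hu).
      - intros v _. apply is_derive_pow. exact (is_derive_id v).
      - intros v _. apply is_derive_scal, is_derive_exp.
      - intros v Hv. rewrite fact_simpl, mult_INR.
        replace (INR (S m) * 1 * v ^ m) with (INR (S m) * v ^ m) by ring.
        rewrite Rmult_assoc. apply Rmult_le_compat_l; [apply pos_INR | apply IH; lra]. }
    rewrite pow_i in H by lia. rewrite exp_0 in H.
    assert (0 < INR (fact (S m))) by apply INR_fact_lt_0. lra.
Qed.

Lemma cubic_kernel_bound (m : nat) (u : R) :
  0 <= u -> 0 <= cubic_kernel m u <= INR (fact m) * exp 2 * exp (- 2 * u).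
Proof.
  intros Hu. unfold cubic_kernel. split.
  - apply Rmult_le_pos; [now apply pow_le | left; apply exp_pos].
  - apply Rle_trans with (INR (fact m) * exp u * exp (2 - 3 * u)).
    + apply Rmult_le_compat.
      * now apply pow_le.
      * left; apply exp_pos.
      * now apply pow_le_fact_exp.
      (* [u^3 >= 3 u - 2], the tangent line at 1; the difference is [(u - 1)^2 (u + 2)]. *)
      * apply exp_le_compat. simpl.
        assert (0 <= (u - 1) * (u - 1) * (u + 2)) by (apply Rmult_le_pos; [apply Rle_0_sqr | lra]).
        lra.
    + right. rewrite !Rmult_assoc, <- !exp_plus. do 2 f_equal. ring.
Qed.

Lemma cubic_moment_limit (m : nat) :
  exists J D, 0 < D /\ forall y, 0 <= y ->
    0 <= cubic_moment m y /\ 0 <= J - cubic_moment m y <= D * exp (- 2 * y).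
Proof.
  set (D := INR (fact m) * exp 2 / 2).
  assert (HD : 0 < D).
  { unfold D. apply Rdiv_lt_0_compat; [|lra].
    apply Rmult_lt_0_compat; [apply INR_fact_lt_0 | apply exp_pos]. }
  assert (Hinc : forall x y, 0 <= x <= y -> 0 <= cubic_moment m y - cubic_moment m x <=
                   D * exp (- 2 * x) - D * exp (- 2 * y)).
  { intros x y Hxy. split.
    - replace 0 with (0 - 0) by ring.
      apply (incr_diff_le (fun _ => 0) (cubic_moment m) (fun _ => 0) (cubic_kernel m)); [lra| | |].
      + intros u _. exact (is_derive_const (V := R_NormedModule) 0 u).
      + intros u _. apply is_derive_cubic_moment.
      + intros u Hu. apply cubic_kernel_bound; lra.
    - replace (D * exp (- 2 * x) - D * exp (- 2 * y))
        with (- D * exp (- 2 * y) - - D * exp (- 2 * x)) by ring.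
      apply (incr_diff_le (cubic_moment m) (fun u => - D * exp (- 2 * u)) (cubic_kernel m)
               (fun u => INR (fact m) * exp 2 * exp (- 2 * u))); [lra| | |].
      + intros u _. apply is_derive_cubic_moment.
      + intros u _. eapply is_derive_eq.
        * apply is_derive_scal. apply (is_derive_Rcomp exp (fun u => - 2 * u)).
          -- apply is_derive_exp.
          -- apply is_derive_scal. exact (is_derive_id u).
        * unfold one; simpl. unfold D. field.
      + intros u Hu. apply cubic_kernel_bound; lra. }
  assert (HS : forall n : nat, cubic_moment m (INR n) <= cubic_moment m (INR (S n))).
  { intros n. assert (H := Hinc (INR n) (INR (S n))). rewrite S_INR in *.
    assert (0 <= INR n) by apply pos_INR. specialize (H ltac:(lra)). lra. }
  (* The limit is taken along the integers; [Hinc] then compares it with the moment at any real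
     [y]. *)
  destruct (ex_finite_lim_seq_incr (fun n => cubic_moment m (INR n)) D HS) as [J HJ].
  { intros n. assert (H := Hinc 0 (INR n)). assert (0 <= INR n) by apply pos_INR.
    specialize (H ltac:(lra)). rewrite cubic_moment_0, Rmult_0_r, exp_0 in H.
    assert (0 < D * exp (- 2 * INR n)) by (apply Rmult_lt_0_compat; [exact HD | apply exp_pos]).
    lra. }
  exists J, D. split; [exact HD|]. intros y Hy.
  assert (H0 := Hinc 0 y ltac:(lra)). rewrite cubic_moment_0 in H0. split; [lra|].
  destruct (INR_unbounded y) as [N HN].
  assert (Hev : forall n, (N <= n)%nat -> y <= INR n).
  { intros n Hn. apply le_INR in Hn. lra. }
  assert (Hl : cubic_moment m y <= J).
  { apply (is_lim_seq_le_loc (fun _ => cubic_moment m y) (fun n => cubic_moment m (INR n))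
             (cubic_moment m y) J); [|apply is_lim_seq_const | exact HJ].
    exists N. intros n Hn. assert (H := Hinc y (INR n)). specialize (Hev n Hn).
    specialize (H ltac:(lra)). lra. }
  assert (Hu : J <= cubic_moment m y + D * exp (- 2 * y)).
  { apply (is_lim_seq_le_loc (fun n => cubic_moment m (INR n)) (fun _ => cubic_moment m y + D * exp (- 2 * y))
             J (cubic_moment m y + D * exp (- 2 * y))); [|exact HJ | apply is_lim_seq_const].
    exists N. intros n Hn. assert (H := Hinc y (INR n)). specialize (Hev n Hn).
    specialize (H ltac:(lra)).
    assert (0 < D * exp (- 2 * INR n)) by (apply Rmult_lt_0_compat; [exact HD | apply exp_pos]).
    lra. }
  lra.
Qed.

Lemma is_derive_Rpower (c t : R) :
  0 < t -> is_derive (fun t => Rpower t c) t (c * Rpower t (c - 1)).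
Proof. intros Ht. apply is_derive_Reals. now apply derivable_pt_lim_power. Qed.

(** An explicit primitive of Euler's integrand, so that no change of variables in an improper
    integral is required. *)
Lemma is_derive_cubic_moment_cbrt (m : nat) (t : R) :
  0 < t ->
  is_derive (fun t => 3 * cubic_moment m (Rpower t (/ 3))) t
    (Rpower t ((INR m + 1) / 3 - 1) * exp (- t)).
Proof.
  intros Ht. eapply is_derive_eq.
  - apply is_derive_scal. apply (is_derive_Rcomp (cubic_moment m) (fun t => Rpower t (/ 3))).
    + apply is_derive_cubic_moment.
    + now apply is_derive_Rpower.
  - unfold cubic_kernel.
    rewrite <- !Rpower_pow, !Rpower_mult by (unfold Rpower; apply exp_pos).
    replace (/ 3 * INR 3) with 1 by (simpl; field).
    rewrite Rpower_1 by exact Ht.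
    replace ((INR m + 1) / 3 - 1) with (/ 3 * INR m + (/ 3 - 1)) by field.
    rewrite Rpower_plus. field.
Qed.

(** The primitive tends to 0 at the lower end and to three times the full moment at infinity. The
    exponential tail is kept in the statement because the saddle integral stops at a finite [d]. *)
Lemma Gamma_cubic_moment (m : nat) :
  exists D, 0 < D /\ forall y, 0 <= y ->
    0 <= 3 * cubic_moment m y /\
    0 <= Gamma ((INR m + 1) / 3) - 3 * cubic_moment m y <= D * exp (- 2 * y).
Proof.
  destruct (cubic_moment_limit m) as [J [D [HD HJ]]].
  assert (HG : Gamma ((INR m + 1) / 3) = 3 * J - 0).
  { unfold Gamma. apply (is_RInt_gen_unique (V := R_CompleteNormedModule)).
    apply (is_RInt_gen_primitive _ (fun t => 3 * cubic_moment m (Rpower t (/ 3)))).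
    - intros a b Ha Hb.
      assert (Hpos : forall x, Rmin a b <= x <= Rmax a b -> 0 < x).
      { intros x Hx. apply Rlt_le_trans with (Rmin a b); [now apply Rmin_glb_lt | apply Hx]. }
      apply (is_RInt_derive (V := R_CompleteNormedModule)
        (fun t => 3 * cubic_moment m (Rpower t (/ 3)))).
      + intros x Hx. apply is_derive_cubic_moment_cbrt. now apply Hpos.
      + intros x Hx. apply (ex_derive_continuous (V := R_NormedModule)).
        eexists. apply is_derive_Rmult.
        * apply is_derive_Rpower. now apply Hpos.
        * apply (is_derive_Rcomp exp Ropp).
          -- apply is_derive_exp.
          -- exact (is_derive_opp _ x _ (is_derive_id x)).
    - assert (L0 : filterlim (fun t => Rpower t (/ 3)) (at_right 0) (locally 0)).
      { apply (filterlim_comp _ _ _ (fun t => / 3 * ln t) exp _ (Rbar_locally m_infty)).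
        - apply (filterlim_comp _ _ _ ln (fun x => / 3 * x) _ (Rbar_locally m_infty));
            [apply is_lim_ln_0|].
          assert (H := filterlim_Rbar_mult_l (/ 3) m_infty). simpl in H.
          destruct (Rle_dec 0 (/ 3)) as [h|h]; [|lra].
          destruct (Rle_lt_or_eq_dec 0 (/ 3) h) as [h'|h']; [exact H | lra].
        - exact is_lim_exp_m. }
      apply (filterlim_comp _ _ _ (fun t => Rpower t (/ 3)) (fun y => 3 * cubic_moment m y) _ (locally 0));
        [exact L0|].
      replace 0 with (3 * cubic_moment m 0) at 2 by (rewrite cubic_moment_0; ring).
      apply (ex_derive_continuous (V := R_NormedModule) (fun y => 3 * cubic_moment m y) 0).
      eexists. apply is_derive_scal, is_derive_cubic_moment.
    - apply (filterlim_comp _ _ _ (fun t => Rpower t (/ 3)) (fun y => 3 * cubic_moment m y) _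
        (Rbar_locally p_infty)).
      { apply (filterlim_comp _ _ _ (fun t => / 3 * ln t) exp _ (Rbar_locally p_infty)).
        - apply (filterlim_comp _ _ _ ln (fun x => / 3 * x) _ (Rbar_locally p_infty));
            [exact is_lim_ln_p|].
          assert (H := filterlim_Rbar_mult_l (/ 3) p_infty). simpl in H.
          destruct (Rle_dec 0 (/ 3)) as [h|h]; [|lra].
          destruct (Rle_lt_or_eq_dec 0 (/ 3) h) as [h'|h']; [exact H | lra].
        - exact is_lim_exp_p. }
      apply (is_lim_spec _ p_infty (3 * J)). intros eps. simpl.
      exists (3 * D / (2 * eps)). intros y Hy.
      assert (He := cond_pos eps).
      assert (Hy0 : 0 < y).
      { eapply Rlt_trans; [|exact Hy]. apply Rdiv_lt_0_compat; lra. }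
      destruct (HJ y ltac:(lra)) as [_ H].
      assert (E : exp (- 2 * y) <= / (2 * y)).
      { replace (- 2 * y) with (- (2 * y)) by ring. rewrite exp_Ropp.
        apply Rinv_le_contravar; [lra|]. assert (X := exp_ineq1_le (2 * y)). lra. }
      assert (E2 : D * exp (- 2 * y) <= D * / (2 * y)) by (apply Rmult_le_compat_l; lra).
      assert (E3 : 3 * (D * / (2 * y)) < eps).
      { apply Rmult_lt_reg_r with (2 * y); [lra|].
        replace (3 * (D * / (2 * y)) * (2 * y)) with (3 * D) by (field; lra).
        apply Rmult_lt_compat_r with (r := 2 * eps) in Hy; [|lra].
        replace (3 * D / (2 * eps) * (2 * eps)) with (3 * D) in Hy by (field; lra). lra. }
      rewrite Rabs_left1; lra. }
  exists (3 * D). split; [lra|]. intros y Hy. destruct (HJ y Hy). rewrite HG. lra.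
Qed.

Lemma RInt_cubic_kernel_scaled (m : nat) (r d : R) :
  0 < r ->
  RInt (fun u => u ^ m * exp (- (r * u) ^ 3)) 0 d = cubic_moment m (r * d) / r ^ S m.
Proof.
  intros Hr. assert (Hp : r ^ S m <> 0) by (apply pow_nonzero; lra).
  assert (H := RInt_comp_lin (V := R_CompleteNormedModule) (cubic_kernel m) r 0 0 d
                 (cubic_kernel_ex_RInt m _ _)).
  rewrite Rmult_0_r, !Rplus_0_r in H. unfold cubic_moment. rewrite <- H.
  unfold Rdiv. rewrite Rmult_comm.
  rewrite <- (RInt_scal (V := R_CompleteNormedModule)).
  - apply RInt_ext. intros u _. change (u ^ m * exp (- (r * u) ^ 3) = / r ^ S m * (r * cubic_kernel m (r * u + 0))).
    unfold cubic_kernel. rewrite Rplus_0_r, (Rpow_mult_distr r u m), <- (tech_pow_Rmult r m). field.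
    split; [apply pow_nonzero; lra | lra].
  - apply (ex_RInt_continuous (V := R_CompleteNormedModule)). intros u _.
    apply (ex_derive_continuous (V := R_NormedModule)). unfold scal; simpl; unfold mult; simpl.
    unfold cubic_kernel. auto_derive. trivial.
Qed.

Lemma exp_neg_le_inv_pow (p : nat) (c : R) :
  0 < c -> exists D, 0 < D /\ forall r, 0 < r -> exp (- c * r) <= D / r ^ p.
Proof.
  intros Hc. exists (INR (fact p) / c ^ p). assert (HF := INR_fact_lt_0 p).
  assert (Hcp : 0 < c ^ p) by now apply pow_lt.
  split; [now apply Rdiv_lt_0_compat|]. intros r Hr.
  assert (Hrp : 0 < r ^ p) by now apply pow_lt.
  assert (H := pow_le_fact_exp p (c * r) ltac:(nra)). rewrite Rpow_mult_distr in H.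
  replace (- c * r) with (- (c * r)) by ring. rewrite exp_Ropp.
  assert (He := exp_pos (c * r)).
  apply Rmult_le_reg_r with (exp (c * r) * (c ^ p * r ^ p)); [apply Rmult_lt_0_compat; nra|].
  replace (/ exp (c * r) * (exp (c * r) * (c ^ p * r ^ p))) with (c ^ p * r ^ p) by (field; lra).
  replace (INR (fact p) / c ^ p / r ^ p * (exp (c * r) * (c ^ p * r ^ p)))
    with (INR (fact p) * exp (c * r)) by (field; lra).
  exact H.
Qed.

(** Uniform in [d] and [r]: it turns a factor [u^m] of an error term into [r^{-(m+1)}]. *)
Lemma truncated_moment_bound (m : nat) :
  exists D, 0 < D /\ forall r d, 0 < r -> 0 <= d ->
    0 <= RInt (fun u => u ^ m * exp (- (r * u) ^ 3)) 0 d <= D / r ^ S m.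
Proof.
  destruct (Gamma_cubic_moment m) as [D [HD H]].
  exists (Rabs (Gamma ((INR m + 1) / 3)) + 1). split.
  { assert (X := Rabs_pos (Gamma ((INR m + 1) / 3))). lra. }
  intros r d Hr Hd. rewrite RInt_cubic_kernel_scaled by exact Hr.
  assert (Hp : 0 < r ^ S m) by now apply pow_lt.
  destruct (H (r * d) ltac:(nra)) as [H1 H2].
  assert (X := Rle_abs (Gamma ((INR m + 1) / 3))). split.
  - apply Rmult_le_pos; [lra | left; now apply Rinv_0_lt_compat].
  - apply Rmult_le_compat_r; [left; now apply Rinv_0_lt_compat | lra].
Qed.

(** Cutting the moment at [d] costs [e^{-2 r d}], smaller than any power [r^{-p}]. *)
Lemma truncated_moment_Gamma (m p : nat) (d : R) :
  0 < d -> exists D, 0 < D /\ forall r, 1 <= r ->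
    Rabs (3 * RInt (fun u => u ^ m * exp (- (r * u) ^ 3)) 0 d - Gamma ((INR m + 1) / 3) / r ^ S m)
      <= D / r ^ p.
Proof.
  intros Hd. destruct (Gamma_cubic_moment m) as [D [HD H]].
  destruct (exp_neg_le_inv_pow p (2 * d) ltac:(lra)) as [D' [HD' H']].
  exists (D * D'). split; [nra|]. intros r Hr.
  rewrite RInt_cubic_kernel_scaled by lra.
  assert (Hp : 1 <= r ^ S m) by (apply pow_R1_Rle; exact Hr).
  destruct (H (r * d) ltac:(nra)) as [H1 H2]. specialize (H' r ltac:(lra)).
  replace (3 * (cubic_moment m (r * d) / r ^ S m) - Gamma ((INR m + 1) / 3) / r ^ S m)
    with (- ((Gamma ((INR m + 1) / 3) - 3 * cubic_moment m (r * d)) * / r ^ S m))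
    by (field; apply pow_nonzero; lra).
  rewrite Rabs_Ropp, Rabs_mult, (Rabs_pos_eq (_ - _)) by lra.
  rewrite Rabs_pos_eq by (left; apply Rinv_0_lt_compat; lra).
  assert (Hi : / r ^ S m <= 1) by (rewrite <- Rinv_1; apply Rinv_le_contravar; lra).
  assert (Hi0 : 0 < / r ^ S m) by (apply Rinv_0_lt_compat; lra).
  replace (- (2 * d) * r) with (- 2 * (r * d)) in H' by ring.
  unfold Rdiv in *. nra.
Qed.

(** * The closing arc *)

Definition arc (r th : R) : path :=
  Path (fun u => (r * Cexp (Ci * u))%C) (fun u => (Ci * (r * Cexp (Ci * u)))%C) th.

Lemma is_Cderive_arc (r th u : R) : is_Cderive (pt (arc r th)) u (vel (arc r th) u).
Proof.
  eapply is_Cderive_eq.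
  - apply is_Cderive_mult; [apply is_Cderive_const|].
    apply is_Cderive_Cexp, is_Cderive_mult; [apply is_Cderive_const|].
    apply is_Cderive_RtoC. exact (is_derive_id u).
  - unfold one. simpl. ring.
Qed.

Lemma Cmod_arc (r th u : R) : 0 <= r -> Cmod (pt (arc r th) u) = r.
Proof.
  intros Hr. simpl. rewrite Cmod_mult, Cmod_R, Cmod_Cexp, Rabs_pos_eq by exact Hr.
  simpl. replace (0 * u - 1 * 0) with 0 by ring. rewrite exp_0. ring.
Qed.

Lemma arc_ok (r th : R) : 0 < r -> 0 <= th -> path_ok (arc r th).
Proof.
  intros Hr Hth. split; [exact Hth|]. intros u _. split; [|split].
  - apply Cmod_gt_0. rewrite Cmod_arc by lra. exact Hr.
  - apply is_Cderive_arc.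
  - apply (is_Cderive_continuous _ _ (0 * pt (arc r th) u + Ci * vel (arc r th) u)%C).
    apply (is_Cderive_mult (fun _ => Ci) (pt (arc r th))).
    + apply is_Cderive_const.
    + apply is_Cderive_arc.
Qed.

Lemma Im_int_arc_inv (r th : R) : 0 < r -> 0 <= th -> Im_int (arc r th) Cinv = th.
Proof.
  intros Hr Hth. unfold Im_int. rewrite (RInt_ext _ (fun _ => 1)).
  - rewrite RInt_const. simpl. unfold scal; simpl; unfold mult; simpl. ring.
  - intros u _. assert (H : pt (arc r th) u <> 0).
    { apply Cmod_gt_0. rewrite Cmod_arc by lra. exact Hr. }
    change (vel (arc r th) u) with (Ci * pt (arc r th) u)%C.
    replace (/ pt (arc r th) u * (Ci * pt (arc r th) u))%C with Ci by (field; exact H).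
    reflexivity.
Qed.

(** Where the real part is negative, [atan (y / x)] differs from the argument by a constant, so it
    is a primitive of the imaginary part of [dt / t]. *)
Lemma Im_int_inv_left_half_plane (q : path) :
  path_ok q -> (forall u, 0 <= u <= len q -> fst (pt q u) < 0) ->
  Im_int q Cinv = atan (snd (pt q (len q)) / fst (pt q (len q))) - atan (snd (pt q 0) / fst (pt q 0)).
Proof.
  intros Hq Hneg. apply is_RInt_unique.
  apply (is_RInt_derive (V := R_CompleteNormedModule) (fun u => atan (snd (pt q u) / fst (pt q u)))).
  - intros u Hu. rewrite Rmin_left, Rmax_right in Hu by apply Hq.
    specialize (Hneg u Hu). destruct Hq as [_ Hq]. destruct (Hq u Hu) as [_ [[D1 D2] _]].
    eapply is_derive_eq.
    + apply (is_derive_Rcomp atan (fun u => snd (pt q u) / fst (pt q u))).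
      * apply is_derive_Reals, derivable_pt_lim_atan.
      * apply (is_derive_div (fun u => snd (pt q u)) (fun u => fst (pt q u))); [exact D2 | exact D1 | lra].
    + simpl. unfold Rsqr. field. repeat split; nra.
  - intros u Hu. rewrite Rmin_left, Rmax_right in Hu by apply Hq.
    apply path_integrand_continuous; [exact Hq | apply path_derivable_inv | exact Hu].
Qed.

Lemma polar_left_half_plane (z : C) :
  fst z < 0 -> (RtoC (Cmod z) * Cexp (Ci * RtoC (PI + atan (snd z / fst z))))%C = z.
Proof.
  intros Hz. set (q := snd z / fst z).
  assert (Hs : Cmod z = - fst z * sqrt (1 + q²)).
  { apply Rsqr_inj; [apply Cmod_ge_0 | |].
    - apply Rmult_le_pos; [lra | apply sqrt_pos].
    - unfold Rsqr. rewrite Cmod_sqr.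
      replace (- fst z * sqrt (1 + q * q) * (- fst z * sqrt (1 + q * q)))
        with (fst z * fst z * (sqrt (1 + q * q) * sqrt (1 + q * q))) by ring.
      rewrite sqrt_sqrt by nra. unfold q. field. lra. }
  assert (Hp : 0 < sqrt (1 + q²)) by (apply sqrt_lt_R0; unfold Rsqr; nra).
  rewrite Hs. apply C_eq; simpl.
  - replace (0 * (PI + atan q) - 1 * 0) with 0 by ring.
    replace (0 * 0 + 1 * (PI + atan q)) with (atan q + PI) by ring.
    rewrite exp_0, neg_cos, cos_atan. field. lra.
  - replace (0 * (PI + atan q) - 1 * 0) with 0 by ring.
    replace (0 * 0 + 1 * (PI + atan q)) with (atan q + PI) by ring.
    rewrite exp_0, neg_sin, sin_atan. unfold q at 2. field. lra.
Qed.

(** Circle about the origin from the positive real axis to the end of [q]. The angle is the argument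
    of that endpoint when its real part is negative. *)
Definition closing_arc (q : path) : path :=
  let z := pt q (len q) in arc (Cmod z) (PI + atan (snd z / fst z)).

(** The arc turns by [PI + atan (y / x)] and [q], which starts on the negative real axis, by
    [atan (y / x)]; the difference is [PI]. *)
Lemma closing_arc_half_loop (q : path) :
  path_ok q -> (forall u, 0 <= u <= len q -> fst (pt q u) < 0) -> Im (pt q 0) = 0 ->
  half_loop (closing_arc q) q.
Proof.
  intros Hq Hneg H0. assert (Hl : 0 <= len q) by apply Hq.
  set (z := pt q (len q)). assert (Hz : fst z < 0) by (apply Hneg; lra).
  assert (Hr : 0 < Cmod z).
  { apply Cmod_gt_0. intros E. rewrite E in Hz. simpl in Hz. lra. }
  assert (Hth : 0 <= PI + atan (snd z / fst z)).
  { assert (B := atan_bound (snd z / fst z)). assert (P := PI_RGT_0). lra. }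
  assert (Ep : pt (closing_arc q) (len (closing_arc q)) = z) by now apply polar_left_half_plane.
  unfold half_loop. split; [now apply arc_ok|]. split; [exact Hq|]. split; [|split; [exact H0|split]].
  - simpl. replace (0 * 0 + 1 * 0) with 0 by ring. rewrite sin_0. unfold Im. simpl. ring.
  - exact Ep.
  - unfold contour_int, closing_arc. fold z. rewrite Im_int_arc_inv by assumption.
    rewrite Im_int_inv_left_half_plane by assumption. fold z.
    unfold Im in H0. rewrite H0.
    replace (0 / fst (pt q 0)) with 0 by (unfold Rdiv; ring). rewrite atan_0. ring.
Qed.

(* The integrand is the [n]-th power of [phase]; its double saddle point is [t = -1]. *)
Definition phase (t : C) : C := (- Cexp (1 - Cexp (1 + t)) * / t)%C.

Lemma path_derivable_phase : path_derivable phase.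
Proof.
  apply (path_derivable_mult (fun t => - Cexp (1 - Cexp (1 + t)))%C Cinv); [|apply path_derivable_inv].
  assert (H : path_derivable (fun t => (RtoC (-1) * Cexp (1 + RtoC (-1) * Cexp (1 + t)))%C)).
  { apply path_derivable_mult; [apply path_derivable_const|].
    apply path_derivable_Cexp, path_derivable_plus; [apply path_derivable_const|].
    apply path_derivable_mult; [apply path_derivable_const|].
    apply path_derivable_Cexp, path_derivable_plus; [apply path_derivable_const | apply path_derivable_id]. }
  destruct H as [f H]. exists f. intros g u a Hu D.
  apply (is_Cderive_ext (fun v => (RtoC (-1) * Cexp (1 + RtoC (-1) * Cexp (1 + g v)))%C)); [|now apply H].
  intros v. replace (1 + RtoC (-1) * Cexp (1 + g v))%C with (1 - Cexp (1 + g v))%C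
    by (apply C_eq; simpl; ring).
  apply C_eq; simpl; ring.
Qed.

Lemma Cmod_phase (t : C) :
  t <> 0 -> Cmod (phase t) = exp (1 - exp (1 + fst t) * cos (snd t)) / Cmod t.
Proof.
  intros Ht. unfold phase. rewrite Cmod_mult, Cmod_opp, Cmod_inv, Cmod_Cexp by exact Ht.
  simpl. rewrite Rplus_0_l. reflexivity.
Qed.

(* On a circle of radius at most 1, [exp (1 + r cos th) cos (r sin th)] has derivative
   [- r exp (1 + r cos th) sin (th + r sin th)], which is nonpositive on [0, PI]. *)
Lemma phase_arc_monotone (r th u : R) :
  0 < r <= 1 -> 0 <= u <= th -> th <= PI ->
  Cmod (phase (pt (arc r th) u)) <= Cmod (phase (pt (arc r th) th)).
Proof.
  intros Hr Hu Hth.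
  assert (N : forall v, pt (arc r th) v <> 0).
  { intros v. apply Cmod_gt_0. rewrite Cmod_arc; lra. }
  rewrite !Cmod_phase, !Cmod_arc by (auto; lra).
  apply Rmult_le_compat_r; [left; apply Rinv_0_lt_compat; lra|].
  apply exp_le_compat. unfold Rminus. apply Rplus_le_compat_l, Ropp_le_contravar.
  assert (E : forall v, exp (1 + fst (pt (arc r th) v)) * cos (snd (pt (arc r th) v)) =
                exp (1 + r * cos v) * cos (r * sin v)).
  { intros v. simpl. replace (0 * v - 1 * 0) with 0 by ring.
    replace (0 * 0 + 1 * v) with v by ring. rewrite exp_0. f_equal; f_equal; ring. }
  rewrite !E.
  assert (D : forall v, is_derive (fun v => exp (1 + r * cos v) * cos (r * sin v)) v
                (- r * exp (1 + r * cos v) * sin (v + r * sin v))).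
  { intros v. eapply is_derive_eq.
    - auto_derive; [trivial | reflexivity].
    - rewrite sin_plus. ring. }
  assert (H : exp (1 + r * cos th) * cos (r * sin th) - exp (1 + r * cos u) * cos (r * sin u) <= 0 - 0).
  { apply (incr_diff_le (fun v => exp (1 + r * cos v) * cos (r * sin v)) (fun _ => 0)
      (fun v => - r * exp (1 + r * cos v) * sin (v + r * sin v)) (fun _ => 0)); [lra| | |].
    - intros v _. apply D.
    - intros v _. exact (is_derive_const (V := R_NormedModule) 0 v).
    - intros v Hv. assert (S0 : 0 <= sin v) by (apply sin_ge_0; lra).
      (* Since [r <= 1], this keeps [v + r sin v] in [[0, PI]], where the sine is nonnegative. *)
      assert (S1 : sin v <= PI - v).
      { rewrite <- sin_PI_x.
        assert (X := incr_diff_le sin (fun x => x) cos (fun _ => 1) 0 (PI - v) ltac:(lra)).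
        rewrite sin_0 in X. cbv beta in X. rewrite !Rminus_0_r in X. apply X.
        - intros x _. apply is_derive_sin.
        - intros x _. exact (is_derive_id x).
        - intros x _. apply COS_bound. }
      assert (S2 : 0 <= sin (v + r * sin v)) by (apply sin_ge_0; nra).
      assert (E0 := exp_pos (1 + r * cos v)).
      assert (0 <= exp (1 + r * cos v) * sin (v + r * sin v)) by nra. nra. }
  lra.
Qed.

(** * The path through the saddle *)

Lemma is_Cderive_partial_pseries (a : nat -> R) (K : nat) (g : R -> C) (u : R) (l : C) :
  is_Cderive g u l ->
  is_Cderive (fun v => partial_pseries a (S K) (g v)) u (l * partial_pseries (PS_derive a) K (g u))%C.
Proof.
  intros D. induction K as [|K IH].
  - apply (is_Cderive_ext (fun _ => (0 + a 0%nat * 1)%C)); [reflexivity|].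
    eapply is_Cderive_eq; [apply is_Cderive_const | unfold partial_pseries; simpl; ring].
  - apply (is_Cderive_ext (fun v => (partial_pseries a (S K) (g v) + a (S K) * g v ^ S K)%C));
      [reflexivity|].
    eapply is_Cderive_eq.
    + apply is_Cderive_plus; [exact IH|].
      apply is_Cderive_mult; [apply is_Cderive_const | apply is_Cderive_pow; exact D].
    + change (partial_pseries (PS_derive a) (S K) (g u)) with
        (partial_pseries (PS_derive a) K (g u) + PS_derive a K * g u ^ K)%C.
      replace (PS_derive a K) with (INR (S K) * a (S K)) by reflexivity. rewrite RtoC_mult. ring.
Qed.

Lemma partial_pseries_bounded (a : nat -> R) (N : nat) :
  exists M, 0 <= M /\ forall z, Cmod z <= 1 -> Cmod (partial_pseries a N z) <= M.
Proof.
  destruct (is_rpoly_partial_pseries a N) as [l Hl].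
  destruct (peval_bounded l) as [M [HM B]]. exists M. split; [exact HM|].
  intros z Hz. rewrite Hl. auto.
Qed.

(** Gronwall's estimate. As [|f|^2] has derivative [2 |f|^2 Re k], the product
    [|f|^2 e^{-2 c u^{p+1}}] does not increase; the resulting bound on [|f'|] is then integrated to
    compare [f] with 1. *)
Lemma exp_growth (f k : R -> C) (c d : R) (p : nat) :
  0 <= c -> 0 <= d ->
  (forall u, 0 <= u <= d -> is_Cderive f u (f u * k u)%C) ->
  (forall u, 0 <= u <= d -> Cmod (k u) <= c * u ^ p) -> f 0 = 1 ->
  forall u, 0 <= u <= d ->
    Cmod (f u) <= exp (c * u ^ S p) /\ Cmod (f u - 1) <= exp (c * u ^ S p) - 1.
Proof.
  intros Hc Hd D Hk H0.
  assert (DE : forall v, is_derive (fun v => c * v ^ S p) v (c * (INR (S p) * v ^ p))).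
  { intros v. eapply is_derive_eq.
    - apply is_derive_scal, is_derive_pow. exact (is_derive_id v).
    - change (c * (INR (S p) * 1 * v ^ p) = c * (INR (S p) * v ^ p)). ring. }
  (* The sharp exponent would be [c u^{p+1} / (p+1)]; giving up the divisor keeps the bounds
     simple. *)
  assert (Hp : forall v, 0 <= v -> c * v ^ p <= c * (INR (S p) * v ^ p)).
  { intros v Hv. apply Rmult_le_compat_l; [exact Hc|].
    rewrite <- (Rmult_1_l (v ^ p)) at 1. apply Rmult_le_compat_r; [now apply pow_le|].
    rewrite S_INR. assert (0 <= INR p) by apply pos_INR. lra. }
  assert (B1 : forall u, 0 <= u <= d -> Cmod (f u) <= exp (c * u ^ S p)).
  { intros u Hu.
    set (N := fun v => fst (f v) * fst (f v) + snd (f v) * snd (f v)).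
    set (E := fun v => exp (- 2 * (c * v ^ S p))).
    assert (HN : N u * E u - N 0 * E 0 <= 0 - 0).
    { apply (incr_diff_le (fun v => N v * E v) (fun _ => 0)
        (fun v => (2 * (N v * Re (k v))) * E v + N v * (- 2 * (c * (INR (S p) * v ^ p)) * E v))
        (fun _ => 0) 0 u (proj1 Hu)).
      - intros v Hv. apply is_derive_Rmult.
        + destruct (D v) as [D1 D2]; [lra|]. eapply is_derive_eq.
          * apply (is_derive_plus (fun v => fst (f v) * fst (f v)) (fun v => snd (f v) * snd (f v)));
              apply is_derive_Rmult; eassumption.
          * unfold plus, N, Re; simpl. ring.
        + apply (is_derive_Rcomp exp (fun v => - 2 * (c * v ^ S p))).
          * apply is_derive_exp.
          * apply is_derive_scal, DE.
      - intros v _. exact (is_derive_const (V := R_NormedModule) 0 v).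
      - intros v Hv. assert (HN : 0 <= N v) by (unfold N; nra).
        assert (HE : 0 < E v) by apply exp_pos.
        assert (HR : Re (k v) <= c * (INR (S p) * v ^ p)).
        { eapply Rle_trans; [apply Rle_abs|]. eapply Rle_trans; [apply re_le_Cmod|].
          eapply Rle_trans; [apply Hk; lra | apply Hp; lra]. }
        replace ((2 * (N v * Re (k v))) * E v + N v * (- 2 * (c * (INR (S p) * v ^ p)) * E v))
          with (- (2 * ((N v * E v) * (c * (INR (S p) * v ^ p) - Re (k v))))) by ring.
        assert (0 <= (N v * E v) * (c * (INR (S p) * v ^ p) - Re (k v)))
          by (apply Rmult_le_pos; [nra | lra]).
        lra. }
    unfold N at 2, E at 2 in HN. rewrite H0, pow_i in HN by lia. simpl fst in HN. simpl snd in HN.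
    replace (-2 * (c * 0)) with 0 in HN by ring. rewrite exp_0 in HN.
    assert (HE : E u * (exp (c * u ^ S p) * exp (c * u ^ S p)) = 1).
    { unfold E. rewrite <- !exp_plus, <- exp_0. f_equal. ring. }
    assert (P := exp_pos (c * u ^ S p)).
    apply Rsqr_incr_0; [|apply Cmod_ge_0 | lra].
    unfold Rsqr. rewrite Cmod_sqr. fold (N u).
    replace (N u) with (N u * E u * (exp (c * u ^ S p) * exp (c * u ^ S p)))
      by (rewrite Rmult_assoc, HE; ring).
    nra. }
  intros u Hu. split; [now apply B1|].
  rewrite <- H0. replace (exp (c * u ^ S p) - 1) with (exp (c * u ^ S p) - exp (c * 0 ^ S p))
    by (rewrite pow_i by lia; rewrite Rmult_0_r, exp_0; reflexivity).
  apply (Cderive_bound f (fun v => (f v * k v)%C) (fun v => exp (c * v ^ S p))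
           (fun v => c * (INR (S p) * v ^ p) * exp (c * v ^ S p))); [apply Hu | | |].
  - intros v Hv. apply D. lra.
  - intros v _. apply (is_derive_Rcomp exp (fun v => c * v ^ S p)); [apply is_derive_exp | apply DE].
  - intros v Hv. rewrite Cmod_mult, Rmult_comm. apply Rmult_le_compat; try apply Cmod_ge_0.
    + eapply Rle_trans; [apply Hk; lra | apply Hp; lra].
    + apply B1. lra.
Qed.

Definition zeta : C := Cexp (Ci * RtoC (PI / 3)).

Lemma zeta_pow (n : nat) : (zeta ^ n)%C = (cos (INR n * (PI / 3)), sin (INR n * (PI / 3))).
Proof.
  unfold zeta. rewrite Cexp_pow. unfold Cexp. simpl.
  replace (INR n * (0 * (PI / 3) - 1 * 0) - 0 * (0 * 0 + 1 * (PI / 3))) with 0 by ring.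
  replace (INR n * (0 * 0 + 1 * (PI / 3)) + 0 * (0 * (PI / 3) - 1 * 0)) with (INR n * (PI / 3)) by ring.
  rewrite exp_0. f_equal; ring.
Qed.

Lemma zeta_cube : (zeta * zeta * zeta)%C = RtoC (-1).
Proof.
  replace (zeta * zeta * zeta)%C with (zeta ^ 3)%C by (simpl; ring).
  rewrite zeta_pow. replace (INR 3 * (PI / 3)) with PI by (simpl; field).
  rewrite cos_PI, sin_PI. reflexivity.
Qed.

Lemma Cmod_zeta : Cmod zeta = 1.
Proof.
  unfold zeta. rewrite Cmod_Cexp. simpl.
  replace (0 * (PI / 3) - 1 * 0) with 0 by ring. apply exp_0.
Qed.

Lemma Re_zeta : fst zeta = 1 / 2.
Proof.
  rewrite <- (Cpow_1_r zeta), zeta_pow. simpl. rewrite Rmult_1_l. apply cos_PI3.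
Qed.

Lemma Im_zeta : 1 / 2 <= snd zeta.
Proof.
  rewrite <- (Cpow_1_r zeta), zeta_pow. simpl. rewrite Rmult_1_l, sin_PI3.
  assert (H : sqrt 1 <= sqrt 3) by (apply sqrt_le_1; lra). rewrite sqrt_1 in H. lra.
Qed.

(* The image under [tau] of the ray of argument [PI / 3], seen from the double saddle [-1];
   [tau] is truncated so that no convergence is needed. *)
Definition saddle_path (a : nat -> R) (K : nat) (d : R) : path :=
  Path (fun u => (partial_pseries a (S K) (zeta * u) - 1)%C)
       (fun u => (zeta * partial_pseries (PS_derive a) K (zeta * u))%C) d.

Lemma is_Cderive_zeta_mult (u : R) : is_Cderive (fun v => (zeta * RtoC v)%C) u zeta.
Proof.
  eapply is_Cderive_eq.
  - apply is_Cderive_mult; [apply is_Cderive_const | apply is_Cderive_RtoC; exact (is_derive_id u)].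
  - unfold one; simpl. ring.
Qed.

Lemma is_Cderive_saddle_path (a : nat -> R) (K : nat) (d u : R) :
  is_Cderive (pt (saddle_path a K d)) u (vel (saddle_path a K d) u).
Proof.
  eapply is_Cderive_eq.
  - apply is_Cderive_minus; [|apply is_Cderive_const].
    apply is_Cderive_partial_pseries, is_Cderive_zeta_mult.
  - simpl. ring.
Qed.

Lemma Ccontinuous_saddle_path (a : nat -> R) (K : nat) (d u : R) :
  Ccontinuous (vel (saddle_path a K d)) u.
Proof.
  destruct K as [|K].
  - apply (is_Cderive_continuous _ _ 0).
    apply (is_Cderive_ext (fun _ => (zeta * 0)%C)); [reflexivity | apply is_Cderive_const].
  - eapply is_Cderive_continuous. apply is_Cderive_mult; [apply is_Cderive_const|].
    apply is_Cderive_partial_pseries, is_Cderive_zeta_mult.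
Qed.

Lemma Cmod_zeta_mult (u : R) : 0 <= u -> Cmod (zeta * RtoC u) = u.
Proof. intros Hu. rewrite Cmod_mult, Cmod_zeta, Cmod_R, Rabs_pos_eq by exact Hu. ring. Qed.

(** The path is [-1 + zeta u + O(u^2)]: its real part stays near -1, its imaginary part grows
    linearly, and its squared modulus is [1 - u + O(u^2)]. The three bounds are what the closing arc
    requires: the left half plane, an angle at most [PI] and a radius at most 1. *)
Lemma saddle_path_geometry (a : nat -> R) (K : nat) :
  (1 <= K)%nat -> a 0%nat = 0 -> a 1%nat = 1 ->
  exists d, 0 < d <= 1 /\ forall u, 0 <= u <= d ->
    fst (partial_pseries a (S K) (zeta * u) - 1)%C <= - 1 / 2 /\
    0 <= snd (partial_pseries a (S K) (zeta * u) - 1)%C /\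
    Cmod (partial_pseries a (S K) (zeta * u) - 1) <= 1.
Proof.
  intros HK H0 H1. destruct K as [|K]; [lia|].
  destruct (partial_pseries_bounded (PS_decr_1 (PS_decr_1 a)) K) as [M [HM B]].
  (* Makes the quadratic remainder at most [u / 16]. With [u <= 1/4] the squared modulus is at most
     [(1 - 7u/16)^2 + (17u/16)^2 <= 1]. *)
  assert (Hd1 : 0 < / (16 * (M + 1))) by (apply Rinv_0_lt_compat; lra).
  exists (Rmin (/ (16 * (M + 1))) (1 / 4)). split.
  { split; [apply Rmin_glb_lt; lra | eapply Rle_trans; [apply Rmin_r | lra]]. }
  intros u Hu. assert (A1 := Rmin_l (/ (16 * (M + 1))) (1 / 4)).
  assert (A2 := Rmin_r (/ (16 * (M + 1))) (1 / 4)).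
  assert (Hz : Cmod (zeta * RtoC u) = u) by (apply Cmod_zeta_mult; lra).
  set (e := (zeta * RtoC u * (zeta * RtoC u) *
             partial_pseries (PS_decr_1 (PS_decr_1 a)) K (zeta * RtoC u))%C).
  assert (Hw : partial_pseries a (S (S K)) (zeta * u) = (zeta * RtoC u + e)%C).
  { rewrite !partial_pseries_shift. unfold e. unfold PS_decr_1 at 1. rewrite H0, H1. ring. }
  assert (He : Cmod e <= u / 16).
  { unfold e. rewrite !Cmod_mult, <- Cmod_mult, Hz.
    specialize (B (zeta * RtoC u)%C ltac:(lra)).
    assert (u * M <= 1 / 16).
    { apply Rle_trans with (/ (16 * (M + 1)) * (M + 1)); [apply Rmult_le_compat; lra|].
      right. field. lra. }
    apply Rle_trans with (u * u * M); [apply Rmult_le_compat_l; nra | nra]. }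
  assert (Re_e := re_le_Cmod e). assert (Im_e := Im_le_Cmod e). unfold Re in Re_e. unfold Im in Im_e.
  apply Rabs_le_between in Re_e. apply Rabs_le_between in Im_e.
  rewrite Hw. set (X := fst (zeta * u + e - 1)%C). set (Y := snd (zeta * u + e - 1)%C).
  assert (EX : X = u / 2 + fst e - 1) by
    (change X with (fst zeta * u - snd zeta * 0 + fst e + - 1); rewrite Re_zeta; field).
  assert (EY : Y = snd zeta * u + snd e) by
    (change Y with (fst zeta * 0 + snd zeta * u + snd e + - 0); ring).
  assert (Hzz : fst zeta * fst zeta + snd zeta * snd zeta = 1)
    by (rewrite <- Cmod_sqr, Cmod_zeta; ring).
  rewrite Re_zeta in Hzz. assert (Iz := Im_zeta).
  assert (Iz' : snd zeta <= 1) by nra.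
  repeat split.
  - lra.
  - rewrite EY. nra.
  - apply Rsqr_incr_0; [|apply Cmod_ge_0 | lra]. unfold Rsqr. rewrite Cmod_sqr.
    fold X Y. rewrite EX, EY.
    assert (0 <= snd zeta * u + snd e <= 17 / 16 * u) by nra.
    assert (7 / 16 * u <= u / 2 + fst e <= 9 / 16 * u) by lra.
    nra.
Qed.

(** The logarithmic derivative of [phase] along the path is [- q' e^{1+q} - q' / q] and that of
    [e^{u^3/6}] is [u^2 / 2]. As [zeta^3 = -1], the latter is the term [s^2 / 2] of [saddle_ode] at
    [s = zeta u], so the sum is a multiple of the defect. *)
Lemma phase_saddle_path (a : nat -> R) (K : nat) (d u : R) :
  pt (saddle_path a K d) u <> 0 ->
  is_Cderive (fun v => (phase (pt (saddle_path a K d) v) * RtoC (exp (v ^ 3 / 6)))%C) u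
    (phase (pt (saddle_path a K d) u) * RtoC (exp (u ^ 3 / 6)) *
     (zeta * saddle_ode (partial_pseries a (S K) (zeta * u))
               (partial_pseries (PS_derive a) K (zeta * u)) (zeta * u) *
      - / pt (saddle_path a K d) u))%C.
Proof.
  intros Hn. set (q := pt (saddle_path a K d)). fold q in Hn.
  assert (Dq := is_Cderive_saddle_path a K d u). fold q in Dq.
  assert (DP : is_Cderive (fun v => phase (q v)) u
    (phase (q u) * (- (vel (saddle_path a K d) u * Cexp (1 + q u)) - vel (saddle_path a K d) u * / q u))%C).
  { eapply is_Cderive_eq.
    - apply is_Cderive_mult.
      + apply is_Cderive_opp, is_Cderive_Cexp, is_Cderive_minus; [apply is_Cderive_const|].
        apply is_Cderive_Cexp, is_Cderive_plus; [apply is_Cderive_const | exact Dq].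
      + apply is_Cderive_inv; [exact Hn | exact Dq].
    - unfold phase. ring. }
  assert (D3 : is_derive (fun v => exp (v ^ 3 / 6)) u (u * u / 2 * exp (u ^ 3 / 6))).
  { apply (is_derive_Rcomp exp (fun v => v ^ 3 / 6)); [apply is_derive_exp|].
    auto_derive; [trivial | simpl; field]. }
  eapply is_Cderive_eq.
  - apply is_Cderive_mult; [exact DP|]. apply is_Cderive_RtoC, D3.
  - unfold saddle_ode.
    assert (Eq : q u = (partial_pseries a (S K) (zeta * u) - 1)%C) by reflexivity.
    assert (Ew : (1 + q u)%C = partial_pseries a (S K) (zeta * u)) by (rewrite Eq; ring).
    set (w := partial_pseries a (S K) (zeta * u)) in *.
    simpl vel. set (dw := partial_pseries (PS_derive a) K (zeta * u)).
    rewrite Ew, RtoC_mult. replace (1 - w)%C with (- q u)%C by (rewrite Eq; ring).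
    replace (zeta * ((1 - - q u * Cexp w) * dw - - q u * (zeta * u * (zeta * u) / 2)) * - / q u)%C
      with (- (zeta * dw * Cexp w) - zeta * dw * / q u + - (zeta * zeta * zeta) * (u * u / 2))%C
      by (field; exact Hn).
    rewrite zeta_cube, RtoC_div, RtoC_mult by lra.
    set (E := RtoC (exp (u ^ 3 / 6))). replace (RtoC (-1)) with (- RtoC 1)%C by (apply C_eq; simpl; ring).
    field. exact Hn.
Qed.

Lemma Cpow_minus_1_bound (z : C) (B : R) (n : nat) :
  1 <= B -> Cmod z <= B -> Cmod (z ^ n - 1) <= INR n * Cmod (z - 1) * B ^ n.
Proof.
  intros HB Hz. induction n as [|n IH].
  - simpl. replace (1 - 1)%C with (RtoC 0) by ring. rewrite Cmod_0. lra.
  - rewrite Cpow_S. replace (z * z ^ n - 1)%C with (z * (z ^ n - 1) + (z - 1))%C by ring.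
    eapply Rle_trans; [apply Cmod_triangle|]. rewrite Cmod_mult, S_INR.
    assert (H1 : 1 <= B ^ S n) by now apply pow_R1_Rle.
    assert (H2 : Cmod z * Cmod (z ^ n - 1) <= B * (INR n * Cmod (z - 1) * B ^ n))
      by (apply Rmult_le_compat; auto; apply Cmod_ge_0).
    assert (H3 := Cmod_ge_0 (z - 1)).
    replace ((INR n + 1) * Cmod (z - 1) * B ^ S n)
      with (B * (INR n * Cmod (z - 1) * B ^ n) + Cmod (z - 1) * B ^ S n) by (simpl pow; ring).
    nra.
Qed.

Lemma exp_INR_mult_pow (n : nat) (y : R) : exp (INR n * y) = exp y ^ n.
Proof.
  induction n as [|n IH]; [simpl; rewrite Rmult_0_l; apply exp_0|].
  rewrite S_INR, Rmult_plus_distr_r, exp_plus, IH, Rmult_1_l. simpl. ring.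
Qed.

Lemma exp_minus_1_le (y : R) : exp y - 1 <= y * exp y.
Proof.
  assert (H := exp_ineq1_le (- y)). assert (P := exp_pos y).
  assert (E : exp y * exp (- y) = 1) by (rewrite <- exp_plus, <- exp_0; f_equal; ring).
  nra.
Qed.

(** A defect of order [M + 3] yields, after [exp_growth], a deviation of order [M + 4]. The
    smallness [c d^{M+1} <= 1/24] makes this deviation at most [u^3 / 24], a fraction of the decay
    [u^3 / 6]. *)
Lemma saddle_path_bounds (a : nat -> R) (M : nat) :
  a 0%nat = 0 -> a 1%nat = 1 ->
  (exists A, 0 <= A /\ forall z, Cmod z <= 1 ->
    Cmod (saddle_ode (partial_pseries a (S (S (S M))) z) (partial_pseries (PS_derive a) (S (S M)) z) z)
      <= A * Cmod z ^ (S (S (S M)))) ->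
  exists d c, 0 < d <= 1 /\ 0 <= c /\ c * d ^ S M <= / 24 /\
    forall u, 0 <= u <= d ->
      let t := pt (saddle_path a (S (S M)) d) u in
      fst t <= - 1 / 2 /\ 0 <= snd t /\ Cmod t <= 1 /\
      Cmod (phase t * RtoC (exp (u ^ 3 / 6))) <= exp (c * u ^ (M + 4)) /\
      Cmod (phase t * RtoC (exp (u ^ 3 / 6)) - 1) <= exp (c * u ^ (M + 4)) - 1.
Proof.
  intros H0 H1 [A [HA Hode]].
  destruct (saddle_path_geometry a (S (S M)) ltac:(lia) H0 H1) as [d0 [Hd0 G]].
  (* The 2 bounds [1 / |q u|], the real part of [q u] being at most [-1/2]. *)
  set (c := 2 * A).
  assert (Hq : 0 < / (24 * (c + 1))) by (apply Rinv_0_lt_compat; unfold c; lra).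
  set (d := Rmin d0 (/ (24 * (c + 1)))).
  assert (Hd : 0 < d) by (apply Rmin_glb_lt; lra).
  assert (Hd' : d <= d0) by apply Rmin_l.
  assert (Hd'' : d <= / (24 * (c + 1))) by apply Rmin_r.
  exists d, c. split; [lra|]. split; [unfold c; lra|]. split.
  { apply Rle_trans with ((c + 1) * d).
    - apply Rmult_le_compat; [unfold c; lra | apply pow_le; lra | lra |].
      assert (X : d ^ M <= 1) by (rewrite <- (pow1 M); apply pow_incr; lra).
      simpl. nra.
    - apply Rle_trans with ((c + 1) * / (24 * (c + 1))); [apply Rmult_le_compat_l; unfold c in *; lra|].
      right. field. unfold c; lra. }
  set (q := pt (saddle_path a (S (S M)) d)).
  assert (Hre : forall u, 0 <= u <= d -> / 2 <= Cmod (q u)).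
  { intros u Hu. destruct (G u ltac:(lra)) as [G1 _].
    eapply Rle_trans; [|apply re_le_Cmod].
    change (fst (q u) <= - 1 / 2) in G1. unfold Re. rewrite Rabs_left; lra. }
  assert (Hne : forall u, 0 <= u <= d -> q u <> 0).
  { intros u Hu. apply Cmod_gt_0. specialize (Hre u Hu). lra. }
  assert (Gr := exp_growth (fun v => (phase (q v) * RtoC (exp (v ^ 3 / 6)))%C)
    (fun u => (zeta * saddle_ode (partial_pseries a (S (S (S M))) (zeta * u))
       (partial_pseries (PS_derive a) (S (S M)) (zeta * u)) (zeta * u) * - / q u)%C)
    c d (S (S (S M))) ltac:(unfold c; lra) ltac:(lra)).
  intros u Hu t. destruct (G u ltac:(lra)) as [G1 [G2 G3]].
  split; [exact G1|]. split; [exact G2|]. split; [exact G3|].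
  replace (M + 4)%nat with (S (S (S (S M)))) by lia.
  apply Gr; [| | |exact Hu].
  - intros v Hv. apply phase_saddle_path. now apply Hne.
  - intros v Hv. rewrite !Cmod_mult, Cmod_zeta, Cmod_opp, Cmod_inv, Rmult_1_l by now apply Hne.
    assert (Hz := Cmod_zeta_mult v ltac:(lra)).
    specialize (Hode (zeta * v)%C ltac:(lra)). rewrite Hz in Hode.
    replace (c * v ^ S (S (S M))) with (A * v ^ S (S (S M)) * 2) by (unfold c; ring).
    apply Rmult_le_compat; [apply Cmod_ge_0 | left; apply Rinv_0_lt_compat | exact Hode |].
    + specialize (Hre v Hv). lra.
    + replace 2 with (/ / 2) by field. apply Rinv_le_contravar; [lra | now apply Hre].
  - assert (Eq : q 0 = RtoC (-1)).
    { unfold q. simpl. rewrite partial_pseries_shift, H0.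
      replace (zeta * 0)%C with (RtoC 0) by ring. apply C_eq; simpl; ring. }
    unfold phase. rewrite Eq. replace (1 + RtoC (-1))%C with (RtoC 0) by (apply C_eq; simpl; ring).
    rewrite Cexp_0. replace (1 - 1)%C with (RtoC 0) by ring. rewrite Cexp_0.
    replace (0 ^ 3 / 6) with 0 by (simpl; field). rewrite exp_0.
    replace (/ RtoC (-1))%C with (RtoC (-1)) by (rewrite <- RtoC_inv by lra; f_equal; field).
    apply C_eq; simpl; ring.
Qed.

(** * From the saddle path to a sum of moments *)

Lemma sum_n_Rsucc (f : nat -> R) (n : nat) : sum_n f (S n) = sum_n f n + f (S n).
Proof. exact (sum_Sn f n). Qed.

(** Origin of the sines: [s^m ds] at [s = zeta u] is [zeta^{m+1} u^m du]. *)
Lemma Im_zeta_partial_pseries (b : nat -> R) (M : nat) (u : R) :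
  Im (zeta * partial_pseries b (S M) (zeta * u)) =
  sum_n (fun m => b m * sin (INR (S m) * (PI / 3)) * u ^ m) M.
Proof.
  assert (T : forall m, Im (zeta * (b m * (zeta * u) ^ m)) = b m * sin (INR (S m) * (PI / 3)) * u ^ m).
  { intros m. rewrite Cpow_mult_l, <- RtoC_pow.
    replace (zeta * (b m * (zeta ^ m * RtoC (u ^ m))))%C with (zeta ^ S m * RtoC (b m * u ^ m))%C
      by (rewrite Cpow_S, RtoC_mult; ring).
    rewrite zeta_pow, im_scal_r. unfold Im, snd. ring. }
  induction M as [|M IH].
  - rewrite sum_O, <- T. unfold partial_pseries. simpl Csum. f_equal. ring.
  - rewrite sum_n_Rsucc, <- IH, <- T.
    change (partial_pseries b (S (S M)) (zeta * u)) with
      (partial_pseries b (S M) (zeta * u) + b (S M) * (zeta * u) ^ S M)%C.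
    rewrite Cmult_plus_distr_l, im_plus. reflexivity.
Qed.

Lemma continuous_sum_n (f : nat -> R -> R) (M : nat) (x : R) :
  (forall m, continuous (f m) x) -> continuous (fun u => sum_n (fun m => f m u) M) x.
Proof.
  intros Hf. induction M as [|M IH].
  - apply (continuous_ext (f 0%nat)); [|apply Hf]. intros u. now rewrite sum_O.
  - apply (continuous_ext (fun u => plus (sum_n (fun m => f m u) M) (f (S M) u))).
    + intros u. now rewrite sum_Sn.
    + apply (continuous_plus (V := R_NormedModule)); [exact IH | apply Hf].
Qed.

Lemma RInt_sum_n (f : nat -> R -> R) (a b : R) (M : nat) :
  (forall m x, continuous (f m) x) ->
  RInt (fun u => sum_n (fun m => f m u) M) a b = sum_n (fun m => RInt (f m) a b) M.
Proof.
  intros Hf. induction M as [|M IH].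
  - rewrite sum_O. apply RInt_ext. intros u _. now rewrite sum_O.
  - rewrite sum_Sn, <- IH, <- (RInt_plus (V := R_CompleteNormedModule)).
    + apply RInt_ext. intros u _. now rewrite sum_Sn.
    + apply (ex_RInt_continuous (V := R_CompleteNormedModule)). intros x _.
      now apply continuous_sum_n.
    + apply (ex_RInt_continuous (V := R_CompleteNormedModule)). intros x _. apply Hf.
Qed.

Lemma scaled_kernel_continuous (m : nat) (c r x : R) :
  continuous (fun u => c * (u ^ m * exp (- (r * u) ^ 3))) x.
Proof. apply (ex_derive_continuous (V := R_NormedModule)). auto_derive. trivial. Qed.

Lemma scaled_kernel_ex_RInt (m : nat) (c r a b : R) :
  ex_RInt (fun u => c * (u ^ m * exp (- (r * u) ^ 3))) a b.
Proof.
  apply (ex_RInt_continuous (V := R_CompleteNormedModule)). intros x _.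
  apply scaled_kernel_continuous.
Qed.

Lemma RInt_Rscal (f : R -> R) (a b c : R) :
  ex_RInt f a b -> RInt (fun u => c * f u) a b = c * RInt f a b.
Proof. exact (RInt_scal (V := R_CompleteNormedModule) f a b c). Qed.

Lemma RInt_scaled_kernel_scal (m : nat) (c r a b : R) :
  RInt (fun u => c * (u ^ m * exp (- (r * u) ^ 3))) a b =
  c * RInt (fun u => u ^ m * exp (- (r * u) ^ 3)) a b.
Proof.
  apply RInt_Rscal. apply (ex_RInt_ext (fun u => 1 * (u ^ m * exp (- (r * u) ^ 3)))).
  - intros x _. apply Rmult_1_l.
  - apply scaled_kernel_ex_RInt.
Qed.

Lemma sum_truncated_moments (g : nat -> R) (p N : nat) (d : R) :
  0 < d -> exists D, 0 < D /\ forall r, 1 <= r ->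
    Rabs (3 * sum_n (fun m => g m * RInt (fun u => u ^ m * exp (- (r * u) ^ 3)) 0 d) N
          - sum_n (fun m => g m * (Gamma ((INR m + 1) / 3) / r ^ S m)) N) <= D / r ^ p.
Proof.
  intros Hd.
  assert (T : forall m, exists D, 0 < D /\ forall r, 1 <= r ->
    Rabs (3 * (g m * RInt (fun u => u ^ m * exp (- (r * u) ^ 3)) 0 d)
      - g m * (Gamma ((INR m + 1) / 3) / r ^ S m)) <= D / r ^ p).
  { intros m. destruct (truncated_moment_Gamma m p d Hd) as [D [HD H]].
    assert (Hg := Rabs_pos (g m)).
    exists ((Rabs (g m) + 1) * D). split; [nra|]. intros r Hr. specialize (H r Hr).
    match goal with |- Rabs ?x <= _ =>
      replace x with (g m * (3 * RInt (fun u => u ^ m * exp (- (r * u) ^ 3)) 0 d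
        - Gamma ((INR m + 1) / 3) / r ^ S m)) by ring end.
    rewrite Rabs_mult.
    replace ((Rabs (g m) + 1) * D / r ^ p) with ((Rabs (g m) + 1) * (D / r ^ p))
      by (unfold Rdiv; ring).
    apply Rmult_le_compat; [exact Hg | apply Rabs_pos | lra | exact H]. }
  induction N as [|N [D [HD IH]]].
  - destruct (T 0%nat) as [D [HD H]]. exists D. split; [exact HD|]. intros r Hr.
    rewrite !sum_O. now apply H.
  - destruct (T (S N)) as [D' [HD' H']]. exists (D + D'). split; [lra|]. intros r Hr.
    rewrite !sum_n_Rsucc. specialize (IH r Hr). specialize (H' r Hr).
    replace ((D + D') / r ^ p) with (D / r ^ p + D' / r ^ p) by (unfold Rdiv; ring).
    match type of IH with Rabs ?x <= _ => match type of H' with Rabs ?y <= _ =>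
      match goal with |- Rabs ?z <= _ => replace z with (x + y) by ring end end end.
    eapply Rle_trans; [apply Rabs_triang|]. lra.
Qed.

(** The scale [r] is the cube root of [n / 6], so that [e^{- n u^3 / 6} = e^{-(r u)^3}]. The
    integrand is first compared pointwise with its leading part, then the comparison is
    integrated. *)
Lemma saddle_path_expansion (a : nat -> R) (M : nat) (d c : R) :
  0 < d <= 1 -> 0 <= c -> c * d ^ S M <= / 24 ->
  path_ok (saddle_path a (S (S M)) d) ->
  (forall u, 0 <= u <= d ->
     let t := pt (saddle_path a (S (S M)) d) u in
     Cmod (phase t * RtoC (exp (u ^ 3 / 6))) <= exp (c * u ^ (M + 4)) /\
     Cmod (phase t * RtoC (exp (u ^ 3 / 6)) - 1) <= exp (c * u ^ (M + 4)) - 1) ->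
  exists D, forall (n : nat) (r : R), (1 <= n)%nat -> 1 <= r -> INR n = 6 * r ^ 3 ->
    Rabs (3 * Im_int (saddle_path a (S (S M)) d) (fun t => (phase t ^ n)%C)
          - sum_n (fun m => PS_derive a m * sin (INR (S m) * (PI / 3))
                            * (Gamma ((INR m + 1) / 3) / r ^ S m)) M)
      <= D / r ^ (M + 2).
Proof.
  intros Hd Hc Hcd Hok HD1.
  set (q := saddle_path a (S (S M)) d) in *. set (b := PS_derive a).
  destruct (Ccontinuous_bounded (vel q) d) as [V [HV BV]].
  { intros u Hu. now apply Hok. }
  set (W := Rabs (b (S M))). assert (HW : 0 <= W) by apply Rabs_pos.
  set (g := fun m => b m * sin (INR (S m) * (PI / 3))).
  (* Two sources of error: the deviation of [phase ^ n] from the cubic exponential, and the last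
     coefficient of the velocity, which has one term more than the sum up to [M]. The halved [r]
     pays for the growth of the first. *)
  assert (Pt : forall (n : nat) (r u : R), (1 <= n)%nat -> 0 < r -> INR n = 6 * r ^ 3 -> 0 <= u <= d ->
    Rabs (Im (phase (pt q u) ^ n * vel q u) - sum_n (fun m => g m * (u ^ m * exp (- (r * u) ^ 3))) M)
    <= INR n * c * V * (u ^ (M + 4) * exp (- (r / 2 * u) ^ 3)) + W * (u ^ S M * exp (- (r / 2 * u) ^ 3))).
  { intros n r u Hn1 Hr Hn Hu. destruct (HD1 u Hu) as [B1 B2].
    set (t := pt q u) in *. set (e := exp (u ^ 3 / 6)) in *. set (eps := c * u ^ (M + 4)) in *.
    assert (Heps : 0 <= eps) by (apply Rmult_le_pos; [exact Hc | apply pow_le; lra]).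
    assert (Heps' : eps <= / 24 * u ^ 3).
    { unfold eps. replace (M + 4)%nat with (S M + 3)%nat by lia. rewrite pow_add, <- Rmult_assoc.
      apply Rmult_le_compat_r; [apply pow_le; lra|].
      eapply Rle_trans; [|exact Hcd]. apply Rmult_le_compat_l; [exact Hc|].
      apply pow_incr. lra. }
    set (E := exp (- (r * u) ^ 3)).
    assert (HE : (phase t ^ n)%C = (RtoC E * (phase t * e) ^ n)%C).
    { rewrite Cpow_mult_l, <- RtoC_pow. unfold e. rewrite <- exp_INR_mult_pow.
      replace (E * (phase t ^ n * exp (INR n * (u ^ 3 / 6))))%C
        with (phase t ^ n * RtoC (E * exp (INR n * (u ^ 3 / 6))))%C by (rewrite RtoC_mult; ring).
      unfold E. rewrite <- exp_plus, Hn.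
      replace (- (r * u) ^ 3 + 6 * r ^ 3 * (u ^ 3 / 6)) with 0 by field.
      rewrite exp_0. ring. }
    set (v0 := (zeta * partial_pseries b (S M) (zeta * u))%C).
    assert (Hv : vel q u = (v0 + zeta * (b (S M) * (zeta * u) ^ S M))%C).
    { unfold v0. change (vel q u) with (zeta * (partial_pseries b (S M) (zeta * u) +
        b (S M) * (zeta * u) ^ S M))%C. ring. }
    assert (Hsum : sum_n (fun m => g m * (u ^ m * E)) M = Im (RtoC E * v0)).
    { rewrite im_scal_l. unfold v0. rewrite Im_zeta_partial_pseries.
      rewrite <- (sum_n_mult_l (K := R_Ring) E). apply sum_n_ext. intros m.
      change (g m * (u ^ m * E) = E * (g m * u ^ m)). ring. }
    rewrite Hsum. unfold Rminus. rewrite <- im_opp, <- im_plus.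
    eapply Rle_trans; [apply Im_le_Cmod|].
    replace (phase t ^ n * vel q u + - (E * v0))%C
      with (RtoC E * (((phase t * e) ^ n - 1) * vel q u + zeta * (b (S M) * (zeta * u) ^ S M)))%C
      by (rewrite HE, Hv; ring).
    rewrite Cmod_mult, Cmod_R, Rabs_pos_eq by (left; apply exp_pos).
    assert (Hn0 : 0 <= INR n) by apply pos_INR.
    (* The base differs from 1 by at most [e^eps - 1 <= eps e^eps]; then [eps + n eps <= 2 n eps]
       because [n >= 1]. *)
    assert (K1 : Cmod ((phase t * e) ^ n - 1) <= INR n * eps * exp (2 * (INR n * eps))).
    { eapply Rle_trans; [apply (Cpow_minus_1_bound _ (exp eps))|].
      - rewrite <- exp_0. now apply exp_le_compat.
      - exact B1.
      - rewrite <- exp_INR_mult_pow.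
        apply Rle_trans with (INR n * (eps * exp eps) * exp (INR n * eps)).
        + apply Rmult_le_compat_r; [left; apply exp_pos|]. apply Rmult_le_compat_l; [exact Hn0|].
          eapply Rle_trans; [exact B2 | apply exp_minus_1_le].
        + rewrite !Rmult_assoc, <- exp_plus. apply Rmult_le_compat_l; [exact Hn0|].
          apply Rmult_le_compat_l; [exact Heps|]. apply exp_le_compat.
          apply le_INR in Hn1. simpl in Hn1. nra. }
    assert (K2 : Cmod (zeta * (b (S M) * (zeta * u) ^ S M)) <= W * u ^ S M).
    { rewrite !Cmod_mult, Cmod_pow, Cmod_zeta, Cmod_zeta_mult, Cmod_R by lra. unfold W. lra. }
    (* [2 n eps] is at most [12 r^3 u^3 / 24], half of the exponent of [E], and an eighth of that
       exponent is all that is claimed. *)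
    assert (K3 : E * exp (2 * (INR n * eps)) <= exp (- (r / 2 * u) ^ 3)).
    { unfold E. rewrite <- exp_plus. apply exp_le_compat. rewrite Hn.
      rewrite !Rpow_mult_distr. replace ((r / 2) ^ 3) with (r ^ 3 / 8) by field.
      assert (R3 : 0 < r ^ 3) by now apply pow_lt.
      assert (U3 : 0 <= u ^ 3) by (apply pow_le; lra).
      assert (R3e : r ^ 3 * eps <= r ^ 3 * (/ 24 * u ^ 3)) by (apply Rmult_le_compat_l; lra).
      assert (0 <= r ^ 3 * u ^ 3) by nra. lra. }
    assert (K4 : E <= exp (- (r / 2 * u) ^ 3)).
    { eapply Rle_trans; [|exact K3]. rewrite <- (Rmult_1_r E) at 1.
      apply Rmult_le_compat_l; [left; apply exp_pos|]. rewrite <- exp_0. apply exp_le_compat. nra. }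
    set (F := exp (- (r / 2 * u) ^ 3)) in *.
    apply Rle_trans with (E * (INR n * eps * exp (2 * (INR n * eps)) * V + W * u ^ S M)).
    { apply Rmult_le_compat_l; [left; apply exp_pos|].
      eapply Rle_trans; [apply Cmod_triangle|]. apply Rplus_le_compat; [|exact K2].
      rewrite Cmod_mult. apply Rmult_le_compat; try apply Cmod_ge_0; [exact K1 | now apply BV]. }
    rewrite Rmult_plus_distr_l. apply Rplus_le_compat.
    - replace (E * (INR n * eps * exp (2 * (INR n * eps)) * V))
        with (INR n * eps * V * (E * exp (2 * (INR n * eps)))) by ring.
      replace (INR n * c * V * (u ^ (M + 4) * F)) with (INR n * eps * V * F) by (unfold eps; ring).
      apply Rmult_le_compat_l; [|exact K3]. apply Rmult_le_pos; [|lra]. now apply Rmult_le_pos.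
    - replace (W * (u ^ S M * F)) with (F * (W * u ^ S M)) by ring.
      apply Rmult_le_compat_r; [|exact K4]. apply Rmult_le_pos; [exact HW | apply pow_le; lra]. }
  destruct (truncated_moment_bound (M + 4)) as [D1 [HD1p HD1']].
  destruct (truncated_moment_bound (S M)) as [D2 [HD2p HD2']].
  destruct (sum_truncated_moments g (M + 2) M d ltac:(lra)) as [D3 [HD3p HD3']].
  exists (3 * (6 * c * V * (D1 * 2 ^ (M + 5)) + W * (D2 * 2 ^ (M + 2))) + D3).
  intros n r Hn1 Hr Hn.
  assert (Hphi : path_derivable (fun t => (phase t ^ n)%C))
    by (apply path_derivable_pow, path_derivable_phase).
  assert (Ex1 := path_integrand_ex_RInt q _ Hok Hphi).
  assert (Ex2 : ex_RInt (fun u => sum_n (fun m => g m * (u ^ m * exp (- (r * u) ^ 3))) M) 0 d).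
  { apply (ex_RInt_continuous (V := R_CompleteNormedModule)). intros x _.
    apply (continuous_sum_n (fun m u => g m * (u ^ m * exp (- (r * u) ^ 3)))). intros m.
    apply scaled_kernel_continuous. }
  assert (Main : Rabs (Im_int q (fun t => (phase t ^ n)%C) -
      sum_n (fun m => g m * RInt (fun u => u ^ m * exp (- (r * u) ^ 3)) 0 d) M)
      <= (6 * c * V * (D1 * 2 ^ (M + 5)) + W * (D2 * 2 ^ (M + 2))) / r ^ (M + 2)).
  { rewrite (sum_n_ext _ (fun m => RInt (fun u => g m * (u ^ m * exp (- (r * u) ^ 3))) 0 d))
      by (intros m; symmetry; apply RInt_scaled_kernel_scal).
    rewrite <- (RInt_sum_n (fun m u => g m * (u ^ m * exp (- (r * u) ^ 3))))
      by (intros; apply scaled_kernel_continuous).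
    unfold Im_int. change (len q) with d in *.
    assert (Sub := RInt_minus (V := R_CompleteNormedModule) _ _ 0 d Ex1 Ex2).
    unfold minus, plus, opp in Sub; simpl in Sub. unfold Rminus at 1. simpl. rewrite <- Sub. clear Sub.
    eapply Rle_trans; [apply abs_RInt_le; [lra|]|].
    { apply (ex_RInt_minus (V := R_NormedModule)); assumption. }
    eapply Rle_trans.
    - apply (RInt_le _ (fun u => INR n * c * V * (u ^ (M + 4) * exp (- (r / 2 * u) ^ 3)) +
        W * (u ^ S M * exp (- (r / 2 * u) ^ 3)))); [lra | | |].
      + apply (ex_RInt_norm (fun u => _)).
        apply (ex_RInt_minus (V := R_NormedModule)); assumption.
      + apply (ex_RInt_plus (V := R_NormedModule)); apply scaled_kernel_ex_RInt.
      + intros u Hu. apply Pt; [exact Hn1 | lra | exact Hn | lra].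
    - rewrite (RInt_plus (V := R_CompleteNormedModule)) by apply scaled_kernel_ex_RInt.
      rewrite !RInt_scaled_kernel_scal.
      destruct (HD1' (r / 2) d ltac:(lra) ltac:(lra)) as [_ L1].
      destruct (HD2' (r / 2) d ltac:(lra) ltac:(lra)) as [_ L2].
      assert (P2 : forall k, (r / 2) ^ k = r ^ k / 2 ^ k).
      { intros k. unfold Rdiv. rewrite Rpow_mult_distr, pow_inv. reflexivity. }
      rewrite P2 in L1, L2.
      assert (Hrk : forall k, 0 < r ^ k) by (intros; apply pow_lt; lra).
      assert (H2k : forall k, 0 < 2 ^ k) by (intros; apply pow_lt; lra).
      (* The moment of order [M + 4] is [O(r^{-(M+5)})] and the factor [n = 6 r^3] brings it to
         [r^{-(M+2)}]. *)
      assert (L1' : INR n * c * V * RInt (fun u => u ^ (M + 4) * exp (- (r / 2 * u) ^ 3)) 0 d <=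
                6 * c * V * (D1 * 2 ^ (M + 5)) / r ^ (M + 2)).
      { eapply Rle_trans.
        - apply Rmult_le_compat_l; [|exact L1].
          apply Rmult_le_pos; [|lra]. apply Rmult_le_pos; [apply pos_INR | exact Hc].
        - right. replace (S (M + 4)) with (M + 2 + 3)%nat by lia.
          replace (M + 5)%nat with (M + 2 + 3)%nat by lia.
          rewrite Hn, (pow_add r). assert (A := Hrk (M + 2)%nat). assert (A' := H2k (M + 2 + 3)%nat).
          field. repeat split; try lra. }
      assert (L2' : W * RInt (fun u => u ^ S M * exp (- (r / 2 * u) ^ 3)) 0 d <=
                W * (D2 * 2 ^ (M + 2)) / r ^ (M + 2)).
      { eapply Rle_trans.
        - apply Rmult_le_compat_l; [exact HW | exact L2].
        - right. replace (S (S M)) with (M + 2)%nat by lia.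
          assert (A := Hrk (M + 2)%nat). assert (A' := H2k (M + 2)%nat).
          field. split; lra. }
      eapply Rle_trans; [exact (Rplus_le_compat _ _ _ _ L1' L2')|]. right. unfold Rdiv. ring. }
  specialize (HD3' r Hr).
  match goal with |- Rabs (3 * ?I - ?S) <= _ =>
    match type of Main with Rabs (_ - ?T) <= _ =>
      replace (3 * I - S) with (3 * (I - T) + (3 * T - S)) by ring end end.
  eapply Rle_trans; [apply Rabs_triang|]. rewrite Rabs_mult, (Rabs_pos_eq 3) by lra.
  replace ((3 * (6 * c * V * (D1 * 2 ^ (M + 5)) + W * (D2 * 2 ^ (M + 2))) + D3) / r ^ (M + 2))
    with (3 * ((6 * c * V * (D1 * 2 ^ (M + 5)) + W * (D2 * 2 ^ (M + 2))) / r ^ (M + 2)) + D3 / r ^ (M + 2))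
    by (unfold Rdiv; ring).
  apply Rplus_le_compat; [apply Rmult_le_compat_l; [lra | exact Main] | exact HD3'].
Qed.

(** * The power series of [tau] *)

Definition has_pseries (f : R -> R) (a : nat -> R) : Prop :=
  locally 0 (fun s : R => is_pseries a s (f s)).

(** Convergence at one nonzero point suffices: outside the disc of convergence the terms do not tend
    to 0. *)
Lemma has_pseries_radius (f : R -> R) (a : nat -> R) :
  has_pseries f a -> Rbar_lt 0 (CV_radius a).
Proof.
  intros [d H].
  assert (Hd := cond_pos d).
  assert (Hx : is_pseries a (d / 2) (f (d / 2))).
  { apply H. change (Rabs (d / 2 - 0) < d). rewrite Rminus_0_r, Rabs_pos_eq; lra. }
  destruct (Rbar_lt_dec 0 (CV_radius a)) as [|Hn]; [assumption|exfalso].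
  apply (CV_disk_outside a (d / 2)).
  - apply Rbar_not_lt_le in Hn. eapply Rbar_le_lt_trans; [exact Hn|].
    simpl. rewrite Rabs_pos_eq; lra.
  - apply (is_lim_seq_ext (fun n => scal (pow_n (d / 2) n) (a n))).
    + intros n. rewrite pow_n_pow. unfold scal; simpl; unfold mult; simpl. ring.
    + apply ex_series_lim_0. eexists. exact Hx.
Qed.

Lemma has_pseries_PSeries (a : nat -> R) : Rbar_lt 0 (CV_radius a) -> has_pseries (PSeries a) a.
Proof.
  intros Ha. destruct (pos_lt_CV_radius a Ha) as [d [Hd H]].
  exists (mkposreal d Hd). intros s Hs. apply PSeries_correct, CV_radius_inside, H.
  change (Rabs (s - 0) < d) in Hs. now rewrite Rminus_0_r in Hs.
Qed.

Lemma has_pseries_eq (f g : R -> R) (a : nat -> R) :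
  locally 0 (fun s : R => f s = g s) -> has_pseries f a -> has_pseries g a.
Proof.
  intros E H. unfold has_pseries in *. generalize (filter_and _ _ E H). apply filter_imp.
  intros s [<- Hs]. exact Hs.
Qed.

Lemma has_pseries_unique (f : R -> R) (a b : nat -> R) (n : nat) :
  has_pseries f a -> has_pseries f b -> a n = b n.
Proof.
  intros Ha Hb. apply PSeries_ext_recip.
  - now apply (has_pseries_radius f).
  - now apply (has_pseries_radius f).
  - unfold has_pseries in *. generalize (filter_and _ _ Ha Hb). apply filter_imp.
    intros s [H1 H2]. rewrite (is_pseries_unique _ _ _ H1). symmetry. now apply is_pseries_unique.
Qed.

Lemma locally_CV_radius (a : nat -> R) :
  Rbar_lt 0 (CV_radius a) -> locally 0 (fun s : R => Rbar_lt (Rabs s) (CV_radius a)).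
Proof.
  intros Ha. destruct (pos_lt_CV_radius a Ha) as [d [Hd H]].
  exists (mkposreal d Hd). intros s Hs. apply H.
  change (Rabs (s - 0) < d) in Hs. now rewrite Rminus_0_r in Hs.
Qed.

Lemma has_pseries_mult (f g : R -> R) (a b : nat -> R) :
  has_pseries f a -> has_pseries g b -> has_pseries (fun s => f s * g s) (PS_mult a b).
Proof.
  intros Ha Hb. unfold has_pseries.
  assert (Ra := locally_CV_radius a (has_pseries_radius _ _ Ha)).
  assert (Rb := locally_CV_radius b (has_pseries_radius _ _ Hb)).
  generalize (filter_and _ _ (filter_and _ _ Ha Hb) (filter_and _ _ Ra Rb)). apply filter_imp.
  intros s [[H1 H2] [H3 H4]]. now apply is_pseries_mult.
Qed.

Lemma has_pseries_plus (f g : R -> R) (a b : nat -> R) :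
  has_pseries f a -> has_pseries g b -> has_pseries (fun s => f s + g s) (fun n => a n + b n).
Proof.
  intros Ha Hb. unfold has_pseries. generalize (filter_and _ _ Ha Hb). apply filter_imp.
  intros s [H1 H2]. exact (is_pseries_plus _ _ _ _ _ H1 H2).
Qed.

Lemma has_pseries_scal (c : R) (f : R -> R) (a : nat -> R) :
  has_pseries f a -> has_pseries (fun s => c * f s) (fun n => c * a n).
Proof.
  intros Ha. revert Ha. unfold has_pseries. apply filter_imp.
  intros s H. apply (is_pseries_scal (V := R_NormedModule) c a s _ (Rmult_comm _ _) H).
Qed.

Lemma has_pseries_incr (f : R -> R) (a : nat -> R) :
  has_pseries f a -> has_pseries (fun s => s * f s) (PS_incr_1 a).
Proof.
  intros Ha. revert Ha. unfold has_pseries. apply filter_imp.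
  intros s H. exact (is_pseries_incr_1 a s _ H).
Qed.

Definition PS_one (n : nat) : R := match n with 0%nat => 1 | S _ => 0 end.

Lemma has_pseries_one : has_pseries (fun _ => 1) PS_one.
Proof.
  unfold has_pseries. apply filter_forall. intros s.
  apply (filterlim_ext (fun _ => 1)); [|apply filterlim_const].
  intros n. induction n as [|n IH].
  - rewrite sum_O. symmetry. exact (Rmult_1_l 1).
  - rewrite sum_Sn, <- IH. change (1 = 1 + pow_n s (S n) * 0). ring.
Qed.

Lemma has_pseries_derive (a : nat -> R) :
  Rbar_lt 0 (CV_radius a) -> has_pseries (PSeries (PS_derive a)) (PS_derive a).
Proof. intros Ha. apply has_pseries_PSeries. now rewrite CV_radius_derive. Qed.

Lemma locally_is_derive_PSeries (a : nat -> R) :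
  Rbar_lt 0 (CV_radius a) ->
  locally 0 (fun s : R => is_derive (PSeries a) s (PSeries (PS_derive a) s)).
Proof.
  intros Ha. generalize (locally_CV_radius a Ha). apply filter_imp.
  intros s Hs. now apply is_derive_PSeries.
Qed.

Lemma eq_0_of_le_linear (c K d : R) :
  0 < d -> (forall s, 0 < s < d -> Rabs c <= K * s) -> c = 0.
Proof.
  intros Hd H. destruct (Req_dec c 0) as [|Hc]; [assumption|exfalso].
  assert (Hc' : 0 < Rabs c) by now apply Rabs_pos_lt.
  assert (HK := Rabs_pos K).
  set (s := Rmin (d / 2) (Rabs c / (2 * (Rabs K + 1)))).
  assert (Hq : 0 < Rabs c / (2 * (Rabs K + 1))) by (apply Rdiv_lt_0_compat; lra).
  assert (Hs : 0 < s) by (apply Rmin_glb_lt; lra).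
  assert (Hs1 : s <= d / 2) by apply Rmin_l.
  assert (Hs2 : s <= Rabs c / (2 * (Rabs K + 1))) by apply Rmin_r.
  specialize (H s ltac:(lra)).
  assert (K * s <= Rabs K * s) by (apply Rmult_le_compat_r; [lra | apply Rle_abs]).
  apply Rmult_le_compat_r with (r := 2 * (Rabs K + 1)) in Hs2; [|lra].
  unfold Rdiv in Hs2. rewrite Rmult_assoc, Rinv_l, Rmult_1_r in Hs2 by lra. nra.
Qed.

(** Differentiating the defining equation trades the logarithm for a first-order equation, stated on
    the series so that it can be truncated. *)
Lemma is_tau_pseries (tau : R -> R) :
  is_tau tau -> exists a,
    has_pseries tau a /\ a 0%nat = 0 /\ a 1%nat = 1 /\
    locally 0 (fun s : R => 0 < 1 - PSeries a s) /\
    locally 0 (fun s : R => (1 - (1 - PSeries a s) * exp (PSeries a s)) * PSeries (PS_derive a) s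
                            = (1 - PSeries a s) * (s ^ 2 / 2)).
Proof.
  intros [[a Ha] [[C HC] Heq]]. exists a.
  assert (Ra := has_pseries_radius tau a Ha).
  assert (HT : locally 0 (fun s : R => PSeries a s = tau s)).
  { revert Ha. unfold has_pseries. apply filter_imp. intros s. apply is_pseries_unique. }
  assert (H0 : a 0%nat = 0).
  { rewrite <- PSeries_0. rewrite (locally_singleton _ _ HT).
    assert (H := locally_singleton _ _ HC). simpl in H.
    rewrite Rminus_0_r, !Rmult_0_l, Rmult_0_r in H.
    destruct (Req_dec (tau 0) 0) as [|Hn]; [assumption|]. apply Rabs_pos_lt in Hn. lra. }
  (* Both [tau s - s] and [tau s - a 1 * s] are [O(s^2)]. *)
  assert (H1 : a 1%nat = 1).
  { apply Rminus_diag_uniq.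
    destruct (PSeries_partial_bigO a 2 Ra) as [K [d [HK [Hd B]]]].
    destruct (filter_and _ _ HT HC) as [d' H].
    apply (eq_0_of_le_linear _ (K + C) (Rmin d d')); [apply Rmin_glb_lt; [exact Hd | apply cond_pos]|].
    intros s Hs. assert (M1 := Rmin_l d d'). assert (M2 := Rmin_r d d').
    specialize (B s ltac:(lra)). destruct (H s) as [E1 E2].
    { change (Rabs (s - 0) < d'). rewrite Rminus_0_r, Rabs_pos_eq; lra. }
    replace (PSeries a s - partial_pseries a 2 s)%C with (RtoC (PSeries a s - a 1%nat * s)) in B.
    - rewrite Cmod_R, E1 in B.
      apply Rmult_le_reg_r with s; [lra|].
      replace (Rabs (a 1%nat - 1) * s) with (Rabs ((a 1%nat - 1) * s))
        by (rewrite Rabs_mult, (Rabs_pos_eq s); lra).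
      replace ((a 1%nat - 1) * s) with ((tau s - s) - (tau s - a 1%nat * s)) by ring.
      eapply Rle_trans; [apply Rabs_triang|]. rewrite Rabs_Ropp.
      replace ((K + C) * s * s) with (C * s ^ 2 + K * s ^ 2) by ring. lra.
    - unfold partial_pseries. simpl Csum. rewrite H0, RtoC_minus, RtoC_mult. ring. }
  (* Needed to differentiate [ln] and to clear the denominator. *)
  assert (Hpos : locally 0 (fun s : R => 0 < 1 - PSeries a s)).
  { assert (Hc : continuity_pt (PSeries a) 0)
      by (apply PSeries_continuity; rewrite Rabs_R0; exact Ra).
    apply continuity_pt_filterlim in Hc.
    assert (Hlt : locally (PSeries a 0) (fun y : R => y < 1)).
    { apply (open_lt 1). rewrite PSeries_0, H0. lra. }
    specialize (Hc _ Hlt). unfold filtermap in Hc. revert Hc. apply filter_imp. intros s Hs. lra. }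
  split; [exact Ha|]. split; [exact H0|]. split; [exact H1|]. split; [exact Hpos|].
  assert (HF : locally 0 (fun s : R => 1 - exp (PSeries a s) - ln (1 - PSeries a s) = s ^ 3 / 6)).
  { generalize (filter_and _ _ HT Heq). apply filter_imp. intros s [-> E]. symmetry; exact E. }
  (* The two sides must agree around each nearby [s], not only at it, for their derivatives to
     agree. *)
  apply locally_locally in HF.
  generalize (filter_and _ _ (filter_and _ _ HF Hpos) (locally_is_derive_PSeries a Ra)).
  apply filter_imp. intros s [[HFs Hp] HD].
  set (T := PSeries a s) in *. set (dT := PSeries (PS_derive a) s) in *.
  assert (D1 : is_derive (fun s => 1 - exp (PSeries a s) - ln (1 - PSeries a s)) s
                 (- (dT * exp T) + dT * / (1 - T))).
  { eapply is_derive_eq.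
    - apply (is_derive_minus (fun s => 1 - exp (PSeries a s)) (fun s => ln (1 - PSeries a s))).
      + apply (is_derive_minus (fun _ => 1) (fun s => exp (PSeries a s))).
        * exact (is_derive_const (V := R_NormedModule) 1 s).
        * apply (is_derive_Rcomp exp (PSeries a)); [apply is_derive_exp | exact HD].
      + apply (is_derive_Rcomp ln (fun s => 1 - PSeries a s)).
        * apply is_derive_ln. exact Hp.
        * apply (is_derive_minus (fun _ => 1) (PSeries a)); [|exact HD].
          exact (is_derive_const (V := R_NormedModule) 1 s).
    - unfold minus, plus, opp, zero; simpl. fold T. ring. }
  assert (D2 : is_derive (fun s => 1 - exp (PSeries a s) - ln (1 - PSeries a s)) s (s ^ 2 / 2)).
  { apply (is_derive_ext_loc (fun s => s ^ 3 / 6)).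
    - revert HFs. apply filter_imp. intros y E. symmetry; exact E.
    - auto_derive; [trivial | simpl; field]. }
  assert (E : - (dT * exp T) + dT * / (1 - T) = s ^ 2 / 2).
  { rewrite <- (is_derive_unique _ _ _ D1). now apply is_derive_unique. }
  rewrite <- E. field. lra.
Qed.

(** A second differentiation allows [e^T] to be eliminated, leaving an equation polynomial in [s],
    [T] and its derivatives, whose coefficients are Cauchy products. The nesting of products
    anticipates the series operations applied next. *)
Lemma is_tau_second_order (a : nat -> R) :
  Rbar_lt 0 (CV_radius a) ->
  locally 0 (fun s : R => (1 - (1 - PSeries a s) * exp (PSeries a s)) * PSeries (PS_derive a) s
                            = (1 - PSeries a s) * (s ^ 2 / 2)) ->
  locally 0 (fun s : R =>
    let T := PSeries a s in
    let dT := PSeries (PS_derive a) s in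
    let ddT := PSeries (PS_derive (PS_derive a)) s in
    s * (((1 - T) * (1 - T)) * dT)
      + - / 2 * (s * (s * ((1 - T) * (dT * dT) + ((1 - T) * (1 - T)) * ddT)))
    = ((dT + - / 2 * (s * (s * (1 - T)))) * T) * (dT * dT)).
Proof.
  intros Ra Hode. apply locally_locally in Hode.
  assert (Ra' : Rbar_lt 0 (CV_radius (PS_derive a))) by (rewrite CV_radius_derive; exact Ra).
  generalize (filter_and _ _ Hode (filter_and _ _ (locally_is_derive_PSeries a Ra)
    (locally_is_derive_PSeries _ Ra'))).
  apply filter_imp. intros s [Hs [D1 D2]].
  assert (Hs0 := locally_singleton _ _ Hs). cbv beta in Hs0.
  set (T := PSeries a s) in *. set (dT := PSeries (PS_derive a) s) in *.
  set (ddT := PSeries (PS_derive (PS_derive a)) s) in *. cbv zeta.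
  assert (DA : is_derive (fun s => 1 - PSeries a s) s (- dT)).
  { eapply is_derive_eq.
    - apply (is_derive_minus (fun _ => 1) (PSeries a)); [|exact D1].
      exact (is_derive_const (V := R_NormedModule) 1 s).
    - unfold minus, plus, opp, zero; simpl. ring. }
  assert (DE : is_derive (fun s => exp (PSeries a s)) s (dT * exp T)).
  { apply (is_derive_Rcomp exp (PSeries a)); [apply is_derive_exp | exact D1]. }
  assert (DL : is_derive (fun s => (1 - (1 - PSeries a s) * exp (PSeries a s)) * PSeries (PS_derive a) s) s
    ((dT * exp T - (1 - T) * (dT * exp T)) * dT + (1 - (1 - T) * exp T) * ddT)).
  { eapply is_derive_eq.
    - apply is_derive_Rmult; [|exact D2].
      apply (is_derive_minus (fun _ => 1) (fun s => (1 - PSeries a s) * exp (PSeries a s))).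
      + exact (is_derive_const (V := R_NormedModule) 1 s).
      + apply is_derive_Rmult; [exact DA | exact DE].
    - unfold minus, plus, opp, zero; simpl. fold T dT ddT. ring. }
  assert (DR : is_derive (fun s => (1 - PSeries a s) * (s ^ 2 / 2)) s (- dT * (s ^ 2 / 2) + (1 - T) * s)).
  { assert (DS : is_derive (fun s => s ^ 2 / 2) s s) by (auto_derive; [trivial | simpl; field]).
    exact (is_derive_Rmult _ _ _ _ _ DA DS). }
  assert (E : (dT * exp T - (1 - T) * (dT * exp T)) * dT + (1 - (1 - T) * exp T) * ddT
              = - dT * (s ^ 2 / 2) + (1 - T) * s).
  { rewrite <- (is_derive_unique _ _ _ DR).
    symmetry. apply is_derive_unique.
    apply (is_derive_ext_loc (fun s => (1 - (1 - PSeries a s) * exp (PSeries a s)) * PSeries (PS_derive a) s));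
      [exact Hs | exact DL]. }
  (* Both relations are linear in [exp T]; eliminate it between them. *)
  set (X := exp T) in *.
  assert (EX : (1 - T) * dT * X = dT - (1 - T) * (s ^ 2 / 2)) by lra.
  assert (E2 : (1 - T) * dT * ((T * dT * dT - (1 - T) * ddT) * X + ddT + dT * (s ^ 2 / 2) - (1 - T) * s) = 0).
  { replace ((T * dT * dT - (1 - T) * ddT) * X + ddT + dT * (s ^ 2 / 2) - (1 - T) * s) with 0; [ring|].
    lra. }
  replace ((1 - T) * dT * ((T * dT * dT - (1 - T) * ddT) * X + ddT + dT * (s ^ 2 / 2) - (1 - T) * s))
    with ((T * dT * dT - (1 - T) * ddT) * ((1 - T) * dT * X)
          + (1 - T) * dT * (ddT + dT * (s ^ 2 / 2) - (1 - T) * s)) in E2 by ring.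
  rewrite EX in E2. lra.
Qed.

Lemma is_tau_coefficient_recursion (a : nat -> R) (n : nat) :
  Rbar_lt 0 (CV_radius a) ->
  locally 0 (fun s : R => (1 - (1 - PSeries a s) * exp (PSeries a s)) * PSeries (PS_derive a) s
                            = (1 - PSeries a s) * (s ^ 2 / 2)) ->
  let b := fun n => PS_one n + - 1 * a n in
  let d := PS_derive a in
  PS_incr_1 (PS_mult (PS_mult b b) d) n
    + - / 2 * PS_incr_1 (PS_incr_1 (fun n => PS_mult b (PS_mult d d) n
                                    + PS_mult (PS_mult b b) (PS_derive d) n)) n
  = PS_mult (PS_mult (fun n => d n + - / 2 * PS_incr_1 (PS_incr_1 b) n) a) (PS_mult d d) n.
Proof.
  intros Ra Hode b d.
  assert (Rd : Rbar_lt 0 (CV_radius d)) by (unfold d; rewrite CV_radius_derive; exact Ra).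
  assert (Ha := has_pseries_PSeries a Ra). assert (Hd := has_pseries_derive a Ra).
  assert (Hdd := has_pseries_derive d Rd).
  assert (Hb := has_pseries_plus _ _ _ _ has_pseries_one (has_pseries_scal (- 1) _ _ Ha)).
  assert (Hb2 := has_pseries_mult _ _ _ _ Hb Hb). assert (Hd2 := has_pseries_mult _ _ _ _ Hd Hd).
  assert (HL := has_pseries_plus _ _ _ _
    (has_pseries_incr _ _ (has_pseries_mult _ _ _ _ Hb2 Hd))
    (has_pseries_scal (- / 2) _ _ (has_pseries_incr _ _ (has_pseries_incr _ _
      (has_pseries_plus _ _ _ _ (has_pseries_mult _ _ _ _ Hb Hd2) (has_pseries_mult _ _ _ _ Hb2 Hdd)))))).
  assert (HR := has_pseries_mult _ _ _ _ (has_pseries_mult _ _ _ _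
    (has_pseries_plus _ _ _ _ Hd (has_pseries_scal (- / 2) _ _ (has_pseries_incr _ _
       (has_pseries_incr _ _ Hb)))) Ha) Hd2).
  apply (has_pseries_unique _ _ _ n HL). revert HR. apply has_pseries_eq.
  generalize (is_tau_second_order a Ra Hode). apply filter_imp.
  intros s E. cbv zeta in E. symmetry.
  replace (1 + -1 * PSeries a s) with (1 - PSeries a s) by ring. exact E.
Qed.

(** For [n >= 2] the coefficient of [s^n] in the recursion is linear in [a n], with all other
    entries of lower index; collected on one side, its factor is [-(n+1)(n+2)/2], which is never
    0. *)
Lemma is_tau_coefficients (a : nat -> R) :
  Rbar_lt 0 (CV_radius a) -> a 0%nat = 0 -> a 1%nat = 1 ->
  locally 0 (fun s : R => (1 - (1 - PSeries a s) * exp (PSeries a s)) * PSeries (PS_derive a) s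
                            = (1 - PSeries a s) * (s ^ 2 / 2)) ->
  a 2%nat = - 5 / 12 /\ a 4%nat = - 1463 / 25920 /\ a 5%nat = 126827 / 5443200 /\
  a 7%nat = 4732223 / 1175731200.
Proof.
  intros Ra H0 H1 Hode.
  assert (E := fun n => is_tau_coefficient_recursion a n Ra Hode). cbv zeta in E.
  unfold PS_incr_1, PS_mult, PS_derive, PS_one in E.
  assert (H2 : a 2%nat = - 5 / 12).
  { specialize (E 2%nat). simpl in E. unfold zero in E; simpl in E. rewrite H0, H1 in E. lra. }
  (* [a 3], and [a 6] below, belong to the vanishing terms [m = 2] and [m = 5], but later
     coefficients depend on them. *)
  assert (H3 : a 3%nat = 11 / 80).
  { specialize (E 3%nat). simpl in E. unfold zero in E; simpl in E. rewrite H0, H1, H2 in E. lra. }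
  assert (H4 : a 4%nat = - 1463 / 25920).
  { specialize (E 4%nat). simpl in E. unfold zero in E; simpl in E. rewrite H0, H1, H2, H3 in E. lra. }
  assert (H5 : a 5%nat = 126827 / 5443200).
  { specialize (E 5%nat). simpl in E. unfold zero in E; simpl in E. rewrite H0, H1, H2, H3, H4 in E. lra. }
  assert (H6 : a 6%nat = - 15451 / 1612800).
  { specialize (E 6%nat). simpl in E. unfold zero in E; simpl in E. rewrite H0, H1, H2, H3, H4, H5 in E. lra. }
  assert (H7 : a 7%nat = 4732223 / 1175731200).
  { specialize (E 7%nat). simpl in E. unfold zero in E; simpl in E. rewrite H0, H1, H2, H3, H4, H5, H6 in E. lra. }
  repeat split; assumption.
Qed.

(** * The asymptotic expansion *)

Lemma dtau_coeffs_PS_derive (tau : R -> R) (B a : nat -> R) (m : nat) :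
  has_pseries tau a -> is_dtau_coeffs tau B -> (-1) ^ m * B m = PS_derive a m.
Proof.
  intros Ha HB. assert (Ra := has_pseries_radius _ _ Ha).
  apply (has_pseries_unique (Derive tau) (fun m => (-1) ^ m * B m) (PS_derive a)); [exact HB|].
  apply (has_pseries_eq (PSeries (PS_derive a))); [|now apply has_pseries_derive].
  assert (HT : locally 0 (fun s : R => PSeries a s = tau s)).
  { revert Ha. unfold has_pseries. apply filter_imp. intros s. apply is_pseries_unique. }
  apply locally_locally in HT.
  generalize (filter_and _ _ HT (locally_is_derive_PSeries a Ra)). apply filter_imp.
  intros s [E D]. rewrite <- (Derive_ext_loc _ _ s E). symmetry. now apply is_derive_unique.
Qed.

Lemma sin_INR_PI (k : nat) : sin (INR k * PI) = 0.
Proof. apply sin_eq_0_1. exists (Z.of_nat k). now rewrite INR_IZR_INZ. Qed.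

Lemma saddle_ode_RtoC (T dT s : R) :
  (1 - (1 - T) * exp T) * dT = (1 - T) * (s ^ 2 / 2) -> saddle_ode T dT s = 0.
Proof.
  intros H. unfold saddle_ode. rewrite Cexp_RtoC.
  replace (s * s / 2)%C with (RtoC (s ^ 2 / 2))
    by (rewrite RtoC_div, RtoC_pow by lra; simpl; field).
  rewrite <- !RtoC_minus, <- !RtoC_mult, <- RtoC_minus, <- !RtoC_mult, <- RtoC_minus.
  f_equal. lra.
Qed.

(** Replaces the real powers of [n / 6] by natural powers of its cube root; [6 <= n] gives
    [1 <= r]. *)
Lemma cube_root_scale (n : nat) :
  (6 <= n)%nat -> exists r, 1 <= r /\ INR n = 6 * r ^ 3 /\
    forall m, Rpower (INR n / 6) ((INR m + 1) / 3) = r ^ S m.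
Proof.
  intros Hn. apply le_INR in Hn. simpl in Hn.
  assert (H6 : 1 <= INR n / 6) by lra.
  exists (Rpower (INR n / 6) (/ 3)).
  assert (Hp : forall k, Rpower (INR n / 6) (/ 3) ^ k = Rpower (INR n / 6) (INR k / 3)).
  { intros k. rewrite <- Rpower_pow by (unfold Rpower; apply exp_pos).
    rewrite Rpower_mult. f_equal. field. }
  split; [|split].
  - rewrite <- (Rpower_O (INR n / 6)) by lra. apply Rle_Rpower; lra.
  - rewrite Hp. replace (INR 3 / 3) with 1 by (simpl; field). rewrite Rpower_1 by lra. field.
  - intros m. rewrite Hp, S_INR. reflexivity.
Qed.

(** [x = e n] gives [- x e^t = - n e^{1+t}], so the whole integrand becomes an [n]-th power. The
    constant is the one normalising [phase] to 1 at the saddle. *)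
Lemma touchard_integrand_phase (n : nat) (x : R) (t : C) :
  x = exp 1 * INR n -> t <> 0 ->
  (Cexp (RtoC (- x) * Cexp t) * (/ t) ^ n)%C = (RtoC ((-1) ^ n * exp (- INR n)) * phase t ^ n)%C.
Proof.
  intros -> Ht. unfold phase.
  replace (- Cexp (1 - Cexp (1 + t)) * / t)%C with (RtoC (-1) * (Cexp (1 - Cexp (1 + t)) * / t))%C
    by (apply C_eq; simpl; ring).
  rewrite !Cpow_mult_l, Cexp_pow, Cexp_plus, <- RtoC_pow, Cexp_RtoC.
  replace (INR n * (1 - exp 1 * Cexp t))%C
    with (RtoC (INR n) + RtoC (- (exp 1 * INR n)) * Cexp t)%C
    by (rewrite RtoC_opp, RtoC_mult; ring).
  rewrite Cexp_plus, Cexp_RtoC.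
  set (X := Cexp (RtoC (- (exp 1 * INR n)) * Cexp t)). set (Y := ((/ t) ^ n)%C).
  replace (RtoC ((-1) ^ n * exp (- INR n)) * (RtoC ((-1) ^ n) * (RtoC (exp (INR n)) * X * Y)))%C
    with (RtoC (((-1) ^ n * (-1) ^ n) * (exp (- INR n) * exp (INR n))) * (X * Y))%C
    by (rewrite !RtoC_mult; ring).
  rewrite <- exp_plus, <- Rpow_mult_distr.
  replace (-1 * -1) with 1 by ring. rewrite pow1.
  replace (- INR n + INR n) with 0 by ring. rewrite exp_0, Rmult_1_r. ring.
Qed.

(** On the arc [|phase|] is largest at the end shared with [q], so the integral is [O(e^{- c n})];
    with [n = 6 r^3 >= 6 r] this is below any power of [r]. *)
Lemma Im_int_closing_arc (q : path) (c : R) (p : nat) :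
  path_ok q -> (forall u, 0 <= u <= len q -> fst (pt q u) < 0) ->
  let z := pt q (len q) in
  0 <= snd z -> Cmod z <= 1 -> 0 < c -> Cmod (phase z) <= exp (- c) ->
  exists D, forall (n : nat) (r : R), 1 <= r -> INR n = 6 * r ^ 3 ->
    Rabs (Im_int (closing_arc q) (fun t => (phase t ^ n)%C)) <= D / r ^ p.
Proof.
  intros Hq Hneg z Hs Hz Hc Hph.
  assert (Hfz : fst z < 0) by (apply Hneg; split; [apply Hq | lra]).
  assert (Hr0 : 0 < Cmod z).
  { apply Cmod_gt_0. intros E. rewrite E in Hfz. simpl in Hfz. lra. }
  set (th := PI + atan (snd z / fst z)).
  assert (Hat : snd z / fst z <= 0).
  { unfold Rdiv. assert (/ fst z < 0) by now apply Rinv_lt_0_compat. nra. }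
  assert (Hth : 0 <= th <= PI).
  { unfold th. assert (B := atan_bound (snd z / fst z)). assert (P := PI_RGT_0).
    assert (atan (snd z / fst z) <= 0).
    { destruct Hat as [Hat|Hat].
      - apply atan_increasing in Hat. rewrite atan_0 in Hat. lra.
      - rewrite Hat, atan_0. lra. }
    lra. }
  assert (Hok : path_ok (closing_arc q)) by now apply arc_ok.
  destruct (Im_int_bound _ Hok) as [K [HK B]].
  destruct (exp_neg_le_inv_pow p (6 * c) ltac:(lra)) as [D [HD HD']].
  exists (K * D). intros n r Hr Hn.
  eapply Rle_trans.
  - apply (B _ (exp (- c) ^ n)).
    + apply path_derivable_pow, path_derivable_phase.
    + intros u Hu. rewrite Cmod_pow. apply pow_incr. split; [apply Cmod_ge_0|].
      eapply Rle_trans; [|exact Hph].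
      assert (E : pt (closing_arc q) th = z) by now apply polar_left_half_plane.
      rewrite <- E. apply phase_arc_monotone; [split; assumption | exact Hu | apply Hth].
  - replace (K * D / r ^ p) with (K * (D / r ^ p)) by (unfold Rdiv; ring).
    apply Rmult_le_compat_l; [lra|].
    eapply Rle_trans; [|apply HD'; lra].
    rewrite <- exp_INR_mult_pow. apply exp_le_compat. rewrite Hn.
    assert (r <= r ^ 3) by (simpl; nra). nra.
Qed.

(** The half loop consists of the arc and then the saddle path run backwards to -1; this reversal
    explains the sign of [- 3]. The paths depend on [M] through the truncation of the series. *)
Lemma touchard_contour_asymptotics (a : nat -> R) (M : nat) :
  Rbar_lt 0 (CV_radius a) -> a 0%nat = 0 -> a 1%nat = 1 ->
  locally 0 (fun s : R => (1 - (1 - PSeries a s) * exp (PSeries a s)) * PSeries (PS_derive a) s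
                            = (1 - PSeries a s) * (s ^ 2 / 2)) ->
  exists p q D, half_loop p q /\ forall (n : nat) (r : R),
    (1 <= n)%nat -> 1 <= r -> INR n = 6 * r ^ 3 ->
    Rabs (- 3 * contour_int p q (fun t => (phase t ^ n)%C)
          - sum_n (fun m => PS_derive a m * sin (INR (S m) * (PI / 3))
                            * (Gamma ((INR m + 1) / 3) / r ^ S m)) M) <= D / r ^ (M + 2).
Proof.
  intros Ra H0 H1 [e Hode].
  (* Truncation at degree [M + 2] gives the defect of order [M + 3] that [saddle_path_bounds]
     expects. *)
  assert (HA := partial_pseries_ode_bound a (S (S M)) ltac:(lia) Ra H0).
  destruct (saddle_path_bounds a M H0 H1) as [d [c [Hd [Hc [Hcd HB]]]]].
  { apply HA. exists e. split; [apply cond_pos|]. intros s Hs. apply saddle_ode_RtoC, Hode.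
    change (Rabs (s - 0) < e). rewrite Rminus_0_r, Rabs_pos_eq; lra. }
  set (q := saddle_path a (S (S M)) d) in *.
  assert (Hneg : forall u, 0 <= u <= len q -> fst (pt q u) < 0).
  { intros u Hu. destruct (HB u Hu) as [B1 _]. lra. }
  assert (Hok : path_ok q).
  { split; [simpl; lra|]. intros u Hu. split; [|split].
    - intros E. specialize (Hneg u Hu). rewrite E in Hneg. simpl in Hneg. lra.
    - apply is_Cderive_saddle_path.
    - apply Ccontinuous_saddle_path. }
  assert (Hq0 : Im (pt q 0) = 0).
  { unfold q. simpl pt. rewrite partial_pseries_shift, H0.
    replace (zeta * 0)%C with (RtoC 0) by ring. unfold Im; simpl. ring. }
  destruct (HB d ltac:(lra)) as [_ [Bs [Bz [Bp _]]]].
  (* Decay minus deviation: [1/6 - 1/24 = 1/8]. *)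
  assert (Hph : Cmod (phase (pt q (len q))) <= exp (- (d ^ 3 / 8))).
  { rewrite Cmod_mult, Cmod_R, Rabs_pos_eq in Bp by (left; apply exp_pos).
    change (pt q (len q)) with (pt q d).
    apply Rmult_le_reg_r with (exp (d ^ 3 / 6)); [apply exp_pos|].
    eapply Rle_trans; [exact Bp|]. rewrite <- exp_plus. apply exp_le_compat.
    replace (M + 4)%nat with (S M + 3)%nat by lia. rewrite pow_add, <- Rmult_assoc.
    assert (0 < d ^ 3) by (apply pow_lt; lra).
    assert (c * d ^ S M * d ^ 3 <= / 24 * d ^ 3) by (apply Rmult_le_compat_r; lra).
    lra. }
  destruct (Im_int_closing_arc q (d ^ 3 / 8) (M + 2) Hok Hneg Bs Bz) as [D1 HD1].
  { apply Rdiv_lt_0_compat; [apply pow_lt; lra | lra]. }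
  { exact Hph. }
  destruct (saddle_path_expansion a M d c Hd Hc Hcd Hok) as [D2 HD2].
  { intros u Hu. apply (HB u Hu). }
  exists (closing_arc q), q, (3 * D1 + D2). split; [now apply closing_arc_half_loop|].
  intros n r Hn1 Hr Hn. specialize (HD1 n r Hr Hn). specialize (HD2 n r Hn1 Hr Hn).
  fold q in HD2. unfold contour_int.
  match type of HD2 with Rabs (3 * ?I - ?S) <= _ =>
    match type of HD1 with Rabs ?J <= _ =>
      replace (- 3 * (J - I) - S) with (- (3 * J) + (3 * I - S)) by ring end end.
  eapply Rle_trans; [apply Rabs_triang|].
  rewrite Rabs_Ropp, Rabs_mult, (Rabs_pos_eq 3) by lra.
  replace ((3 * D1 + D2) / r ^ (M + 2)) with (3 * (D1 / r ^ (M + 2)) + D2 / r ^ (M + 2))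
    by (unfold Rdiv; ring).
  lra.
Qed.

Theorem theorem1 (tau : R -> R) (B : nat -> R)
    (Htau : is_tau tau) (HB : is_dtau_coeffs tau B) :
  (B 0%nat = 1 /\ B 1%nat = 5 / 6 /\ B 3%nat = 1463 / 6480 /\
   B 4%nat = 126827 / 1088640 /\ B 6%nat = 4732223 / 167961600) /\
  (forall n k : nat, (1 <= n)%nat -> expansion_term B n (3 * k + 2) = 0) /\
  (forall M : nat, exists (C : R) (N : nat), forall (n : nat) (x : R),
     (N <= n)%nat -> (1 <= n)%nat -> 0 < x -> INR n / x = 1 / exp 1 ->
     Rabs (scaled_touchard (n - 1) (- x)
             / ((-1) ^ (n - 1) * (exp (x - INR n) / (3 * PI)))
           - sum_n (fun m => expansion_term B n m) M)
       <= C * Rpower (INR n) (- ((INR M + 2) / 3))).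
Proof.
  destruct (is_tau_pseries tau Htau) as [a [Ha [H0 [H1 [_ Hode]]]]].
  assert (Ra := has_pseries_radius tau a Ha).
  assert (Hm := fun m => dtau_coeffs_PS_derive tau B a m Ha HB).
  split; [|split].
  - destruct (is_tau_coefficients a Ra H0 H1 Hode) as [H2 [H4 [H5 H7]]].
    assert (E0 := Hm 0%nat). assert (E1 := Hm 1%nat). assert (E3 := Hm 3%nat).
    assert (E4 := Hm 4%nat). assert (E6 := Hm 6%nat). unfold PS_derive in *.
    rewrite H1 in E0. rewrite H2 in E1. rewrite H4 in E3. rewrite H5 in E4. rewrite H7 in E6.
    simpl in E0, E1, E3, E4, E6. repeat split; lra.
  - intros n k _. unfold expansion_term.
    replace (PI * (INR (3 * k + 2) + 1) / 3) with (INR (S k) * PI).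
    + rewrite sin_INR_PI. ring.
    + rewrite plus_INR, mult_INR, S_INR. simpl. field.
  - intros M.
    destruct (touchard_contour_asymptotics a M Ra H0 H1 Hode) as [p [q [D [HL HD]]]].
    (* The bound obtained is in powers of [n / 6]; the constant converts it to powers of [n]. *)
    exists (Rabs D * Rpower (/ 6) (- ((INR M + 2) / 3))), 6%nat.
    intros n x Hn Hn1 Hx Hnx.
    assert (Ex : x = exp 1 * INR n).
    { assert (He := exp_pos 1). apply Rmult_eq_reg_r with (/ x * / exp 1).
      - replace (x * (/ x * / exp 1)) with (1 / exp 1) by (field; lra).
        rewrite <- Hnx. field. lra.
      - apply Rmult_integral_contrapositive_currified; apply Rinv_neq_0_compat; lra. }
    destruct (cube_root_scale n Hn) as [r [Hr [Hnr Hpow]]].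
    specialize (HD n r Hn1 Hr Hnr).
    assert (T := touchard_contour_int p q (n - 1) (- x) HL).
    replace (S (n - 1)) with n in T by lia.
    rewrite (contour_int_ext p q _ (fun t => (RtoC ((-1) ^ n * exp (- INR n)) * phase t ^ n)%C) HL) in T
      by (intros t Ht; now apply touchard_integrand_phase).
    rewrite contour_int_scal in T; [|exact HL | apply path_derivable_pow, path_derivable_phase].
    rewrite Ropp_involutive in T.
    set (I := contour_int p q (fun t => (phase t ^ n)%C)) in *.
    assert (HP := PI_RGT_0). assert (He := exp_pos (x - INR n)).
    assert (Hs : (-1) ^ (n - 1) <> 0) by (apply pow_nonzero; lra).
    (* The sign comes from [(-1)^n] in the integrand against [(-1)^(n-1)] in the prefactor, and [PI]
       from the half loop cancels. *)
    assert (Er : scaled_touchard (n - 1) (- x) / ((-1) ^ (n - 1) * (exp (x - INR n) / (3 * PI)))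
                 = - 3 * I).
    { assert (S1 : scaled_touchard (n - 1) (- x) = - ((-1) ^ (n - 1)) * exp (x - INR n) * I / PI).
      { apply Rmult_eq_reg_l with PI; [|lra]. rewrite T.
        replace (exp (x - INR n)) with (exp x * exp (- INR n)) by (rewrite <- exp_plus; reflexivity).
        replace ((-1) ^ n) with (- ((-1) ^ (n - 1))).
        - field. lra.
        - replace n with (S (n - 1)) at 2 by lia. simpl pow. ring. }
      rewrite S1. field. repeat split; lra. }
    rewrite Er.
    rewrite (sum_n_ext (fun m => expansion_term B n m) (fun m => PS_derive a m *
      sin (INR (S m) * (PI / 3)) * (Gamma ((INR m + 1) / 3) / r ^ S m))).
    + eapply Rle_trans; [exact HD|].
      assert (HrM : 0 < r ^ (M + 2)) by (apply pow_lt; lra).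
      assert (Hn0 : 6 <= INR n) by (apply le_INR in Hn; simpl in Hn; lra).
      replace (Rabs D * Rpower (/ 6) (- ((INR M + 2) / 3)) * Rpower (INR n) (- ((INR M + 2) / 3)))
        with (Rabs D / r ^ (M + 2)).
      * apply Rmult_le_compat_r; [left; now apply Rinv_0_lt_compat | apply Rle_abs].
      * rewrite Rmult_assoc, Rpower_mult_distr by lra.
        replace (/ 6 * INR n) with (INR n / 6) by (unfold Rdiv; ring).
        rewrite Rpower_Ropp. unfold Rdiv at 1. do 2 f_equal.
        replace (M + 2)%nat with (S (M + 1)) by lia. rewrite <- Hpow, plus_INR.
        f_equal. simpl. field.
    + intros m. unfold expansion_term. rewrite Hm, Hpow, S_INR.
      replace (PI * (INR m + 1) / 3) with ((INR m + 1) * (PI / 3)) by field.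
      assert (r ^ S m <> 0) by (apply pow_nonzero; lra).
      apply Rminus_diag_uniq. field. assumption.
Qed.
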